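(* Let $1\le m<n$ and let $\Omega\subset\mathbb C^n$ be a domain. For every $u\in\mathrm{SH}_m(\Omega)$ and every $a\in\Omega$, $$\nu_u(a)=2\lim_{r\downarrow0}\frac{M(u,a,r)}{\phi_m(r)}.$$
   Context: Let $\beta=dd^c|z|^2$ on $\mathbb C^n$. A real constant-coefficient $(1,1)$-form $\alpha$ is $m$-positive if $\alpha^k\wedge\beta^{n-k}\ge0$ for $1\le k\le m$. For an open set $\Omega\subset\mathbb C^n$, a locally integrable, upper semicontinuous function $u:\Omega\to[-\infty,\infty)$ is $m$-subharmonic, written $u\in \mathrm{SH}_m(\Omega)$, if it is subharmonic and $dd^c u\wedge\alpha_1\wedge\cdots\wedge\alpha_{m-1}\wedge\beta^{n-m}\ge0$ (as a current) for all constant-coefficient $m$-positive $(1,1)$-forms $\alpha_j$. For $1\le m<n$ put $\phi_m(r)=-\dfrac{1}{(n/m-1)\,r^{2(n/m-1)}}$, $r>0$. The $m$-Lelong number of $u$ at $a$ is $$\nu_u(a)=2\lim_{r\downarrow0}\frac{\lambda(u,a,r)}{\phi_m(r)},$$ where $\lambda(u,a,r)$ is the mean value of $u$ over the sphere $\{|z-a|=r\}$ (the limit is known to exist). For small $r>0$, $M(u,a,r)=\sup_{B(a,r)}u$, where $B(a,r)=\{|z-a|<r\}$. *)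

(* Defs.v *)
From HB Require Import structures.
From mathcomp Require Import all_boot all_order all_algebra.
From mathcomp Require Import complex.
From mathcomp Require Import all_classical all_reals all_analysis.
From mathcomp Require Import measurable_realfun.

Set Implicit Arguments.
Unset Strict Implicit.
Unset Printing Implicit Defensive.

Import Order.TTheory GRing.Theory Num.Theory.
Import numFieldNormedType.Exports.

Local Open Scope classical_set_scope.
Local Open Scope ring_scope.
Local Open Scope complex_scope.

(* C^n is 'rV[R[i]]_n.  With this instance R[i] carries the topology of the
   modulus and 'rV[R[i]]_n the product topology, i.e. the usual one of C^n. *)
HB.instance Definition _ (R : realType) := NormedModule.copy R[i] R[i]^o.

Section TuplePower.
Context d (T : measurableType d) (R : realType).
Variable m : {sigma_finite_measure set T -> \bar R}.
Local Open Scope ereal_scope.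

Definition tcons n (p : T * n.-tuple T) : n.+1.-tuple T := [tuple of p.1 :: p.2].

Lemma measurable_tcons n : measurable_fun [set: T * n.-tuple T] (@tcons n).
Proof. exact: measurable_cons measurable_fst measurable_snd. Qed.

Section step.
Variables (n : nat) (mu : {sigma_finite_measure set (n.-tuple T) -> \bar R}).

Definition power_step : set (n.+1.-tuple T) -> \bar R :=
  pushforward (m \x mu) (@tcons n).

Let power_step0 : power_step set0 = 0.
Proof. by rewrite /power_step /pushforward preimage_set0 measure0. Qed.

Let mcons (A : set (n.+1.-tuple T)) : measurable A -> measurable (@tcons n @^-1` A).
Proof. by move=> mA; rewrite -[X in measurable X]setTI; exact: measurable_tcons. Qed.

Let power_step_ge0 A : 0 <= power_step A.
Proof. by rewrite /power_step /pushforward; apply: measure_ge0. Qed.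

Let power_step_sigma_additive : semi_sigma_additive power_step.
Proof.
move=> F mF tF mUF; rewrite /power_step /pushforward preimage_bigcup.
apply: measure_semi_sigma_additive => [k||].
- exact: mcons.
- apply/trivIsetP => /= i j _ _ ij; rewrite -preimage_setI.
  by move/trivIsetP : tF => /(_ _ _ _ _ ij) ->//; rewrite preimage_set0.
- by rewrite -preimage_bigcup; exact: mcons.
Qed.

HB.instance Definition _ := isMeasure.Build _ _ _ power_step
  power_step0 power_step_ge0 power_step_sigma_additive.

Let sigma_finite_product : sigma_finite setT (m \x mu).
Proof.
have /sigma_finiteP[F [TF ndF Foo]] := sigma_finiteT m.
have /sigma_finiteP[G [TG ndG Goo]] := sigma_finiteT mu.
exists (fun n => F n `*` G n).
  rewrite -setXTT TF TG predeqE => -[x y]; split.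
    move=> [/= [i _ Fix] [k _ Gky]]; exists (maxn i k) => //; split.
    - by move: x Fix; exact/subsetPset/ndF/leq_maxl.
    - by move: y Gky; exact/subsetPset/ndG/leq_maxr.
  by move=> [i _ []/= ? ?]; split; exists i.
move=> k; have [? ?] := Foo k; have [? ?] := Goo k.
split; first exact: measurableX.
by rewrite product_measure1E// lte_mul_pinfty// ge0_fin_numE.
Qed.

Let power_step_sigma_finite : sigma_finite setT power_step.
Proof.
have [F TF Foo] := sigma_finite_product.
pose g (t : n.+1.-tuple T) : T * n.-tuple T := (thead t, [tuple of behead t]).
have gK : cancel (@tcons n) g.
  by case=> x t; rewrite /g /tcons theadE /=; congr pair; apply: val_inj.
have mg : measurable_fun setT g.
  by apply/measurable_fun_pairP; split;
    [exact: measurable_tnth | exact: measurable_behead].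
exists (fun k => g @^-1` F k); first by rewrite -preimage_bigcup -TF preimage_setT.
move=> k; have [mF Fk] := Foo k; split.
  by rewrite -[X in measurable X]setTI; exact: mg.
rewrite /power_step /pushforward (_ : @tcons n @^-1` _ = F k)//.
by apply/seteqP; split=> x /=; rewrite gK.
Qed.

HB.instance Definition _ := Measure_isSigmaFinite.Build _ _ _ power_step
  power_step_sigma_finite.
End step.

Fixpoint tuple_power n : {sigma_finite_measure set (n.-tuple T) -> \bar R} :=
  if n is n'.+1 then power_step (tuple_power n') else \d_([tuple]).

End TuplePower.

Section ComplexSpace.
Variables (R : realType) (n : nat).
Implicit Types (z a v : 'rV[R[i]]_n) (Om : set 'rV[R[i]]_n).

Definition sqnorm z : R := \sum_j (complex.Re (z 0 j) ^+ 2 + complex.Im (z 0 j) ^+ 2).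

Definition enorm z : R := Num.sqrt (sqnorm z).

Definition eball a (r : R) : set 'rV[R[i]]_n := [set z | enorm (z - a) < r].

Definition ecball a (r : R) : set 'rV[R[i]]_n := [set z | enorm (z - a) <= r].

Local Notation mC := ((n + n).-tuple (measurableTypeR R)).

(* Lebesgue integration over C^n = R^(2n) is integration over (n + n).-tuples
   (x_1, .., x_n, y_1, .., y_n), with z_j = x_j + i y_j. *)
Definition leb := tuple_power (@lebesgue_measure R) (n + n).

Definition toC (t : mC) : 'rV[R[i]]_n :=
  \row_j ((tnth t (lshift n j) : R) +i* (tnth t (rshift n j) : R)).

(* The normalized rotation-invariant measure on the sphere {|z - a| = r} is the
   image of the normalized Lebesgue measure of the unit ball under the radial
   projection z |-> a + r z / |z| (polar coordinates). *)
Definition sphere_mean (u : 'rV[R[i]]_n -> \bar R) a (r : R) : \bar R :=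
  let B := [set t | enorm (toC t) < 1] in
  ((fine (leb B))^-1%:E *
   \int[leb]_(t in B) u (a + (r / enorm (toC t))%:C *: toC t)%R)%E.

Definition sup_ball (u : 'rV[R[i]]_n -> \bar R) a (r : R) : \bar R :=
  ereal_sup (u @` eball a r).

Definition usc_on Om (u : 'rV[R[i]]_n -> \bar R) : Prop :=
  forall z, Om z -> forall c : R, (u z < c%:E)%E -> \forall w \near z, (u w < c%:E)%E.

Definition loc_integrable Om (u : 'rV[R[i]]_n -> \bar R) : Prop :=
  measurable_fun (toC @^-1` Om : set mC) (fun t : mC => u (toC t)) /\
  forall K, compact K -> K `<=` Om ->
    (\int[leb]_(t in toC @^-1` K) `|u (toC t)| < +oo)%E.

Definition subharmonic Om (u : 'rV[R[i]]_n -> \bar R) : Prop :=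
  usc_on Om u /\
  forall a r, 0 < r -> ecball a r `<=` Om -> (u a <= sphere_mean u a r)%E.

Definition rderive (V : 'rV[R[i]]_n) (f : 'rV[R[i]]_n -> R) z : R :=
  derive1 (fun t : R => f (z + t%:C *: V)) 0.

Definition cderive (V : 'rV[R[i]]_n) (f : 'rV[R[i]]_n -> R[i]) z : R[i] :=
  rderive V (fun w => complex.Re (f w)) z +i* rderive V (fun w => complex.Im (f w)) z.

Definition smooth (f : 'rV[R[i]]_n -> R) : Prop :=
  forall s : seq 'rV[R[i]]_n, let g := foldr rderive f s in
  continuous g /\ forall z v, derivable (fun t : R => g (z + t%:C *: v)) 0 1.

Definition test_function Om (chi : 'rV[R[i]]_n -> R) : Prop :=
  let S := closure [set z | chi z != 0] in
  [/\ smooth chi, compact S & S `<=` Om].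

(* d/dz_j = (d/dx_j - i d/dy_j) / 2 and d/dzbar_j = (d/dx_j + i d/dy_j) / 2 *)
Definition dw (j : 'I_n) (f : 'rV[R[i]]_n -> R[i]) z : R[i] :=
  (cderive (delta_mx 0 j) f z - 'i * cderive ('i *: delta_mx 0 j) f z) / 2.

Definition dwbar (j : 'I_n) (f : 'rV[R[i]]_n -> R[i]) z : R[i] :=
  (cderive (delta_mx 0 j) f z + 'i * cderive ('i *: delta_mx 0 j) f z) / 2.

(* Exterior algebra of the complexified real dual of C^n.  The generators are
   ordered as dz_1, .., dz_n, dzbar_1, .., dzbar_n, and w S is the coefficient of
   w on the increasing wedge product of the generators in S. *)
Definition ext_form := {ffun {set 'I_(n + n)} -> R[i]}.

Definition form1 : ext_form := [ffun S => (S == finset.set0)%:R].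

Definition gen (k : 'I_(n + n)) : ext_form := [ffun S => (S == [set k]%SET)%:R].

Definition dz (j : 'I_n) : ext_form := gen (lshift n j).
Definition dzbar (j : 'I_n) : ext_form := gen (rshift n j).

Definition inversions (A B : {set 'I_(n + n)}) : nat :=
  #|[set p : 'I_(n + n) * 'I_(n + n) | [&& p.1 \in A, p.2 \in B & (p.2 < p.1)%N]]%SET|.

Definition wedge (w1 w2 : ext_form) : ext_form :=
  [ffun S : {set 'I_(n + n)} => \sum_(A : {set 'I_(n + n)} | A \subset S)
    (-1) ^+ inversions A (S :\: A) * w1 A * w2 (S :\: A)%SET].

Definition wedges (s : seq ext_form) : ext_form := foldr wedge form1 s.

Definition wedge_exp (w : ext_form) (k : nat) : ext_form := iter k (wedge w) form1.

(* The Euclidean volume form, dx_j /\ dy_j being (i/2) dz_j /\ dzbar_j. *)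
Definition volume_form : ext_form :=
  wedges [seq ('i / 2 : R[i]) *: wedge (dz j) (dzbar j) | j <- enum 'I_n].

(* The function h such that the top degree part of w is h times the volume form;
   a top degree form is nonnegative when this coefficient is. *)
Definition density (w : ext_form) : R[i] := w [set: _]%SET / volume_form [set: _]%SET.

(* With d^c = i (dbar - d) one has dd^c = 2 i d dbar. *)
Definition form11 (A : 'M[R[i]]_n) : ext_form :=
  \sum_j \sum_k (2 * 'i * A j k) *: wedge (dz j) (dzbar k).

Definition ddc (f : 'rV[R[i]]_n -> R) z : ext_form :=
  form11 (\matrix_(j, k) dw j (dwbar k (fun w => (f w)%:C)) z).

(* dd^c |z|^2 has constant coefficients, so that it can be evaluated at 0. *)
Definition beta : ext_form := ddc sqnorm 0.

(* A real constant-coefficient (1,1)-form is form11 A with A Hermitian. *)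
Definition m_positive (m : nat) (A : 'M[R[i]]_n) : Prop :=
  (forall j k, A k j = (A j k)^*) /\
  forall k, (1 <= k <= m)%N ->
    0 <= density (wedge (wedge_exp (form11 A) k) (wedge_exp beta (n - k))).

(* Nonnegativity of the current dd^c u /\ al_1 /\ .. /\ al_(m-1) /\ beta^(n-m):
   its pairing with chi is the integral of u dd^c chi /\ al_1 /\ .. *)
Definition hessian_nonneg (m : nat) Om (u : 'rV[R[i]]_n -> \bar R) : Prop :=
  forall al : 'I_m.-1 -> 'M[R[i]]_n, (forall l, m_positive m (al l)) ->
  forall chi : 'rV[R[i]]_n -> R, test_function Om chi -> (forall z, 0 <= chi z) ->
  let T := wedge (wedges [seq form11 (al l) | l <- enum 'I_m.-1])
                 (wedge_exp beta (n - m)) in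
  (0 <= \int[leb]_(t in toC @^-1` Om)
    (u (toC t) * (complex.Re (density (wedge (ddc chi (toC t)) T)))%:E))%E.

(* Functions with values in [-oo, +oo[ on Om are represented by total functions,
   whose values outside Om are irrelevant. *)
Definition SH (m : nat) Om (u : 'rV[R[i]]_n -> \bar R) : Prop :=
  [/\ forall z, Om z -> (u z < +oo)%E,
      loc_integrable Om u,
      usc_on Om u,
      subharmonic Om u &
      hessian_nonneg m Om u].

Definition phi (m : nat) (r : R) : R :=
  - ((n%:R / m%:R - 1) * r `^ (2 * (n%:R / m%:R - 1)))^-1.

Definition lelong (m : nat) (u : 'rV[R[i]]_n -> \bar R) a : \bar R :=
  (2%:E * lim ((sphere_mean u a r * ((phi m r)^-1)%:E) @[r --> 0^'+]))%E.

End ComplexSpace.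

(* Main.v *)
(* Put p = n/m - 1, k0 = (m-1) n/m, F = -u and Psi(s) = s^(-p), so that
   phi_m(r) = - Psi(r^2) / p.  Testing the Hessian inequality with the extremal
   m-positive matrices I - (n/m) v, v the orthogonal projection onto a complex line
   C e, shows that F is a supersolution of each of the linear operators
   D_e f = p tr(ddbar f) + k0 <ddbar f (e), e>, and D_e kills Psi(|z - a|^2) at z
   when e is the radial direction at z.  If u(a) is finite both quotients tend to 0.
   Otherwise a comparison principle for F (mollify, then look at second differences
   at a minimum point) provides a largest l such that
   F >= l (Psi(|z - a|^2) - Psi(R1^2)) near a, and inf_{B(a,r)} F ~ l Psi(r^2).
   The spherical means of F are then at least about l Psi(r^2).  If one of them
   exceeded (l + d) Psi(r^2) for some small r, radial test functions concentrated
   near |z - a| = r would produce a ball, of radius comparable to r and centred near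
   that sphere, on which F exceeds l Psi(|z - a|^2) by a multiple of Psi(r^2); a Hopf
   barrier and a chain of balls spread this excess to the whole sphere, and the
   minimum principle contradicts inf_{B(a,r)} F ~ l Psi(r^2).  Hence both quotients
   tend to p l. *)
Require Import Defs.
From HB Require Import structures.
From mathcomp Require Import all_boot all_order all_algebra.
From mathcomp Require Import complex.
From mathcomp Require Import all_classical all_reals all_analysis.
From mathcomp Require Import measurable_realfun.
From mathcomp Require Import ring lra.

Set Implicit Arguments.
Unset Strict Implicit.
Unset Printing Implicit Defensive.

Import Order.TTheory GRing.Theory Num.Theory.
Import numFieldNormedType.Exports.

Local Open Scope classical_set_scope.
Local Open Scope ring_scope.
Local Open Scope complex_scope.

(** * Real calculus *)

(** Linear operators suffice because the comparison principle asks, at each point, for a single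
    direction in which the competitor is strictly positive, and this direction may vary with the
    point. The radial power, killed only by the operator of the radial direction, can thus be
    combined with barriers that are subsolutions in every direction. The delicate half is the upper
    bound of the spherical means: a mean over a thin sphere controls no single ball, and $F$ is
    merely lower semicontinuous. The mean is therefore traded for a solid integral with the weight
    $(|z-a|/r)^{2k}$. A large $k$ makes the inner ball negligible and leaves a shell, whose mass is
    estimated by averaging over small balls. Shell width, exponent, size of the small balls and Hopf
    constant are all fixed before $r$; this is possible since $\Psi(st)=\Psi(s)\Psi(t)$. The strict
    inequalities needed at minimum points come from small perturbations, such as $\tau|z-a|^2$ or a
    constant $\tau$, and $\tau$ tends to 0 at the end. *)

Section RealCalculus.
Variable R : realType.
Implicit Types (f g : R -> R) (x a b : R).
(* A plain definition, so that type-class resolution does not guess derivatives. *)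
Definition has_deriv f x a : Prop := is_derive x (1 : R) f a.
Local Notation D := has_deriv.

Lemma has_deriv_ext f g x a : f =1 g -> D f x a -> D g x a.
Proof. by move=> /funext ->. Qed.

Lemma has_deriv_eq f x a b : D f x a -> a = b -> D f x b.
Proof. by move=> ? <-. Qed.

Lemma has_derivP f x a : D f x a -> derivable f x 1 /\ f^`()%classic x = a.
Proof. by case=> df <-; rewrite derive1E. Qed.

Lemma has_deriv_near f g x a : (\forall y \near x, f y = g y) -> D f x a -> D g x a.
Proof. by move=> h df; apply: near_eq_is_derive df; rewrite ?oner_eq0//; near do rewrite h. Unshelve. all: end_near. Qed.

Lemma has_derivD f g x a b : D f x a -> D g x b -> D (fun y => f y + g y) x (a + b).
Proof. by move=> df dg; exact: is_deriveD. Qed.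

Lemma has_derivB f g x a b : D f x a -> D g x b -> D (fun y => f y - g y) x (a - b).
Proof. by move=> df dg; exact: is_deriveB. Qed.

Lemma has_derivN f x a : D f x a -> D (fun y => - f y) x (- a).
Proof. by move=> df; exact: is_deriveN. Qed.

Lemma has_derivM f g x a b : D f x a -> D g x b ->
  D (fun y => f y * g y) x (a * g x + f x * b).
Proof.
move=> df dg; have h := @is_deriveM _ _ f g x 1 a b df dg.
apply: (is_derive_eq h).
by rewrite /GRing.scale /= addrC [_ * a]mulrC.
Qed.

Lemma has_derivZ k f x a : D f x a -> D (fun y => k * f y) x (k * a).
Proof. by move=> df; exact: is_deriveZ. Qed.

Lemma has_derivX m f x a : D f x a ->
  D (fun y => f y ^+ m) x (m%:R * f x ^+ m.-1 * a).
Proof.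
move=> df; apply: (@has_deriv_ext (f ^+ m)); first by move=> y; rewrite fctE.
exact: (@is_deriveX _ _ f m x 1 a df).
Qed.

Lemma has_derivV f x a : f x != 0 -> D f x a ->
  D (fun y => (f y)^-1) x (- a / f x ^+ 2).
Proof.
move=> fx; case=> df dv; split; first exact: derivableV.
by rewrite deriveV// dv /GRing.scale /= mulrC mulrN mulNr.
Qed.

Lemma has_deriv_comp f g x a b : D g (f x) b -> D f x a ->
  D (fun y => g (f y)) x (b * a).
Proof. by move=> dg df; exact: is_derive1_comp. Qed.

Lemma has_deriv_continuous f x a : D f x a -> {for x, continuous f}.
Proof.
by case=> df _; apply/differentiable_continuous/derivable1_diffP.
Qed.

Lemma has_deriv_id x : D (fun y => y) x 1.
Proof. exact: is_derive_id. Qed.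

Lemma has_deriv_cst x c : D (fun=> c) x 0.
Proof. exact: is_derive_cst. Qed.

Lemma has_deriv_sqrM x c : D (fun y => y ^+ 2 * c) x (2 * x * c).
Proof.
apply: has_deriv_eq.
  by apply: has_derivM; [apply: has_derivX; exact: has_deriv_id|exact: has_deriv_cst].
by rewrite /=; ring.
Qed.

Lemma MVT_abs_le f g (t K : R) : 0 <= t ->
  (forall s, 0 <= s <= t -> D f s (g s)) ->
  (forall s, 0 <= s <= t -> `|g s| <= K) -> `|f t - f 0| <= K * t.
Proof.
rewrite le_eqVlt => /orP[/eqP <- _ _|t0 df gK]; first by rewrite subrr normr0 mulr0.
have [|s|c] := @MVT R f g 0 t t0.
- by move=> s; rewrite in_itv => /= /andP[a b]; apply: df; rewrite !ltW.
- apply: continuous_in_subspaceT => r; rewrite inE /= in_itv /= => rt.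
  exact: has_deriv_continuous (df _ rt).
- rewrite in_itv /= => /andP[a b] ->; rewrite subr0 normrM (gtr0_norm t0).
  by rewrite ler_pM2r// gK// !ltW.
Qed.

(** The mean value inequality is applied three times: to [f2] on both sides of 0, then to the odd
    part of [f1], then to the even part of [f], where the first order terms cancel. The error is
    explicit, so that it can later be integrated over a parameter. *)
Lemma second_difference_le f f1 f2 f3 (t C : R) : 0 <= t ->
  (forall s, D f s (f1 s)) -> (forall s, D f1 s (f2 s)) -> (forall s, D f2 s (f3 s)) ->
  (forall s, `|s| <= t -> `|f3 s| <= C) ->
  `|f t + f (- t) - 2 * f 0 - t ^+ 2 * f2 0| <= 2 * C * t ^+ 3.
Proof.
move=> t0 d0 d1 d2 f3C.
have C0 : 0 <= C by apply: le_trans (f3C 0 _); rewrite ?normr0.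
have dN h h1 s : (forall r, D h r (h1 r)) -> D (fun r => h (- r)) s (- h1 (- s)).
  move=> dh; have := has_deriv_comp (dh (- s)) (has_derivN (has_deriv_id s)).
  by rewrite mulrN1.
have f2b s : 0 <= s <= t -> `|f2 s - f2 0| <= C * s /\ `|f2 (- s) - f2 0| <= C * s.
  move=> /andP[s0 st]; split.
    apply: (MVT_abs_le s0 (fun r _ => d2 r)) => r /andP[r0 rs].
    by apply: f3C; rewrite ger0_norm// (le_trans rs).
  have := @MVT_abs_le (fun r => f2 (- r)) (fun r => - f3 (- r)) s C s0.
  rewrite oppr0; apply=> [r _|r]; first exact: (dN f2 f3).
  by move=> /andP[r0 rs]; rewrite normrN f3C// normrN ger0_norm// (le_trans rs).
pose g1 s := f1 s - f1 (- s) - 2 * s * f2 0.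
have dg1 s : D g1 s (f2 s + f2 (- s) - 2 * f2 0).
  apply: has_deriv_eq.
    apply: has_derivB; first exact: has_derivB (d1 s) (dN _ _ s d1).
    apply: (@has_deriv_ext (fun s => (2 * f2 0) * s)); first by move=> r; ring.
    by apply: has_derivZ; exact: has_deriv_id.
  by ring.
have g1b s : 0 <= s <= t -> `|g1 s| <= 2 * C * t * s.
  move=> /andP[s0 st].
  have -> : g1 s = g1 s - g1 0 by rewrite /g1 oppr0; ring.
  apply: (MVT_abs_le s0 (fun r _ => dg1 r)) => r /andP[r0 rs].
  have rt : 0 <= r <= t by rewrite r0 (le_trans rs).
  have [h1 h2] := f2b r rt.
  have -> : f2 r + f2 (- r) - 2 * f2 0 = (f2 r - f2 0) + (f2 (- r) - f2 0) by ring.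
  apply: le_trans (ler_normD _ _) _; apply: le_trans (lerD h1 h2) _.
  by have := ler_wpM2l C0 (le_trans rs st); lra.
pose g s := f s + f (- s) - 2 * f 0 - s ^+ 2 * f2 0.
have dg s : D g s (g1 s).
  apply: has_deriv_eq.
    apply: has_derivB; first apply: has_derivB.
    - exact: has_derivD (d0 s) (dN _ _ s d0).
    - exact: has_deriv_cst.
    - exact: has_deriv_sqrM.
  by rewrite /g1; ring.
have -> : f t + f (- t) - 2 * f 0 - t ^+ 2 * f2 0 = g t - g 0.
  by rewrite /g oppr0; ring.
have -> : 2 * C * t ^+ 3 = 2 * C * t * t * t by ring.
apply: (MVT_abs_le t0 (fun r _ => dg r)) => r /andP[r0 rs].
by apply: le_trans (g1b r _) _; rewrite ?r0// ler_wpM2l ?mulr_ge0.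
Qed.

(** A Peano version, with error o(t^2): [f1] is only assumed differentiable at 0, and [f] only near
    0. This suits powers such as [Psi], which are smooth only away from the origin. *)
Lemma second_difference_near f f1 (f2 d e : R) : 0 < d -> 0 < e ->
  (forall s, `|s| < d -> D f s (f1 s)) -> D f1 0 f2 ->
  exists2 t0, 0 < t0 & forall t, 0 < t < t0 ->
  `|f t + f (- t) - 2 * f 0 - t ^+ 2 * f2| <= e * t ^+ 2.
Proof.
move=> d0 e0 df [df1 f2E].
have : (h^-1 *: (f1 (h *: 1 + 0) - f1 0)) @[h --> 0^'] --> f2.
  by rewrite -f2E; exact: df1.
have e2 : 0 < e / 2 by rewrite divr_gt0.
move=> /cvgrPdist_le /(_ _ e2) /nbhs_ballP[t1 /= t10 h1].
have hb s : `|s| < t1 -> `|f1 s - f1 0 - s * f2| <= e / 2 * `|s|.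
  have [->|s0] := eqVneq s 0; first by rewrite mul0r subr0 subrr normr0 mulr0.
  move=> st; have := h1 s; rewrite /ball /= sub0r normrN => /(_ st s0).
  rewrite /GRing.scale /= mulr1 addr0 => h.
  have -> : f1 s - f1 0 - s * f2 = - s * (f2 - s^-1 * (f1 s - f1 0)) by field.
  by rewrite normrM normrN mulrC ler_wpM2r.
exists (Num.min d t1); first by rewrite lt_min d0.
move=> t /andP[t0]; rewrite lt_min => /andP[td tt1].
pose g s := f s + f (- s) - 2 * f 0 - s ^+ 2 * f2.
have -> : f t + f (- t) - 2 * f 0 - t ^+ 2 * f2 = g t - g 0.
  by rewrite /g oppr0; ring.
have -> : e * t ^+ 2 = e * t * t by ring.
apply: (@MVT_abs_le _ (fun s => f1 s - f1 (- s) - 2 * s * f2)) => [|s|s]; first exact: ltW.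
- move=> /andP[s0 st].
  have sd : `|s| < d by rewrite ger0_norm// (le_lt_trans st).
  apply: has_deriv_eq.
    apply: has_derivB; first apply: has_derivB.
    - apply: has_derivD; first exact: df.
      apply: has_deriv_comp; last by apply: has_derivN; exact: has_deriv_id.
      by apply: df; rewrite normrN.
    - exact: has_deriv_cst.
    - exact: has_deriv_sqrM.
  by ring.
- move=> /andP[s0 st].
  have st1 : `|s| < t1 by rewrite ger0_norm// (le_lt_trans st).
  have st1' : `|- s| < t1 by rewrite normrN.
  have -> : f1 s - f1 (- s) - 2 * s * f2 =
    (f1 s - f1 0 - s * f2) - (f1 (- s) - f1 0 - (- s) * f2) by ring.
  apply: le_trans (ler_normB _ _) _; apply: le_trans (lerD (hb _ st1) (hb _ st1')) _.
  rewrite normrN (ger0_norm s0) -mulrDl -splitr ler_wpM2l//; exact: ltW.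
Qed.
End RealCalculus.

(** * Lebesgue measure and the Euclidean structure *)

Section LebesgueAffine.
Variable R : realType.
Local Open Scope ereal_scope.
Local Notation lebR := (@lebesgue_measure R).
Local Notation mR := (measurableTypeR R).

Lemma measurable_aff1 (s b : R) :
  measurable_fun setT ((fun x => s * x + b)%R : mR -> mR).
Proof. by apply: measurable_funD => //; apply: measurable_funM. Qed.

(** As functions of [A] both sides are measures, and they agree on half-open intervals, which
    determine Lebesgue measure. *)
Lemma lebesgue_measure_aff1 (s b : R) (A : set R) : (0 < s)%R -> measurable A ->
  lebR A = s%:E * lebR ((fun x => s * x + b)%R @^-1` A).
Proof.
move=> s0; have mf := measurable_aff1 s b.
pose mu : {measure set mR -> \bar R} := mscale (NngNum (ltW s0))
    (pushforward lebR ((fun x => s * x + b)%R : mR -> mR)).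
move=> mA; rewrite -[RHS]/(mu mf A); apply: (@lebesgue_measure_unique R (mu mf) _ A mA) => _ [[x y] /= xy] <-.
rewrite /mu /mscale /= /pushforward.
have -> : (fun z : mR => (s * z + b)%R) @^-1` `]x, y]%classic =
          `]((x - b) / s)%R, ((y - b) / s)%R]%classic.
  apply/seteqP; split=> z /=; rewrite !in_itv /=;
    by rewrite ler_pdivlMr // ltr_pdivrMr // lerBrDr ltrBlDr [(z * s)%R]mulrC.
rewrite !lebesgue_measure_itv /= !lte_fin ltr_pM2r ?invr_gt0// ltrD2r.
case: ifP => _; last by rewrite mule0.
rewrite -!EFinB -EFinM; congr EFin.
by field; rewrite gt_eqF.
Qed.

Lemma integral_aff1 (s b : R) (f : mR -> \bar R) : (0 < s)%R ->
  measurable_fun setT f -> (forall x, 0 <= f x) ->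
  \int[lebR]_x f (s * x + b)%R = (s^-1)%:E * \int[lebR]_x f x.
Proof.
move=> s0 mf f0.
have maff := measurable_aff1 s b.
rewrite [in RHS](@eq_measure_integral _ _ _ _ (mscale (NngNum (ltW s0))
    (pushforward lebR ((fun x => s * x + b)%R : mR -> mR))) lebR); last first.
  by move=> A mA _; exact: (lebesgue_measure_aff1 b s0 mA).
rewrite ge0_integral_mscale//= ge0_integral_pushforward//= muleA -EFinM.
by rewrite mulVf ?gt_eqF// mul1e.
Qed.

Lemma integral_tcons n (m : {sigma_finite_measure set mR -> \bar R})
   (mu : {sigma_finite_measure set (n.-tuple mR) -> \bar R})
   (f : n.+1.-tuple mR -> \bar R) :
  measurable_fun setT f -> (forall x, 0 <= f x) ->
  \int[power_step m mu]_t f t = \int[m]_x \int[mu]_t f (tcons (x, t)).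
Proof.
move=> mf f0.
have mt := @measurable_tcons _ mR n.
have -> : \int[power_step m mu]_t f t = \int[m \x mu]_p f (tcons p).
  rewrite -[RHS](_ : \int[pushforward (m \x mu) (@tcons _ mR n)]_t f t = _) //.
  exact: ge0_integral_pushforward.
rewrite -(@fubini_tonelli1 _ _ _ _ _ m mu (fun p => f (tcons p))) //.
exact: measurableT_comp.
Qed.

Definition afft n (s : R) (b t : n.-tuple mR) : n.-tuple mR :=
  [tuple (s * tnth t i + tnth b i)%R | i < n].

Lemma measurable_afft n (s : R) (b : n.-tuple mR) : measurable_fun setT (afft s b).
Proof.
apply/measurable_fun_tnthP => i.
rewrite (_ : _ \o _ = (fun x => s * x + tnth b i)%R \o (@tnth n mR ^~ i)).
  by apply: measurableT_comp; [exact: measurable_aff1|exact: measurable_tnth].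
by apply/funext => t /=; rewrite tnth_mktuple.
Qed.

(** Tonelli peels off one coordinate at a time, each contributing a factor 1/s. Nonnegative
    integrands avoid every question of integrability. *)
Lemma integral_afft n (s : R) (b : n.-tuple mR) (f : n.-tuple mR -> \bar R) :
  (0 < s)%R -> measurable_fun setT f -> (forall x, 0 <= f x) ->
  \int[tuple_power lebR n]_t f (afft s b t) =
  ((s ^+ n)^-1)%:E * \int[tuple_power lebR n]_t f t.
Proof.
move=> s0; elim: n b f => [|n IH] b f mf f0.
  rewrite expr0 invr1 mul1e; apply: eq_integral => t _.
  by rewrite [t]tuple0 [afft _ _ _]tuple0.
have mf' x : measurable_fun setT (fun t : n.-tuple mR => f (tcons (x, t))).
  apply: (measurableT_comp mf).
  by apply: measurable_cons; [exact: measurable_cst|exact: measurable_id].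
rewrite /= integral_tcons//; last first.
  by apply: (measurableT_comp mf); exact: measurable_afft.
rewrite integral_tcons//.
pose g x := \int[tuple_power lebR n]_t f (tcons (x, t)).
have mg : measurable_fun setT (g : mR -> _).
  apply: (@measurable_fun_fubini_tonelli_F _ _ _ _ _ (tuple_power lebR n)
    (fun p : mR * n.-tuple mR => f (tcons p))) => //.
  by apply: (measurableT_comp mf); exact: measurable_tcons.
have g0 x : 0 <= g x by apply: integral_ge0.
transitivity (\int[lebR]_x ((s ^+ n)^-1%:E * g (s * x + thead b)%R)).
  apply: eq_integral => x _; rewrite /g -(IH [tuple of behead b])//.
  apply: eq_integral => t _; congr f; apply/eq_from_tnth => i.
  rewrite tnth_mktuple; have [->|[j ->]] : i = ord0 \/ exists j, i = lift ord0 j.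
    case: (unliftP ord0 i) => [j ->|->]; by [right; exists j|left].
  - by rewrite /tcons /= !tnth0.
  - rewrite /tcons /= !tnthS tnth_mktuple; congr (_ + _)%R.
    by rewrite tnth_behead; congr tnth; apply/val_inj; rewrite /= inordK// ltnS.
have mg' : measurable_fun setT (fun x : mR => g (s * x + thead b)%R).
  by apply: (measurableT_comp mg); exact: measurable_aff1.
rewrite ge0_integralZl_EFin; [|exact: measurableT|by move=> x _|exact: mg'|
  by rewrite invr_ge0 exprn_ge0// ltW].
rewrite integral_aff1// muleA -EFinM; congr (_%:E * _).
by rewrite exprS invfM mulrC.
Qed.
End LebesgueAffine.

Section RealToComplex.
Variable R : realType.
Lemma CMr (x y : R) : (x * y)%:C = x%:C * y%:C :> R[i].
Proof. exact: (rmorphM (real_complex R)). Qed.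
Lemma CBr (x y : R) : (x - y)%:C = x%:C - y%:C :> R[i].
Proof. exact: (rmorphB (real_complex R)). Qed.
Lemma CVr (x : R) : (x^-1)%:C = x%:C^-1 :> R[i].
Proof. exact: (fmorphV (real_complex R)). Qed.
Lemma CXr (x : R) j : (x ^+ j)%:C = x%:C ^+ j :> R[i].
Proof. exact: (rmorphXn (real_complex R)). Qed.
Lemma Cnat (j : nat) : (j%:R : R)%:C = j%:R :> R[i].
Proof. exact: (rmorph_nat (real_complex R)). Qed.

End RealToComplex.

Section EuclideanStructure.
Variables (R : realType) (n : nat).
Implicit Types (x y z : 'rV[R[i]]_n) (t : R).
Local Notation Re := complex.Re.
Local Notation Im := complex.Im.

(** The real part of the Hermitian product. The imaginary part is, up to sign, the product with
    ['i *: y], so that the squared modulus of the Hermitian product is a sum of two squares of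
    [rdot]. *)
Definition rdot x y : R :=
  \sum_j (Re (x 0 j) * Re (y 0 j) + Im (x 0 j) * Im (y 0 j)).

Lemma ReD (a b : R[i]) : Re (a + b) = Re a + Re b.
Proof. by case: a => ? ?; case: b. Qed.
Lemma ImD (a b : R[i]) : Im (a + b) = Im a + Im b.
Proof. by case: a => ? ?; case: b. Qed.
Lemma ReN (a : R[i]) : Re (- a) = - Re a. Proof. by case: a. Qed.
Lemma ImN (a : R[i]) : Im (- a) = - Im a. Proof. by case: a. Qed.
Lemma ReM (a b : R[i]) : Re (a * b) = Re a * Re b - Im a * Im b.
Proof. by case: a => ? ?; case: b. Qed.
Lemma ImM (a b : R[i]) : Im (a * b) = Re a * Im b + Im a * Re b.
Proof. by case: a => ? ?; case: b. Qed.
Lemma complex_eq (a b : R[i]) : Re a = Re b -> Im a = Im b -> a = b.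
Proof. by case: a => ? ?; case: b => ? ? /= -> ->. Qed.

Lemma sqnormE x : sqnorm x = rdot x x.
Proof. by apply: eq_bigr => j _; rewrite !expr2. Qed.

Lemma rdotC x y : rdot x y = rdot y x.
Proof. by apply: eq_bigr => j _; rewrite [in LHS]mulrC [X in _ + X]mulrC. Qed.

Lemma rdotDl x y z : rdot (x + y) z = rdot x z + rdot y z.
Proof.
rewrite /rdot -big_split /=; apply: eq_bigr => j _.
by rewrite mxE ReD ImD; ring.
Qed.

Lemma rdotDr x y z : rdot z (x + y) = rdot z x + rdot z y.
Proof. by rewrite rdotC rdotDl ![rdot _ z]rdotC. Qed.

Lemma rdotZl t x y : rdot (t%:C *: x) y = t * rdot x y.
Proof.
rewrite /rdot mulr_sumr; apply: eq_bigr => j _.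
by rewrite mxE ReM ImM /=; ring.
Qed.

Lemma rdotZr t x y : rdot x (t%:C *: y) = t * rdot x y.
Proof. by rewrite rdotC rdotZl rdotC. Qed.

Lemma rdotNl x y : rdot (- x) y = - rdot x y.
Proof.
rewrite /rdot -sumrN; apply: eq_bigr => j _.
by rewrite mxE ReN ImN; ring.
Qed.

Lemma rdotNr x y : rdot x (- y) = - rdot x y.
Proof. by rewrite rdotC rdotNl rdotC. Qed.

Lemma rdotIZ x y : rdot ('i *: x) ('i *: y) = rdot x y.
Proof.
apply: eq_bigr => j _.
by rewrite !mxE !ReM !ImM /=; ring.
Qed.

Lemma rdotxI x : rdot x ('i *: x) = 0.
Proof.
apply: big1 => j _.
by rewrite !mxE !ReM !ImM /=; ring.
Qed.

Lemma sqnorm_ge0 x : 0 <= sqnorm x.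
Proof. by apply: sumr_ge0 => j _; rewrite addr_ge0// sqr_ge0. Qed.

Lemma sqnorm0 : sqnorm (0 : 'rV[R[i]]_n) = 0.
Proof. by apply: big1 => j _; rewrite mxE /= expr0n /= addr0. Qed.

Lemma sqnormD x y : sqnorm (x + y) = sqnorm x + 2 * rdot x y + sqnorm y.
Proof. by rewrite !sqnormE rdotDl !rdotDr [rdot y x]rdotC; ring. Qed.

Lemma sqnormZ t x : sqnorm (t%:C *: x) = t ^+ 2 * sqnorm x.
Proof. by rewrite !sqnormE rdotZl rdotZr mulrA expr2. Qed.

Lemma sqnormN x : sqnorm (- x) = sqnorm x.
Proof. by rewrite !sqnormE rdotNl rdotNr opprK. Qed.

Lemma sqnormI x : sqnorm ('i *: x) = sqnorm x.
Proof. by rewrite !sqnormE rdotIZ. Qed.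

Lemma sqnorm_eq0 x : (sqnorm x == 0) = (x == 0).
Proof.
apply/eqP/eqP => [/eqP|->]; last exact: sqnorm0.
rewrite psumr_eq0 => [/allP h|j _]; last by rewrite addr_ge0// sqr_ge0.
apply/rowP => j; have := h j (mem_index_enum j).
rewrite paddr_eq0 ?sqr_ge0// !sqrf_eq0 => /andP[/eqP a /eqP b].
by rewrite mxE; apply: complex_eq.
Qed.

(** Cauchy-Schwarz, from the nonnegative squared norm of |y|^2 x - (x, y) y. *)
Lemma rdot_sqr_le x y : rdot x y ^+ 2 <= sqnorm x * sqnorm y.
Proof.
have [y0|y0] := eqVneq (sqnorm y) 0.
  move/eqP: (y0); rewrite sqnorm_eq0 => /eqP ->.
  rewrite -[0 : 'rV__](scale0r (0 : 'rV[R[i]]_n)) -[0 : R[i]]/(0%:C) rdotZr.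
  by rewrite sqnormZ mul0r expr0n /= mul0r mulr0.
have y1 : 0 < sqnorm y by rewrite lt_def y0 sqnorm_ge0.
have := sqnorm_ge0 ((sqnorm y)%:C *: x - (rdot x y)%:C *: y).
rewrite sqnormD sqnormN !sqnormZ rdotNr rdotZl rdotZr.
move=> h; rewrite -(ler_pM2l y1) -subr_ge0; apply: le_trans h _.
rewrite le_eqVlt; apply/orP; left; apply/eqP; ring.
Qed.

Lemma enorm_ge0 x : 0 <= enorm x. Proof. exact: sqrtr_ge0. Qed.

Lemma sqr_enorm x : enorm x ^+ 2 = sqnorm x.
Proof. by rewrite sqr_sqrtr// sqnorm_ge0. Qed.

Lemma enorm0 : enorm (0 : 'rV[R[i]]_n) = 0.
Proof. by rewrite /enorm sqnorm0 sqrtr0. Qed.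

Lemma enorm_eq0 x : (enorm x == 0) = (x == 0).
Proof. by rewrite -sqnorm_eq0 -sqr_enorm sqrf_eq0. Qed.

Lemma enorm_gt0 x : (0 < enorm x) = (x != 0).
Proof. by rewrite lt_def enorm_ge0 andbT enorm_eq0. Qed.

Lemma enormZ t x : enorm (t%:C *: x) = `|t| * enorm x.
Proof. by rewrite /enorm sqnormZ sqrtrM ?sqr_ge0// sqrtr_sqr. Qed.

Lemma enormN x : enorm (- x) = enorm x.
Proof. by rewrite /enorm sqnormN. Qed.

Lemma enormB x y : enorm (x - y) = enorm (y - x).
Proof. by rewrite -enormN opprB. Qed.

Lemma enormI x : enorm ('i *: x) = enorm x.
Proof. by rewrite /enorm sqnormI. Qed.

Lemma ler_rdot x y : `|rdot x y| <= enorm x * enorm y.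
Proof.
rewrite -(@ler_pXn2r _ 2) ?nnegrE ?mulr_ge0 ?enorm_ge0//.
by rewrite exprMn !sqr_enorm real_normK ?num_real// rdot_sqr_le.
Qed.

Lemma ler_enormD x y : enorm (x + y) <= enorm x + enorm y.
Proof.
rewrite -(@ler_pXn2r _ 2) ?nnegrE ?addr_ge0 ?enorm_ge0//.
rewrite sqr_enorm sqnormD sqrrD !sqr_enorm.
have := ler_rdot x y; have := ler_norm (rdot x y); lra.
Qed.

Lemma ler_enorm_dist x y z : enorm (x - z) <= enorm (x - y) + enorm (y - z).
Proof. by rewrite -[x - z](subrKA y) ler_enormD. Qed.

Lemma ler_enorm_sub x y : enorm x - enorm y <= enorm (x - y).
Proof. by rewrite lerBlDr -[X in enorm X <= _](subrK y) ler_enormD. Qed.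

Lemma Re_le_enorm x j : `|Re (x 0 j)| <= enorm x.
Proof.
rewrite -(@ler_pXn2r _ 2) ?nnegrE ?enorm_ge0// real_normK ?num_real//.
rewrite sqr_enorm /sqnorm (bigD1 j)//= -addrA lerDl addr_ge0 ?sqr_ge0//.
by apply: sumr_ge0 => k _; rewrite addr_ge0 ?sqr_ge0.
Qed.

Lemma Im_le_enorm x j : `|Im (x 0 j)| <= enorm x.
Proof. by have := Re_le_enorm (- ('i *: x)) j; rewrite enormN enormI !mxE ReN ReM /= mul0r mul1r sub0r opprK. Qed.

Lemma enorm_le_sum x : enorm x <= \sum_j (`|Re (x 0 j)| + `|Im (x 0 j)|).
Proof.
have s0 : 0 <= \sum_j (`|Re (x 0 j)| + `|Im (x 0 j)|).
  by apply: sumr_ge0 => k _; rewrite addr_ge0.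
rewrite -(@ler_pXn2r _ 2) ?nnegrE ?enorm_ge0// sqr_enorm.
have H : forall (s : seq 'I_n),
   \sum_(j <- s) (Re (x 0 j) ^+ 2 + Im (x 0 j) ^+ 2) <=
   (\sum_(j <- s) (`|Re (x 0 j)| + `|Im (x 0 j)|)) ^+ 2.
  elim=> [|j s IH]; first by rewrite !big_nil expr0n.
  rewrite !big_cons sqrrD.
  have t0 : 0 <= \sum_(j <- s) (`|Re (x 0 j)| + `|Im (x 0 j)|).
    by apply: sumr_ge0 => k _; rewrite addr_ge0.
  have a0 := normr_ge0 (Re (x 0 j)); have b0 := normr_ge0 (Im (x 0 j)).
  have := sqrrD `|Re (x 0 j)| `|Im (x 0 j)|.
  rewrite !real_normK ?num_real// => ->.
  have := mulr_ge0 a0 b0; have := mulr_ge0 (addr_ge0 a0 b0) t0; lra.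
exact: H.
Qed.
End EuclideanStructure.

Section EuclideanTopology.
Variables (R : realType) (n : nat).
Implicit Types (x y z : 'rV[R[i]]_n) (t : R).
Local Notation Re := complex.Re.
Local Notation Im := complex.Im.

(** Links the entrywise topology, whose balls have radii in [R[i]] (a positive complex number being
    real), to Euclidean balls, which serve as neighbourhoods from here on. *)
Lemma nbhs_eballP z (A : set 'rV[R[i]]_n) :
  nbhs z A <-> exists2 r : R, 0 < r & eball z r `<=` A.
Proof.
split.
- move=> /nbhs_ballP[e /= e0 zA].
  have eE : e = (Re e)%:C by case: e e0 {zA} => a b /andP[/= /eqP -> _].
  have e1 : 0 < Re e by move: e0; rewrite {1}eE ltcR.
  exists (Re e) => // w wz; apply: zA; split=> // i j.
  rewrite ord1 -ball_normE /= eE normc_def ltcR.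
  apply: le_lt_trans wz; rewrite enormB /enorm ler_sqrt ?sqnorm_ge0//.
  rewrite /sqnorm (bigD1 j)//= !mxE lerDl.
  by apply: sumr_ge0 => k _; rewrite addr_ge0 ?sqr_ge0.
(* Each of the 2n real coordinates is below r / (2 (n + 1)), so their sum is at most r n / (n + 1) <
   r. Using [n.+1] keeps the radius meaningful for n = 0. *)
- move=> [r r0 zA]; apply/nbhs_ballP; exists (r / (2 * n.+1%:R))%:C => /=.
    by rewrite ltcR divr_gt0// mulr_gt0.
  move=> w [_ wz]; apply: zA; rewrite /eball /= enormB.
  apply: le_lt_trans (enorm_le_sum _) _.
  apply: (@le_lt_trans _ _ (\sum_(j < n) (r / n.+1%:R))).
    apply: ler_sum => j _; have := wz 0 j.
    rewrite -ball_normE /= => h.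
    have e1 : `|Re (z 0 j - w 0 j)| < r / (2 * n.+1%:R).
      by have := le_lt_trans (normc_ge_Re _) h; rewrite ltcR.
    have e2 : `|Im (z 0 j - w 0 j)| < r / (2 * n.+1%:R).
      move: h; rewrite normc_def ltcR; apply: le_lt_trans.
      by rewrite -sqrtr_sqr ler_sqrt ?addr_ge0 ?sqr_ge0// lerDr sqr_ge0.
    rewrite !mxE; have := ltW e1; have := ltW e2.
    have -> : r / n.+1%:R = r / (2 * n.+1%:R) + r / (2 * n.+1%:R).
      have -> : r / (2 * n.+1%:R) = r / n.+1%:R / 2 by rewrite invfM mulrCA mulrC.
      by rewrite -splitr.
    by move=> ? ?; exact: lerD.
  rewrite sumr_const card_ord -[X in X < _]mulr_natr -mulrA gtr_pMr// mulrC.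
  by rewrite ltr_pdivrMr// mul1r ltr_nat.
Qed.

Lemma sqrt_sqrD_le (x y : R) : Num.sqrt (x ^+ 2 + y ^+ 2) <= `|x| + `|y|.
Proof.
rewrite -(@ler_pXn2r _ 2) ?nnegrE ?sqrtr_ge0 ?addr_ge0//.
rewrite sqr_sqrtr ?addr_ge0 ?sqr_ge0// sqrrD !real_normK ?num_real//.
by have := mulr_ge0 (normr_ge0 x) (normr_ge0 y); lra.
Qed.

Lemma continuous_complex : continuous ((fun p => p.1 +i* p.2) : R * R -> R[i]).
Proof.
move=> [a b] /=; apply/cvgrPdist_lt => e e0.
have eE : e = (Re e)%:C by case: e e0 => c d /andP[/= /eqP -> _].
have e1 : 0 < Re e by move: e0; rewrite {1}eE ltcR.
have e2 : 0 < Re e / 2 by rewrite divr_gt0.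
have Ha : \forall p \near (a, b), `|a - p.1| < Re e / 2.
  exists ([set x | `|a - x| < Re e / 2], setT) => /=; last by move=> ? [].
  split; last exact: filterT.
  by apply/nbhs_ballP; exists (Re e / 2) => //= x; rewrite -ball_normE.
have Hb : \forall p \near (a, b), `|b - p.2| < Re e / 2.
  exists (setT, [set x | `|b - x| < Re e / 2]) => /=; last by move=> ? [].
  split; first exact: filterT.
  by apply/nbhs_ballP; exists (Re e / 2) => //= x; rewrite -ball_normE.
near=> p.
have h1 : `|a - p.1| < Re e / 2 by near: p.
have h2 : `|b - p.2| < Re e / 2 by near: p.
rewrite eE normc_def ltcR /=.
apply: (@le_lt_trans _ _ (`|a - p.1| + `|b - p.2|)); last by lra.
exact: sqrt_sqrD_le.
Unshelve. all: by end_near. Qed.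

Lemma closed_ecball z (r : R) : closed (ecball z r).
Proof.
move=> w /= cw; rewrite /ecball /= leNgt; apply/negP => rw.
have [|v [zv wv]] := cw (eball w (enorm (w - z) - r)).
  by apply/nbhs_eballP; exists (enorm (w - z) - r) => //; rewrite subr_gt0.
move: zv wv; rewrite /ecball /eball /= => zv wv.
have := ler_enorm_dist w v z; rewrite [enorm (v - w)]enormB in wv.
by move=> h; lra.
Qed.

(** A closed subset of a product of closed squares. *)
Lemma compact_ecball z (r : R) : compact (ecball z r).
Proof.
pose M := r + enorm z.
pose Q := (fun p : R * R => p.1 +i* p.2) @` (`[- M, M] `*` `[- M, M]).
have cQ : compact Q.
  apply: continuous_compact; last by apply: compact_setX; exact: segment_compact.
  by apply: continuous_subspaceT => x; exact: continuous_complex.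
apply: (subclosed_compact (@closed_ecball z r) (rV_compact (fun _ => cQ))).
move=> w /= zw j; exists (Re (w 0 j), Im (w 0 j)); last by case: (w _ _).
have wM : enorm w <= M.
  by have := ler_enorm_sub w z; move: zw; rewrite /ecball /= /M; lra.
have hr := le_trans (Re_le_enorm w j) wM.
have hi := le_trans (Im_le_enorm w j) wM.
by split; rewrite /= in_itv /= -ler_norml.
Qed.
End EuclideanTopology.

Section TupleCoordinates.
Variables (R : realType) (n : nat).
Local Open Scope ereal_scope.
Local Notation mR := (measurableTypeR R).
Local Notation mC := ((n + n).-tuple mR).
Local Notation V := 'rV[R[i]]_n.

Definition ofC (z : V) : mC :=
  [tuple match fintype.split i with
         | inl j => complex.Re (z 0%R j) | inr j => complex.Im (z 0%R j) end | i < n + n].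

Lemma ofCK : cancel ofC (@toC R n).
Proof.
move=> z; apply/rowP => j; rewrite mxE !tnth_mktuple.
by rewrite (unsplitK (inl j)) (unsplitK (inr j)); case: (z 0%R j).
Qed.

Lemma toC_afft (s : R) (b t : mC) :
  toC (afft s b t) = (s%:C *: toC t + toC b)%R.
Proof.
apply/rowP => j; rewrite !mxE !tnth_mktuple.
by apply: complex_eq; rewrite ?ReD ?ImD ?ReM ?ImM /= ?mul0r ?subr0 ?addr0.
Qed.

Lemma measurable_to_mC d (T : measurableType d) (f : T -> V) :
  (forall j, measurable_fun setT (fun x => complex.Re (f x 0%R j))) ->
  (forall j, measurable_fun setT (fun x => complex.Im (f x 0%R j))) ->
  measurable_fun setT (fun x => ofC (f x)).
Proof.
move=> mr mi; apply/measurable_fun_tnthP => i.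
case: (split_ordP i) => j ->.
- apply: eq_measurable_fun (mr j) => x _.
  by rewrite /= tnth_mktuple (unsplitK (inl j)).
- apply: eq_measurable_fun (mi j) => x _.
  by rewrite /= tnth_mktuple (unsplitK (inr j)).
Qed.

Lemma measurable_ReC j : measurable_fun setT (fun t : mC => complex.Re (toC t 0%R j)).
Proof.
rewrite (_ : (fun _ => _) = (@tnth _ mR ^~ (lshift n j))); first exact: measurable_tnth.
by apply/funext => t; rewrite mxE.
Qed.

Lemma measurable_ImC j : measurable_fun setT (fun t : mC => complex.Im (toC t 0%R j)).
Proof.
rewrite (_ : (fun _ => _) = (@tnth _ mR ^~ (rshift n j))); first exact: measurable_tnth.
by apply/funext => t; rewrite mxE.
Qed.

Lemma measurable_sqnorm d (T : measurableType d) (f : T -> V) :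
  (forall j, measurable_fun setT (fun x => complex.Re (f x 0%R j))) ->
  (forall j, measurable_fun setT (fun x => complex.Im (f x 0%R j))) ->
  measurable_fun setT (fun x => sqnorm (f x)).
Proof.
move=> mr mi; apply: measurable_sum => j.
by apply: measurable_funD; apply: measurable_funX.
Qed.

Lemma measurable_enorm d (T : measurableType d) (f : T -> V) :
  (forall j, measurable_fun setT (fun x => complex.Re (f x 0%R j))) ->
  (forall j, measurable_fun setT (fun x => complex.Im (f x 0%R j))) ->
  measurable_fun setT (fun x => enorm (f x)).
Proof.
move=> mr mi; apply: measurableT_comp; last exact: measurable_sqnorm.
by apply: continuous_measurable_fun; exact: sqrt_continuous.
Qed.

Lemma integral_translate (c : V) (f : V -> \bar R) :
  measurable_fun setT (f \o @toC R n) -> (forall z, 0 <= f z) ->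
  \int[leb R n]_t f (toC t + c)%R = \int[leb R n]_t f (toC t).
Proof.
move=> mf f0.
have := @integral_afft R (n + n) 1%R (ofC c) (f \o @toC R n) ltr01 mf (fun t => f0 (toC t)).
rewrite expr1n invr1 mul1e => <-; apply: eq_integral => t _ /=.
by rewrite toC_afft ofCK scale1r.
Qed.

Lemma integral_scale (s : R) (f : V -> \bar R) : (0 < s)%R ->
  measurable_fun setT (f \o @toC R n) -> (forall z, 0 <= f z) ->
  \int[leb R n]_t f (s%:C *: toC t)%R =
  ((s ^+ (n + n))^-1)%:E * \int[leb R n]_t f (toC t).
Proof.
move=> s0 mf f0.
rewrite -(@integral_afft R (n + n) s (ofC 0) (f \o @toC R n))//; last by move=> t; exact: f0.
by apply: eq_integral => t _ /=; rewrite toC_afft ofCK addr0.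
Qed.
End TupleCoordinates.

(** * Polar coordinates *)

Section Polar.
Variables (R : realType) (n : nat).
Local Open Scope ereal_scope.
Local Notation lebR := (@lebesgue_measure R).
Local Notation mR := (measurableTypeR R).
Local Notation mC := ((n + n).-tuple mR).
Local Notation V := 'rV[R[i]]_n.
Local Notation N := (n + n)%N.
Local Notation mu := (leb R n).

Lemma measurable_h_comp d (T : measurableType d) (h : V -> \bar R) (f : T -> V) :
  measurable_fun setT (h \o @toC R n) ->
  (forall j, measurable_fun setT (fun x => complex.Re (f x 0%R j))) ->
  (forall j, measurable_fun setT (fun x => complex.Im (f x 0%R j))) ->
  measurable_fun setT (fun x => h (f x)).
Proof.
move=> mh mr mi.
apply: (eq_measurable_fun ((h \o @toC R n) \o (fun x => ofC (f x)))).
  by move=> x _ /=; rewrite ofCK.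
by apply: measurableT_comp => //; exact: measurable_to_mC.
Qed.

Lemma measurable_Re_affine d (T : measurableType d) (c : V) (p : T -> R) (q : T -> mC) j :
  measurable_fun setT p -> measurable_fun setT q ->
  measurable_fun setT (fun x => complex.Re ((c + (p x)%:C *: toC (q x))%R 0%R j)).
Proof.
move=> mp mq.
apply: (eq_measurable_fun (fun x => complex.Re (c 0%R j) +
   p x * complex.Re (toC (q x) 0 j))%R).
  by move=> x _; rewrite !mxE ReD ReM /= mul0r subr0.
apply: measurable_funD => //; apply: measurable_funM => //.
by apply: (measurableT_comp (@measurable_ReC R n j)).
Qed.

Lemma measurable_Im_affine d (T : measurableType d) (c : V) (p : T -> R) (q : T -> mC) j :
  measurable_fun setT p -> measurable_fun setT q ->
  measurable_fun setT (fun x => complex.Im ((c + (p x)%:C *: toC (q x))%R 0%R j)).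
Proof.
move=> mp mq.
apply: (eq_measurable_fun (fun x => complex.Im (c 0%R j) +
   p x * complex.Im (toC (q x) 0 j))%R).
  by move=> x _; rewrite !mxE ImD ImM /= mul0r addr0.
apply: measurable_funD => //; apply: measurable_funM => //.
by apply: (measurableT_comp (@measurable_ImC R n j)).
Qed.

Lemma measurable_enormC : measurable_fun setT (fun t : mC => enorm (toC t)).
Proof. by apply: measurable_enorm; [exact: measurable_ReC|exact: measurable_ImC]. Qed.

Lemma measurable_enormC_sub (c : V) : measurable_fun setT (fun t : mC => enorm (toC t - c)%R).
Proof.
apply: (eq_measurable_fun (fun t : mC => enorm (- c + 1%:C *: toC t)%R)).
  by move=> t _; rewrite scale1r addrC.
by apply: measurable_enorm => j; [apply: measurable_Re_affine|apply: measurable_Im_affine].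
Qed.

Lemma measurable_eballC (c : V) (r : R) : measurable (@toC R n @^-1` eball c r).
Proof.
rewrite -[X in measurable X]setTI.
have -> : @toC R n @^-1` eball c r = (fun t : mC => enorm (toC t - c)%R) @^-1` `]-oo, r[.
  by apply/seteqP; split=> t /=; rewrite in_itv.
exact: measurable_enormC_sub.
Qed.

Lemma measurable_ecballC (c : V) (r : R) : measurable (@toC R n @^-1` ecball c r).
Proof.
rewrite -[X in measurable X]setTI.
have -> : @toC R n @^-1` ecball c r = (fun t : mC => enorm (toC t - c)%R) @^-1` `]-oo, r].
  by apply/seteqP; split=> t /=; rewrite in_itv.
exact: measurable_enormC_sub.
Qed.

(** This way of writing 1 introduces an auxiliary radial variable [s], through which polar
    coordinates follow from Tonelli and scalings, with no Jacobian to compute. *)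
Lemma integral_pow_tail (rho : R) (M : nat) : (0 < rho)%R -> (0 < M)%N ->
  \int[lebR]_(s in `]rho, +oo[) (M%:R * rho ^+ M * (s^-1) ^+ M.+1)%:E = 1.
Proof.
move=> r0 M0.
pose f s : R := (M%:R * rho ^+ M * (s^-1) ^+ M.+1)%R.
pose F s : R := (- rho ^+ M * (s^-1) ^+ M)%R.
have dF (s : R) : (0 < s)%R -> has_deriv F s (f s).
  move=> s0; apply: has_deriv_eq.
    apply: has_derivZ; apply: has_derivX; apply: has_derivV.
      by rewrite gt_eqF.
    exact: has_deriv_id.
  rewrite /f; case: M M0 {f F} => // M _ /=.
  by rewrite !exprS; field; rewrite gt_eqF.
have cf (s : R) : (0 < s)%R -> {for s, continuous f}.
  move=> s0; apply: has_deriv_continuous.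
  apply: has_derivZ; apply: has_derivX; apply: has_derivV.
    by rewrite gt_eqF.
  exact: has_deriv_id.
have sub : {within `[rho, +oo[, continuous f}.
  apply: continuous_in_subspaceT => s; rewrite inE /= in_itv /= andbT => rs.
  by apply: cf; exact: lt_le_trans rs.
rewrite integral_itv_obnd_cbnd; last first.
  apply/measurable_EFinP; apply: (@measurable_funS _ _ _ _ `[rho, +oo[) => //.
    by move=> x; rewrite /= !in_itv /= !andbT => /ltW.
  exact: subspace_continuous_measurable_fun.
rewrite (@ge0_continuous_FTC2y R f F rho 0%R).
- by rewrite sub0e /F -EFinN mulNr opprK exprVn divff// expf_neq0// gt_eqF.
- by move=> s rs; rewrite /f !mulr_ge0 ?exprn_ge0 ?invr_ge0// ltW// (lt_le_trans r0).
- exact: sub.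
- rewrite /F -[X in _ --> X](mulr0 (- rho ^+ M)%R); apply: cvgMr.
  have c0 : (fun y : R => y ^+ M)%R @ (0 : R)%R --> (0 : R)%R.
    have e0 : (0 ^+ M)%R = (0 : R)%R by rewrite expr0n eqn0Ngt M0.
    rewrite -[X in _ --> X]e0.
    exact: has_deriv_continuous (has_derivX M (has_deriv_id (0 : R)%R)).
  apply: (@cvg_comp _ _ _ (fun s : R => s^-1%R) (fun y : R => (y ^+ M)%R) _ (nbhs (0 : R)%R)); last exact: c0.
  by apply/(@gtr0_cvgV0 R _ _ _ id); [near do exact|exact: cvg_id].
- by move=> s rs; have := dF s (lt_trans r0 rs) => /@ex_derive.
- have /cvg_at_right_filter := has_deriv_continuous (dF rho r0); exact.
- move=> s; rewrite in_itv /= andbT => rs.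
  by have [] := has_derivP (dF s (lt_trans r0 rs)).
Unshelve. all: end_near. Qed.

Lemma measurable_pos d (T : measurableType d) (f : T -> R) :
  measurable_fun setT f -> measurable_fun setT (fun x => ((0 < f x)%R%:R : R)).
Proof.
move=> mf.
apply: (eq_measurable_fun ((\1_(`]0%R, +oo[%classic : set R) : R -> R) \o f)).
  by move=> x _ /=; rewrite indicE mem_setE in_itv /= andbT.
by apply: measurableT_comp => //; exact: measurable_indic.
Qed.

Lemma tuple_power_cube k (M : R) : (0 <= M)%R ->
  tuple_power lebR k [set t : k.-tuple mR | forall i, (`|tnth t i : R| <= M)%R] =
  ((2 * M) ^+ k)%:E.
Proof.
move=> M0; elim: k => [|k IH].
  rewrite /= diracE mem_set ?expr0//; by case.
rewrite /= /power_step /pushforward.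
have -> : @tcons _ mR k @^-1` [set t | forall i, (`|tnth t i : R| <= M)%R] =
   `[(- M)%R, M]%classic `*` [set t : k.-tuple mR | forall i, (`|tnth t i : R| <= M)%R].
  apply/seteqP; split=> -[x t] /=.
  - move=> h; split; first by have := h ord0; rewrite in_itv /= -ler_norml /tcons tnth0.
    by move=> i; have := h (lift ord0 i); rewrite /tcons tnthS.
  - move=> [hx ht] i; case: (unliftP ord0 i) => [j|] ->.
      by rewrite /tcons tnthS.
    by rewrite /tcons tnth0 ler_norml; move: hx; rewrite in_itv.
rewrite product_measure1E.
- rewrite IH exprS EFinM; congr (_ * _).
  transitivity (lebesgue_measure (`[(- M)%R, M]%classic : set R)) => //.
  rewrite lebesgue_measure_itv /= lte_fin; case: ifPn => [_|].
    by rewrite -EFinB; congr (_%:E); ring.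
  by rewrite -leNgt => h; congr (_%:E); lra.
- exact: measurable_itv.
- rewrite (_ : [set _ | _] = \bigcap_(i in [set: 'I_k]) ((@tnth k mR ^~ i) @^-1` `[(- M)%R, M]%classic)).
    apply: fin_bigcap_measurable; first exact: finite_finset.
    move=> i _; rewrite -[X in measurable X]setTI; apply: measurable_tnth => //.
  apply/seteqP; split=> t /= h i; first by move=> _ /=; rewrite in_itv /= -ler_norml.
  by rewrite ler_norml; have := h i Logic.I; rewrite /= in_itv.
Qed.

Lemma leb_eball_lty (c : V) (r : R) : mu (@toC R n @^-1` eball c r) < +oo.
Proof.
have [r0|r0] := ltP 0%R r; last first.
  rewrite (_ : _ @^-1` _ = set0) ?measure0//; apply/seteqP; split=> // t /=.
  by rewrite /eball /= => h; have := le_lt_trans (enorm_ge0 _) (lt_le_trans h r0); rewrite ltxx.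
pose M := (r + enorm c)%R.
have M0 : (0 <= M)%R by rewrite addr_ge0 ?enorm_ge0// ltW.
apply: (@le_lt_trans _ _ (mu [set t : mC | forall i, (`|tnth t i : R| <= M)%R])); last first.
  by rewrite /leb tuple_power_cube ?ltry.
apply: le_measure; rewrite ?inE; first exact: measurable_eballC.
  rewrite (_ : [set _ | _] = \bigcap_(i in [set: 'I_N]) ((@tnth N mR ^~ i) @^-1` `[(- M)%R, M]%classic)).
    apply: fin_bigcap_measurable; first exact: finite_finset.
    move=> i _; rewrite -[X in measurable X]setTI; apply: measurable_tnth => //.
  apply/seteqP; split=> t /= h i; first by move=> _ /=; rewrite in_itv /= -ler_norml.
  by rewrite ler_norml; have := h i Logic.I; rewrite /= in_itv.
move=> t /= tc i.
have tM : (enorm (toC t) <= M)%R.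
  by have := ler_enorm_sub (toC t) c; move: tc; rewrite /eball /= /M; lra.
case: (split_ordP i) => j ->.
  by have := le_trans (Re_le_enorm (toC t) j) tM; rewrite mxE.
by have := le_trans (Im_le_enorm (toC t) j) tM; rewrite mxE.
Qed.

Lemma leb_eball_gt0 (r : R) : (0 < r)%R -> 0 < mu (@toC R n @^-1` eball 0 r).
Proof.
move=> r0.
pose M := (r / (2 * n.+1%:R))%R.
have M0 : (0 < M)%R by rewrite divr_gt0// mulr_gt0.
apply: (@lt_le_trans _ _ (mu [set t : mC | forall i, (`|tnth t i : R| <= M)%R])).
  by rewrite /leb tuple_power_cube ?ltW// lte_fin exprn_gt0// mulr_gt0.
apply: le_measure; rewrite ?inE; last 2 first.
- exact: measurable_eballC.
- move=> t /= h; rewrite /eball /= subr0.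
  apply: le_lt_trans (enorm_le_sum _) _.
  apply: (@le_lt_trans _ _ (\sum_(j < n) (2 * M))%R).
    apply: ler_sum => j _; have := h (lshift n j); have := h (rshift n j).
    by rewrite !mxE /=; lra.
  rewrite sumr_const card_ord -[X in (X < _)%R]mulr_natr /M.
  have -> : (2 * (r / (2 * n.+1%:R)) * n%:R = r * (n%:R / n.+1%:R))%R.
    by rewrite invfM !mulrA [(2 * r)%R]mulrC mulfK ?pnatr_eq0// mulrAC.
  by rewrite gtr_pMr// ltr_pdivrMr// mul1r ltr_nat.
rewrite (_ : [set _ | _] = \bigcap_(i in [set: 'I_N]) ((@tnth N mR ^~ i) @^-1` `[(- M)%R, M]%classic)).
  apply: fin_bigcap_measurable; first exact: finite_finset.
  move=> i _; rewrite -[X in measurable X]setTI; apply: measurable_tnth => //.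
apply/seteqP; split=> t /= h i; first by move=> _ /=; rewrite in_itv /= -ler_norml.
by rewrite ler_norml; have := h i Logic.I; rewrite /= in_itv.
Qed.


(** The origin is invariant under z -> 2 z, which multiplies measures by a power of 2; a finite
    number equal to 2^(-2n) times itself is 0. For n = 0 the space is a point of mass 1. *)
Lemma leb_center0 : (0 < n)%N -> mu [set t : mC | toC t = 0%R] = 0.
Proof.
move=> n0.
have ZE : [set t : mC | toC t = 0%R] = @toC R n @^-1` ecball 0 0.
  apply/seteqP; split=> t /=; rewrite /ecball /= subr0; first by move=> ->; rewrite enorm0.
  by move=> h; apply/eqP; rewrite -enorm_eq0 eq_le h enorm_ge0.
have mZ : measurable [set t : mC | toC t = 0%R] by rewrite ZE; exact: measurable_ecballC.
pose f (z : V) : \bar R := (\1_[set x : V | x = 0%R] z)%:E.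
have fE : f \o @toC R n = EFin \o \1_[set t : mC | toC t = 0%R].
  by apply/funext => t /=; rewrite /f !indicE; congr ((nat_of_bool _)%:R%:E); apply/idP/idP; rewrite !inE.
have mf : measurable_fun setT (f \o @toC R n).
  by rewrite fE; apply/measurable_EFinP; exact: measurable_indic.
have f0 z : 0 <= f z by rewrite lee_fin.
have h := @integral_scale R n 2%R f (ltr0n _ 2) mf f0.
have intE : \int[mu]_t f (toC t) = mu [set t : mC | toC t = 0%R].
  rewrite -[LHS]/(\int[mu]_t (f \o @toC R n) t) fE.
  by rewrite integral_indic// setIT.
move: h; rewrite intE.
have -> : \int[mu]_t f (2%:C *: toC t)%R = mu [set t : mC | toC t = 0%R].
  rewrite -intE; apply: eq_integral => t _; rewrite /f !indicE; congr ((nat_of_bool _)%:R%:E).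
  apply/idP/idP; rewrite !inE /=; last by move=> ->; rewrite scaler0.
  by move/eqP; rewrite scaler_eq0 (_ : ((2%:C)%R == 0%R :> R[i]) = false) /= => [/eqP//|]; apply/negP => /eqP[] /eqP; rewrite pnatr_eq0.
have : mu [set t : mC | toC t = 0%R] < +oo.
  apply: le_lt_trans (leb_eball_lty 0 1); apply: le_measure; rewrite ?inE//.
    exact: measurable_eballC.
  by move=> t /= t0; rewrite /eball /= t0 subrr enorm0.
move=> mlt; have /fineK <- : mu [set t : mC | toC t = 0%R] \is a fin_num.
  by rewrite ge0_fin_numE.
move: (fine _) => x; rewrite -EFinM => -[] h.
congr (_%:E).
have h2 : ((2 ^+ N)^-1 < (1 : R))%R.
  by rewrite invf_lt1 ?exprn_gt0// exprn_egt1// ?ltr1n// addn_eq0 negb_and -!lt0n n0.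
move: h => /eqP; rewrite -subr_eq0 -[X in (X - _)%R]mul1r -mulrBl mulf_eq0 subr_eq0 => /orP[/eqP e|/eqP //].
by move: h2; rewrite -e ltxx.
Qed.

(** [sphere_mean] before the division by the volume of the unit ball. *)
Definition sphere_int (h : V -> \bar R) (c : V) (x : R) : \bar R :=
  \int[mu]_(t in [set t : mC | (enorm (toC t) < 1)%R])
     h (c + (x / enorm (toC t))%:C *: toC t)%R.

Lemma ae_enormC_gt0 (f : V -> \bar R) : (0 < n)%N -> measurable_fun setT (f \o @toC R n) ->
  (forall z, 0 <= f z) ->
  \int[mu]_t (f (toC t) * ((0 < enorm (toC t))%R%:R)%:E) = \int[mu]_t f (toC t).
Proof.
move=> n0 mf f0; apply: ge0_ae_eq_integral => //.
- by apply: emeasurable_funM => //; apply/measurable_EFinP; apply: measurable_pos; exact: measurable_enormC.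
- by move=> t _; rewrite mule_ge0// lee_fin.
exists [set t : mC | toC t = 0%R]; split.
- rewrite (_ : [set _ | _] = @toC R n @^-1` ecball 0 0); first exact: measurable_ecballC.
  apply/seteqP; split=> t /=; rewrite /ecball /= subr0; first by move=> ->; rewrite enorm0.
  by move=> h; apply/eqP; rewrite -enorm_eq0 eq_le h enorm_ge0.
- exact: leb_center0.
- move=> t /=; apply: contra_notP => /eqP t0 _.
  by rewrite enorm_gt0 t0 mule1.
Qed.

(** The inverse of y is written as y |y|^(-2), with a real power whose measurability is known; at y
    = 0 both expressions are 0. *)
Lemma measurable_invr d (T : measurableType d) (f : T -> R) :
  measurable_fun setT f -> measurable_fun setT (fun x => (f x)^-1%R).
Proof.
move=> mf; apply: (eq_measurable_fun (fun x => f x * (powR `|f x| (-1)) ^+ 2)%R).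
  move=> x _; rewrite powR_inv1 ?normr_ge0// -normfV real_normK ?num_real// expr2.
  by have [->|fx] := eqVneq (f x) 0%R; [rewrite invr0 mul0r|field].
apply: measurable_funM => //; apply: measurable_funX.
apply: (@measurableT_comp _ _ _ _ _ _ (fun y : R => powR y (-1))); first exact: measurable_powR.
exact: measurableT_comp.
Qed.

Lemma ind_mulr_ge0 (b : bool) (y : R) : (b -> 0 <= y)%R -> (0 <= b%:R * y)%R.
Proof. by case: b => [/(_ isT)|_]; rewrite ?mul1r ?mul0r. Qed.

Lemma muleVK (r : R) (x : \bar R) : (0 < r)%R -> r%:E * (r^-1%:E * x) = x.
Proof. by move=> r0; rewrite muleA -EFinM divff ?gt_eqF// mul1e. Qed.

Lemma ge0_integral_cstM d (T : measurableType d) (m : {measure set T -> \bar R})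
  (x : \bar R) (f : T -> \bar R) : measurable_fun setT f -> (forall t, 0 <= f t) ->
  0 <= x -> \int[m]_t (x * f t) = x * \int[m]_t f t.
Proof. by move=> mf f0 x0; apply: ge0_integralZl. Qed.

Section PolarProof.
Variables (h : V -> \bar R) (k : R -> R) (c : V).
Let rho (t : mC) := enorm (toC t).

(** The successive integrands of the change of variables: [polar_A] after inserting the tail
    integral in s, [polar_B] after the scaling z = s w, [polar_C] after the substitution x = s |w|.
    The Boolean factors are indicator functions. *)
Definition polar_A (p : mC * R) : \bar R := h (c + 1%:C *: toC p.1)%R *
  ((0 < p.2)%R%:R * (k (rho p.1) * (0 < rho p.1)%R%:R * (0 < p.2 - rho p.1)%R%:R *
   (N%:R * rho p.1 ^+ N * (p.2^-1) ^+ N.+1)))%:E.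
Definition polar_B (p : R * mC) : \bar R := h (c + p.1%:C *: toC p.2)%R *
  ((0 < p.1)%R%:R * ((0 < rho p.2)%R%:R * (0 < 1 - rho p.2)%R%:R *
   (k (p.1 * rho p.2)%R * N%:R * p.1 ^+ N.-1 * rho p.2 ^+ N)))%:E.
Definition polar_C (p : mC * R) : \bar R := h (c + (p.2 / rho p.1)%:C *: toC p.1)%R *
  ((0 < p.2)%R%:R * ((0 < rho p.1)%R%:R * (0 < 1 - rho p.1)%R%:R *
   (N%:R * p.2 ^+ N.-1 * k p.2)))%:E.

Hypothesis n0 : (0 < n)%N.
Hypothesis mh : measurable_fun setT (h \o @toC R n).
Hypothesis h0 : forall z, 0 <= h z.
Hypothesis mk : measurable_fun setT k.
Hypothesis k0 : forall x, (0 <= k x)%R.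

Let W0 x : (0 <= (0 < x)%R%:R * (N%:R * x ^+ N.-1 * k x))%R.
Proof. by apply: ind_mulr_ge0 => x0; rewrite !mulr_ge0// exprn_ge0// ltW. Qed.

Let N0 : (0 < N)%N. Proof. by rewrite addn_gt0 n0. Qed.
Let rho0 t : (0 <= rho t)%R. Proof. exact: enorm_ge0. Qed.

Let mhc d (T : measurableType d) (q : T -> R) (g : T -> mC) :
  measurable_fun setT q -> measurable_fun setT g ->
  measurable_fun setT (fun x : T => h (c + (q x)%:C *: toC (g x))%R).
Proof.
move=> mq mg; apply: measurable_h_comp => // j.
  exact: measurable_Re_affine.
exact: measurable_Im_affine.
Qed.

Let mr d (T : measurableType d) (g : T -> mC) : measurable_fun setT g ->
  measurable_fun setT (fun x => rho (g x)).
Proof. by move=> mg; apply: (measurableT_comp measurable_enormC). Qed.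

Let mkc d (T : measurableType d) (g : T -> R) : measurable_fun setT g ->
  measurable_fun setT (fun x => k (g x)).
Proof. by move=> mg; apply: (measurableT_comp mk). Qed.

Let mA : measurable_fun setT polar_A.
Proof.
apply: emeasurable_funM; first exact: mhc.
apply/measurable_EFinP.
by do ![apply: measurable_funM => //|apply: measurable_pos => //|apply: measurable_funB => //
  |apply: measurable_funX => //|apply: mr => //|apply: mkc => //|apply: measurable_invr => //].
Qed.

Let mB : measurable_fun setT polar_B.
Proof.
apply: emeasurable_funM; first exact: mhc.
apply/measurable_EFinP.
by do ![apply: measurable_funM => //|apply: measurable_pos => //|apply: measurable_funB => //
  |apply: measurable_funX => //|apply: mr => //|apply: mkc => //|apply: measurable_invr => //].
Qed.

Let mC' : measurable_fun setT polar_C.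
Proof.
apply: emeasurable_funM.
  apply: mhc; last exact: measurable_fst.
  by apply: measurable_funM; [exact: measurable_snd|apply: measurable_invr; apply: mr; exact: measurable_fst].
apply/measurable_EFinP.
by do ![apply: measurable_funM => //|apply: measurable_pos => //|apply: measurable_funB => //
  |apply: measurable_funX => //|apply: mr => //|apply: mkc => //|apply: measurable_invr => //].
Qed.

Let A0 p : 0 <= polar_A p.
Proof.
rewrite mule_ge0// lee_fin; apply: ind_mulr_ge0 => p0.
by rewrite !mulr_ge0// ?exprn_ge0// invr_ge0 ltW.
Qed.

Let B0 p : 0 <= polar_B p.
Proof.
rewrite mule_ge0// lee_fin; apply: ind_mulr_ge0 => p0.
by rewrite !mulr_ge0// ?exprn_ge0// ltW.
Qed.

Let C0 p : 0 <= polar_C p.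
Proof.
rewrite mule_ge0// lee_fin; apply: ind_mulr_ge0 => p0.
by rewrite !mulr_ge0// ?exprn_ge0// ltW.
Qed.

Let T1 : \int[mu]_t (h (toC t) * (k (enorm (toC t - c)%R))%:E) =
  \int[mu]_t \int[lebR]_s polar_A (t, s).
Proof.
pose f z := h z * (k (enorm (z - c)%R))%:E.
have mf : measurable_fun setT (f \o @toC R n).
  by apply: emeasurable_funM => //; apply/measurable_EFinP; apply: mkc; exact: measurable_enormC_sub.
have f0 z : 0 <= f z by rewrite mule_ge0// lee_fin.
transitivity (\int[mu]_t f (toC t)) => //.
rewrite -(integral_translate c mf f0).
pose g z := h (c + 1%:C *: z)%R * (k (enorm z))%:E.
have mg : measurable_fun setT (g \o @toC R n).
  apply: emeasurable_funM; first exact: mhc.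
  by apply/measurable_EFinP; apply: mkc; exact: mr.
have g0 z : 0 <= g z by rewrite mule_ge0// lee_fin.
transitivity (\int[mu]_t g (toC t)).
  by apply: eq_integral => t _; rewrite /f /g addrK scale1r addrC.
rewrite -(ae_enormC_gt0 n0 mg g0); apply: eq_integral => t _; rewrite /g.
have [r0|] := boolP (0 < rho t)%R; last first.
  move=> /negbTE r0; rewrite mule0; apply/esym/integral0_eq => s _.
  by rewrite /polar_A /= r0 !(mulr0, mul0r) mule0.
pose w (s : R) := ((0 < s)%R%:R * ((0 < s - rho t)%R%:R * (N%:R * rho t ^+ N * (s^-1) ^+ N.+1)))%R.
have w0 s : (0 <= w s)%R.
  apply: ind_mulr_ge0 => s0; by rewrite !mulr_ge0// ?exprn_ge0// invr_ge0 ltW.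
transitivity (\int[lebR]_s (h (c + 1%:C *: toC t)%R * (k (rho t))%:E * (w s)%:E)); last first.
  apply: eq_integral => s _; rewrite /polar_A /w /= r0 -muleA -EFinM; congr (_ * _%:E).
  by rewrite -[(true%:R : R)%R]/(1 : R)%R; ring.
have mw : measurable_fun setT (fun s => (w s)%:E).
  apply/measurable_EFinP; rewrite /w.
  by do ![apply: measurable_funM => //|apply: measurable_pos => //|apply: measurable_funB => //
    |apply: measurable_funX => //|apply: measurable_invr => //].
have hk : 0 <= h (c + 1%:C *: toC t)%R * (k (rho t))%:E by rewrite mule_ge0// lee_fin.
have w0' (s : R) : 0 <= (w s)%:E by rewrite lee_fin.
apply/esym; apply: (etrans (ge0_integral_cstM lebR mw w0' hk)).
congr (_ * _); transitivity (1 : \bar R) => //; apply/esym.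
rewrite -(integral_pow_tail r0 N0) [LHS]integral_mkcond; apply: eq_integral => s _.
rewrite patchE mem_setE in_itv /= andbT /w subr_gt0.
case: ifPn => [rs|_]; last by rewrite mul0r mulr0.
by rewrite (lt_trans r0 rs) !mul1r.
Qed.

Let T2 : \int[lebR]_s \int[mu]_t polar_A (t, s) = \int[lebR]_s \int[mu]_t polar_B (s, t).
Proof.
apply: eq_integral => s _.
have [s0|s0] := boolP (0 < s)%R; last first.
  have -> : \int[mu]_t polar_A (t, s) = 0.
    by apply: integral0_eq => t _; rewrite /polar_A /= (negbTE s0) mul0r mule0.
  apply/esym; apply: integral0_eq => t _.
  by rewrite /polar_B /= (negbTE s0) mul0r mule0.
pose G (z : V) := h (c + 1%:C *: z)%R *
  ((0 < s)%R%:R * (k (enorm z) * (0 < enorm z)%R%:R * (0 < s - enorm z)%R%:R *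
   (N%:R * enorm z ^+ N * (s^-1) ^+ N.+1)))%:E.
have mG : measurable_fun setT (G \o @toC R n).
  by apply: (measurableT_comp mA (measurable_pair2 s)) => //; exact: measurable_pair2.
have G0 z : 0 <= G z.
  rewrite mule_ge0// lee_fin; apply: ind_mulr_ge0 => p0.
  by rewrite !mulr_ge0// ?exprn_ge0// ?invr_ge0 ?enorm_ge0// ltW.
transitivity (\int[mu]_t G (toC t)) => //.
have sN : (0 < s ^+ N)%R by rewrite exprn_gt0.
have -> : \int[mu]_t G (toC t) = (s ^+ N)%:E * \int[mu]_t G (s%:C *: toC t)%R.
  by rewrite (integral_scale s0 mG G0) muleA -EFinM divff ?gt_eqF// mul1e.
have mGs : measurable_fun setT (fun t : mC => G (s%:C *: toC t)%R).
  apply: (measurable_h_comp mG) => j.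
    apply: eq_measurable_fun (@measurable_Re_affine _ _ (0 : V)%R (cst s) id j _ _) => //.
    by move=> t _; rewrite add0r.
  apply: eq_measurable_fun (@measurable_Im_affine _ _ (0 : V)%R (cst s) id j _ _) => //.
  by move=> t _; rewrite add0r.
rewrite -(ge0_integral_cstM _ mGs (fun t => G0 _)); last by rewrite lee_fin ltW.
apply: eq_integral => t _; rewrite /G /polar_B /= scale1r muleCA -EFinM enormZ (gtr0_norm s0) -/(rho t).
congr (_ * _%:E).
have -> : (s - s * rho t = s * (1 - rho t))%R by ring.
rewrite s0 !pmulr_rgt0// !mul1r.
rewrite exprMn [in LHS]exprS; have -> : (s ^+ N = s * s ^+ N.-1)%R by rewrite -exprS prednK.
have -> : (s^-1 ^+ N = (s * s ^+ N.-1)^-1)%R by rewrite -exprS prednK// exprVn.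
by field; rewrite gt_eqF ?exprn_gt0//= gt_eqF.
Qed.

Let T3 : \int[mu]_t \int[lebR]_s polar_B (s, t) = \int[mu]_t \int[lebR]_x polar_C (t, x).
Proof.
apply: eq_integral => t _.
have [r0|r0] := boolP (0 < rho t)%R; last first.
  have -> : \int[lebR]_s polar_B (s, t) = 0.
    by apply: integral0_eq => s _; rewrite /polar_B /= (negbTE r0) !mul0r mulr0 mule0.
  apply/esym; apply: integral0_eq => s _.
  by rewrite /polar_C /= (negbTE r0) !mul0r mulr0 mule0.
have mCt : measurable_fun setT (fun x : R => polar_C (t, x)).
  exact: (measurableT_comp mC' (measurable_pair1 t)).
have h1 := @integral_aff1 R (rho t) 0%R _ r0 mCt (fun x => C0 _).
have -> : \int[lebR]_x polar_C (t, x) = (rho t)%:E * \int[lebR]_x polar_C (t, rho t * x + 0)%R.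
  by rewrite h1 muleVK.
have mCa : measurable_fun setT (fun x : R => polar_C (t, rho t * x + 0)%R).
  exact: (measurableT_comp mCt (measurable_aff1 _ _)).
have hr : 0 <= (rho t)%:E by rewrite lee_fin.
apply: etrans (ge0_integral_cstM lebR mCa (fun t => C0 _) hr).
apply: eq_integral => s _; rewrite /polar_B /polar_C /= addr0 muleCA -EFinM.
have rn := lt0r_neq0 r0.
rewrite [(rho t * s)%R]mulrC (mulfK rn) (pmulr_lgt0 s r0) r0.
congr (_ * _%:E).
have -> : (rho t ^+ N = rho t * rho t ^+ N.-1)%R by rewrite -exprS prednK.
by rewrite exprMn; ring.
Qed.

Let T4 : \int[lebR]_x \int[mu]_t polar_C (t, x) =
  \int[lebR]_x (sphere_int h c x *
     ((0 < x)%R%:R * (N%:R * x ^+ N.-1 * k x))%:E).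
Proof.
apply: eq_integral => x _.
pose f (z : V) := h (c + (x / enorm z)%:C *: z)%R * ((0 < 1 - enorm z)%R%:R)%:E.
have mf : measurable_fun setT (f \o @toC R n).
  apply: emeasurable_funM.
    apply: mhc; last exact: measurable_id.
    apply: measurable_funM; first exact: measurable_cst.
    by apply: measurable_invr; apply: mr; exact: measurable_id.
  apply/measurable_EFinP; apply: measurable_pos; apply: measurable_funB; first exact: measurable_cst.
  by apply: mr; exact: measurable_id.
have f0 z : 0 <= f z by rewrite mule_ge0// lee_fin.
have -> : sphere_int h c x = \int[mu]_t (f (toC t) * ((0 < enorm (toC t))%R%:R)%:E).
  rewrite (ae_enormC_gt0 n0 mf f0) /sphere_int integral_mkcond; apply: eq_integral => t _.
  rewrite patchE /f subr_gt0; case: ifPn; first by rewrite inE => ->; rewrite mule1.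
  by move=> /negP; rewrite inE /= => /negP/negbTE ->; rewrite mule0.
have mf1 : measurable_fun setT (fun t : mC => f (toC t) * ((0 < enorm (toC t))%R%:R)%:E).
  apply: emeasurable_funM; first exact: mf.
  by apply/measurable_EFinP; apply: measurable_pos; apply: mr; exact: measurable_id.
rewrite [RHS]muleC -(ge0_integral_cstM _ mf1).
- apply: eq_integral => t _; rewrite /polar_C /f /= [RHS]muleC -!muleA -!EFinM; congr (_ * _%:E).
  by rewrite -/(rho t); ring.
- by move=> t; rewrite mule_ge0// lee_fin.
- by rewrite lee_fin; exact: W0.
Qed.

(** Tonelli is applied three times, between the substitutions [T1], [T2] and [T3]. The factor is N
    x^(N-1), rather than x^(N-1), because the sphere carries here the whole mass of the unit
    ball. *)
Lemma polar_integral : 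
  \int[mu]_t (h (toC t) * (k (enorm (toC t - c)%R))%:E) =
  \int[lebR]_x (sphere_int h c x *
     ((0 < x)%R%:R * (N%:R * x ^+ N.-1 * k x))%:E).
Proof.
rewrite T1; apply: etrans (@fubini_tonelli _ _ _ _ R mu lebR _ mA A0) _.
rewrite T2; apply: etrans (@fubini_tonelli _ _ _ _ R lebR mu _ mB B0) _.
by rewrite T3; apply: etrans (@fubini_tonelli _ _ _ _ R mu lebR _ mC' C0) _.
Qed.
End PolarProof.
End Polar.

(** * The exterior algebra *)

Section WedgeRing.
Variables (R : realType) (n : nat).
Local Open Scope set_scope.
Local Notation I2 := 'I_(n + n).
Local Notation form := (ext_form R n).
Local Notation set0 := finset.set0.
Implicit Types (A B C D S : {set I2}) (w : form).

Definition disj A B := A :&: B == set0.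

Lemma disjP A B x : disj A B -> x \in A -> x \in B -> False.
Proof.
by move=> /eqP/setP/(_ x); rewrite !inE => h xA xB; move: h; rewrite xA xB.
Qed.

Lemma disjC A B : disj A B = disj B A.
Proof. by rewrite /disj finset.setIC. Qed.

Lemma disjUl A B C : disj (A :|: B) C = disj A C && disj B C.
Proof. by rewrite /disj finset.setIUl finset.setU_eq0. Qed.

Lemma disjUr A B C : disj A (B :|: C) = disj A B && disj A C.
Proof. by rewrite disjC disjUl ![disj _ A]disjC. Qed.

Lemma inversionsE A B : inversions A B = (\sum_(a in A) \sum_(b in B) (b < a))%N.
Proof.
rewrite /inversions -sum1_card pair_big_dep /= big_mkcond /= [RHS]big_mkcond /=.
apply: eq_bigr => p _; rewrite inE.
by case: (p.1 \in A); case: (p.2 \in B) => //=; case: ltnP.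
Qed.

Lemma sum_disjU A B (F : I2 -> nat) : disj A B ->
  (\sum_(i in A :|: B) F i = \sum_(i in A) F i + \sum_(i in B) F i)%N.
Proof.
move=> dAB; rewrite -bigU /=; last by rewrite -setI_eq0.
by apply: eq_bigl => i; rewrite !inE.
Qed.

Lemma inversionsUl A B C : disj A B ->
  inversions (A :|: B) C = (inversions A C + inversions B C)%N.
Proof. by move=> dAB; rewrite !inversionsE sum_disjU. Qed.

Lemma inversionsUr A B C : disj B C ->
  inversions A (B :|: C) = (inversions A B + inversions A C)%N.
Proof.
move=> dBC; rewrite !inversionsE -big_split /=; apply: eq_bigr => a _.
by rewrite sum_disjU.
Qed.

Let bF : (false%:R = 0 :> R[i]). Proof. by []. Qed.
Let bT : (true%:R = 1 :> R[i]). Proof. by []. Qed.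

Let bAnd (x y : bool) : ((x && y)%:R = x%:R * y%:R :> R[i]).
Proof. by case: x; rewrite ?mul1r ?mul0r. Qed.

(** Summing over all pairs with an indicator, instead of over subsets of [S] and their complements,
    treats both factors alike and turns associativity into an exchange of sums. *)
Lemma wedgeE w1 w2 S : wedge w1 w2 S =
  \sum_A \sum_B (disj A B && (A :|: B == S))%:R * ((-1) ^+ inversions A B * w1 A * w2 B).
Proof.
rewrite ffunE big_mkcond /=; apply: eq_bigr => A _.
have [AS|nAS] := boolP (A \subset S).
- rewrite (bigD1 (S :\: A)) //= big1 ?addr0.
    have -> : disj A (S :\: A) && (A :|: S :\: A == S); last by rewrite mul1r.
    apply/andP; split; apply/eqP/setP => x; rewrite !inE.
      by case: (x \in A).
    by have := fintype.subsetP AS x; case: (x \in A) => //= ->.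
  move=> B BD; case: (boolP (disj _ _ && _)); rewrite ?mul0r//.
  move=> /andP[dAB /eqP SE].
  case/eqP: BD; rewrite -SE; apply/setP => x; rewrite !inE.
  by have := @disjP A B x dAB; case: (x \in A); case: (x \in B) => // /(_ isT isT).
- rewrite big1// => B _; case: (boolP (disj _ _ && _)); rewrite ?mul0r//.
  move=> /andP[_ /eqP SE].
  by case/negP: nAS; rewrite -SE finset.subsetUl.
Qed.

(** [inversions] is additive over disjoint unions in either argument; both bracketings therefore
    carry the sign of [T3], which counts the inversions of the three pairs. *)
Lemma wedgeA : associative (@wedge R n).
Proof.
move=> w1 w2 w3; apply/ffunP => S.
pose T3 A B C : R[i] := [&& disj A B, disj A C, disj B C & A :|: (B :|: C) == S]%:R *
  ((-1) ^+ (inversions A B + inversions A C + inversions B C) * w1 A * w2 B * w3 C).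
transitivity (\sum_A \sum_B \sum_C T3 A B C).
- rewrite wedgeE; apply: eq_bigr => A _.
  transitivity (\sum_D \sum_B \sum_C
     (D == B :|: C)%:R * T3 A B C).
    apply: eq_bigr => D _; rewrite wedgeE !mulr_sumr; apply: eq_bigr => B _.
    rewrite !mulr_sumr; apply: eq_bigr => C _.
    rewrite /T3; have [->|nD] := eqVneq D (B :|: C); last first.
      by rewrite andbF !bF; ring.
    rewrite andbT bT disjUr; case dBC: (disj B C); last by rewrite !andbF bF; ring.
    rewrite inversionsUr// !exprD.
    by rewrite !bAnd !bT; ring.
  rewrite exchange_big; apply: eq_bigr => B _.
  rewrite exchange_big; apply: eq_bigr => C _.
  by rewrite (bigD1 (B :|: C))//= eqxx mul1r big1 ?addr0// => D /negbTE ->; rewrite mul0r.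
- rewrite wedgeE.
  transitivity (\sum_D \sum_A \sum_B \sum_C
     (D == A :|: B)%:R * T3 A B C).
    apply/esym; rewrite exchange_big; apply: eq_bigr => A _.
    rewrite exchange_big; apply: eq_bigr => B _.
    rewrite exchange_big; apply: eq_bigr => C _.
    by rewrite (bigD1 (A :|: B))//= eqxx mul1r big1 ?addr0// => D /negbTE ->; rewrite mul0r.
  apply: eq_bigr => D _.
  rewrite [LHS](eq_bigr (fun A => \sum_C \sum_B (D == A :|: B)%:R * T3 A B C)); last first.
    by move=> A _; rewrite exchange_big.
  rewrite [LHS]exchange_big; apply: eq_bigr => C _.
  rewrite wedgeE !(mulr_sumr, mulr_suml); apply: eq_bigr => A _.
  rewrite !(mulr_sumr, mulr_suml); apply: eq_bigr => B _.
  rewrite /T3; have [->|nD] := eqVneq D (A :|: B); last first.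
    by rewrite andbF !bF; ring.
  rewrite andbT bT disjUl -finset.setUA; case dAB: (disj A B); last by rewrite /= !bF; ring.
  by rewrite inversionsUl// !exprD /= !bAnd; ring.
Qed.

Lemma wedgeDl : left_distributive (@wedge R n) +%R.
Proof.
move=> w1 w2 w3; apply/ffunP => S; rewrite !ffunE -big_split /=.
by apply: eq_bigr => A _; rewrite !ffunE; ring.
Qed.

Lemma wedgeDr : right_distributive (@wedge R n) +%R.
Proof.
move=> w1 w2 w3; apply/ffunP => S; rewrite !ffunE -big_split /=.
by apply: eq_bigr => A _; rewrite !ffunE; ring.
Qed.

Lemma inversions0l A : inversions set0 A = 0%N.
Proof. by rewrite inversionsE big_set0. Qed.

Lemma inversions0r A : inversions A set0 = 0%N.
Proof. by rewrite inversionsE big1// => a _; rewrite big_set0. Qed.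

Definition mono (S : {set I2}) : form := [ffun T => (T == S)%:R].

Lemma wedge_mono A B : wedge (mono A) (mono B) =
  ((disj A B)%:R * (-1) ^+ inversions A B) *: mono (A :|: B).
Proof.
apply/ffunP => S; rewrite wedgeE !ffunE.
rewrite (bigD1 A)//= [X in _ + X]big1 ?addr0; last first.
  move=> C /negbTE CA; rewrite big1// => D _; rewrite [mono A C]ffunE CA bF; ring.
rewrite (bigD1 B)//= big1 ?addr0; last first.
  by move=> C /negbTE CB; rewrite [mono B C]ffunE CB bF; ring.
rewrite !ffunE !eqxx [S == _]eq_sym /GRing.scale /=.
by rewrite bAnd; ring.
Qed.

Lemma wedge1l : left_id (form1 R n) (@wedge R n).
Proof.
move=> w; apply/ffunP => S; rewrite ffunE (bigD1 set0) ?finset.sub0set//= big1 ?addr0.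
  by rewrite finset.setD0 inversions0l ffunE eqxx bT; ring.
by move=> A /andP[_ /negbTE A0]; rewrite ffunE A0 bF; ring.
Qed.

Lemma wedge1r : right_id (form1 R n) (@wedge R n).
Proof.
move=> w; apply/ffunP => S; rewrite ffunE (bigD1 S) ?subxx//= big1 ?addr0.
  by rewrite finset.setDv inversions0r ffunE eqxx bT; ring.
move=> A /andP[AS nAS]; rewrite [form1 R n _]ffunE finset.setD_eq0.
have -> : (S \subset A) = false; last by rewrite bF; ring.
by apply/negP => SA; case/negP: nAS; rewrite finset.eqEsubset AS SA.
Qed.

Lemma wedgeZl (a : R[i]) w1 w2 : a *: wedge w1 w2 = wedge (a *: w1) w2.
Proof.
apply/ffunP => S; rewrite !ffunE /GRing.scale /= mulr_sumr.
by apply: eq_bigr => A _; rewrite !ffunE /GRing.scale /=; ring.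
Qed.

Lemma wedgeZr (a : R[i]) w1 w2 : a *: wedge w1 w2 = wedge w1 (a *: w2).
Proof.
apply/ffunP => S; rewrite !ffunE /GRing.scale /= mulr_sumr.
by apply: eq_bigr => A _; rewrite !ffunE /GRing.scale /=; ring.
Qed.

Lemma form1_neq0 : form1 R n != 0.
Proof. by apply/eqP => /ffunP/(_ set0); rewrite !ffunE eqxx => /eqP; rewrite oner_eq0. Qed.

(** A copy of [ext_form] whose multiplication is the wedge product, so that the algebra of powers,
    sums and scalars applies to forms. *)
Definition ext : Type := form.
HB.instance Definition _ := GRing.Lmodule.copy ext form.
HB.instance Definition _ := GRing.Zmodule_isNzRing.Build ext
  wedgeA wedge1l wedge1r wedgeDl wedgeDr form1_neq0.
HB.instance Definition _ := GRing.Lmodule_isLalgebra.Build R[i] ext wedgeZl.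
HB.instance Definition _ := GRing.Lalgebra_isAlgebra.Build R[i] ext wedgeZr.
End WedgeRing.

(** * Powers of sums of commuting square-zero elements *)

Section SquareZero.
Variable A : nzRingType.

Lemma exprD_sqr0 (x y : A) k : x * x = 0 -> GRing.comm x y ->
  (x + y) ^+ k.+1 = y ^+ k.+1 + k.+1%:R * (x * y ^+ k).
Proof.
move=> xx xy; elim: k => [|k IH]; first by rewrite !expr1 mul1r expr0 mulr1 addrC.
have cxk i : x * y ^+ i = y ^+ i * x by exact: commrX.
rewrite exprSr IH [in LHS]mulrDr ![in LHS]mulrDl.
have -> : k.+1%:R * (x * y ^+ k) * x = 0.
  by rewrite -mulrA -mulrA -cxk mulrA mulrA -[_ * x * x]mulrA xx mulr0 mul0r.
rewrite addr0 -exprSr -cxk.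
have -> : k.+1%:R * (x * y ^+ k) * y = k.+1%:R * (x * y ^+ k.+1).
  by rewrite -!mulrA -exprSr.
by rewrite addrCA -[k.+2%:R]natr1 [in RHS]mulrDl mul1r [X in _ + X = _]addrC.
Qed.

Variables (I : eqType) (b : I -> A).
Hypothesis bC : forall i j, b i * b j = b j * b i.
Hypothesis bb : forall i, b i * b i = 0.

Lemma comm_sum_sqr0 (x : A) (s : seq I) : (forall i, x * b i = b i * x) ->
  GRing.comm x (\sum_(i <- s) b i).
Proof.
move=> xb; elim: s => [|i s IH]; first by rewrite big_nil; exact: commr0.
by rewrite big_cons; apply: commrD.
Qed.

(** Only products using every term once survive the expansion, and they occur in (size s)! orders;
    one more factor forces a repetition. *)
Lemma sum_sqr0_exp (s : seq I) :
  (\sum_(i <- s) b i) ^+ size s = (size s)`!%:R * \prod_(i <- s) b i /\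
  (\sum_(i <- s) b i) ^+ (size s).+1 = 0.
Proof.
elim: s => [|i s [IH1 IH2]]; first by rewrite !big_nil expr0 fact0 mul1r expr1.
have cb : GRing.comm (b i) (\sum_(i <- s) b i) by exact: comm_sum_sqr0.
rewrite /= !big_cons; split.
  rewrite (exprD_sqr0 _ (bb i) cb) IH2 add0r IH1 factS natrM -!mulrA; congr (_ * _).
  by rewrite [in LHS]mulrA commr_nat -mulrA.
rewrite (exprD_sqr0 _ (bb i) cb) exprS IH2 mulr0 add0r mulr0.
by rewrite mulr0.
Qed.

Lemma sum_sqr0_exp_eq0 (s : seq I) k : (size s < k)%N -> (\sum_(i <- s) b i) ^+ k = 0.
Proof.
move=> sk; rewrite -(subnK sk) exprD; have [_ ->] := sum_sqr0_exp s.
by rewrite mulr0.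
Qed.

(** One has w S = w S', and S commutes with S'; hence the factors S can be replaced by S' one at a
    time, whether or not [w] commutes with them. *)
Lemma mul_sum_kill (w : A) (s : seq I) (Q : pred I) k :
  (forall i, Q i -> w * b i = 0) ->
  w * (\sum_(i <- s) b i) ^+ k = w * (\sum_(i <- s | ~~ Q i) b i) ^+ k.
Proof.
move=> wQ; set S := \sum_(i <- s) b i; set S' := \sum_(i <- s | _) b i.
have wS : w * S = w * S'.
  rewrite /S (bigID Q) /= mulrDr [X in X + _](_ : _ = 0) ?add0r//.
  by rewrite mulr_sumr big1// => i; exact: wQ.
have cS : GRing.comm S S'.
  apply: (big_ind (GRing.comm S)) => [|x y|i _]; [exact: commr0|exact: commrD|].
  by apply: commr_sym; apply: comm_sum_sqr0.
elim: k => [|k IH]; first by rewrite !expr0.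
by rewrite exprS mulrA wS -mulrA (commrX k (commr_sym cS)) mulrA IH -mulrA -exprSr.
Qed.
End SquareZero.

(** * Trace formulas for products of (1,1)-forms with powers of beta, in dimension m + 2 *)

Section Grassmann.
Variables (C : numFieldType) (A : algType C) (m : nat).
Variables (gz gzb : 'I_m.+2 -> A) (c0 : C).
Hypothesis gz_sq : forall j, gz j * gz j = 0.
Hypothesis gzb_sq : forall j, gzb j * gzb j = 0.
Hypothesis gz_anti : forall j k, gz j * gz k = - (gz k * gz j).
Hypothesis gzb_anti : forall j k, gzb j * gzb k = - (gzb k * gzb j).
Hypothesis gzzb_anti : forall j k, gzb j * gz k = - (gz k * gzb j).
Local Notation n := m.+2.

Definition theta j k : A := gz j * gzb k.

Lemma theta_gen j k (x : A) : (forall i, x * gz i = - (gz i * x)) ->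
  (forall i, x * gzb i = - (gzb i * x)) -> theta j k * x = x * theta j k.
Proof.
move=> xz xzb; rewrite /theta mulrA xz mulNr -!mulrA.
by rewrite -[gzb k * x]opprK -xzb mulrN.
Qed.

Lemma theta_comm j k p q : theta j k * theta p q = theta p q * theta j k.
Proof.
rewrite {2 3}/theta mulrA theta_gen; last 2 first.
- by move=> i; rewrite gz_anti.
- by move=> i; rewrite gzzb_anti opprK.
by rewrite -mulrA theta_gen ?mulrA.
Qed.

Lemma gzb_gz a b (x : A) : gzb a * (gz b * x) = - (gz b * (gzb a * x)).
Proof. by rewrite mulrA gzzb_anti mulNr mulrA. Qed.

Lemma theta_mul j k p q : theta j k * theta p q = - (theta j q * theta p k).
Proof. by rewrite /theta -!mulrA !gzb_gz gzb_anti !mulrN !opprK. Qed.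

Lemma theta_killl j k p : theta j k * theta j p = 0.
Proof. by rewrite /theta -!mulrA gzb_gz mulrN !mulrA gz_sq !mul0r oppr0. Qed.

Lemma theta_killr j k p : theta j k * theta p k = 0.
Proof. by rewrite theta_comm /theta -!mulrA gzb_gz gzb_sq !(mulr0, oppr0). Qed.

Definition om j : A := c0 *: theta j j.
Definition bet : A := \sum_j om j.

Lemma om_comm i j : om i * om j = om j * om i.
Proof. by rewrite /om -[LHS]scalerAl -[RHS]scalerAl -!scalerAr theta_comm. Qed.

Lemma om_sq i : om i * om i = 0.
Proof. by rewrite /om -scalerAl -scalerAr theta_killl !scaler0. Qed.

(** Partial sums of beta. A form containing dz_j or dzbar_j blocks the index j of beta, and a power
    larger than the number of unblocked indices vanishes; the formulas below are instances of this
    count. *)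
Definition betP (P : pred 'I_n) : A := \sum_(i | P i) om i.

Lemma betP_kill (w : A) (P Q : pred 'I_n) k : (forall i, Q i -> w * om i = 0) ->
  w * betP P ^+ k = w * betP (predI P (predC Q)) ^+ k.
Proof.
move=> wQ; rewrite /betP -big_filter (mul_sum_kill om_comm _ _ wQ) big_filter_cond.
by congr (_ * _ ^+ _); apply: eq_bigl.
Qed.

Lemma betP_eq0 (P : pred 'I_n) k : (#|P| < k)%N -> betP P ^+ k = 0.
Proof.
move=> Pk; rewrite /betP -big_filter (sum_sqr0_exp_eq0 om_comm om_sq)//.
by apply: leq_ltn_trans Pk; rewrite cardE /enum_mem.
Qed.

Lemma betE : bet = betP predT. Proof. by []. Qed.

Lemma bet_kill (w : A) (Q : pred 'I_n) k : (forall i, Q i -> w * om i = 0) ->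
  (#|predC Q| < k)%N -> w * bet ^+ k = 0.
Proof. by move=> wQ cQ; rewrite betE (betP_kill _ _ wQ) betP_eq0 ?mulr0. Qed.

Lemma theta_om_l j k : theta j k * om j = 0.
Proof. by rewrite /om -scalerAr theta_killl scaler0. Qed.

Lemma theta_om_r j k : theta j k * om k = 0.
Proof. by rewrite /om -scalerAr theta_killr scaler0. Qed.

(** Two distinct indices are blocked, so only m terms remain for the power m + 1. *)
Lemma theta_bet_offdiag j k : j != k -> theta j k * bet ^+ m.+1 = 0.
Proof.
move=> jk; apply: (@bet_kill _ (pred2 j k)) => [i /orP[] /eqP ->|].
- exact: theta_om_l.
- exact: theta_om_r.
have := cardC (pred2 j k); rewrite card2 jk card_ord /= !add2n ltnS => -[] h.
by apply: eq_leq; rewrite -[RHS]h.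
Qed.

Lemma card_predC1 (j : 'I_n) : #|predC (pred1 j)| = m.+1.
Proof. by have := cardC (pred1 j); rewrite card1 card_ord add1n => -[]. Qed.

Lemma bet_split j : bet = om j + betP (predC (pred1 j)).
Proof. by rewrite /bet (bigD1 j). Qed.

Lemma om_betP_comm j P : GRing.comm (om j) (betP P).
Proof.
by apply: (big_ind (GRing.comm (om j))) => [|x y|i _]; [exact: commr0|exact: commrD|exact: om_comm].
Qed.

Lemma om_kill j i : pred1 j i -> om j * om i = 0.
Proof. by move=> /eqP ->; exact: om_sq. Qed.

(** Expanding bet^n along [om j], the power n of the n - 1 other terms vanishes and n om_j bet^(n-1)
    is left. *)
Lemma om_bet j : om j * bet ^+ m.+1 = n%:R^-1 *: bet ^+ n.
Proof.
rewrite {1}betE (betP_kill _ _ (@om_kill j)).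
rewrite (bet_split j) (exprD_sqr0 _ (om_sq j) (om_betP_comm _ _)).
rewrite [betP (predC (pred1 j)) ^+ n]betP_eq0 ?card_predC1// add0r mulr_natl -[(om j * _) *+ _]scaler_nat scalerA mulVf ?scale1r//.
Qed.

Lemma om_om_bet j p : j != p ->
  om j * om p * bet ^+ m = (n%:R * m.+1%:R)^-1 *: bet ^+ n.
Proof.
move=> jp.
have h : om p * bet ^+ m.+1 = m.+1%:R *: (om j * om p * bet ^+ m).
  have -> : om j * om p * bet ^+ m = om j * om p * betP (predC (pred1 j)) ^+ m.
    rewrite betE (@betP_kill _ _ (pred1 j))//.
    by move=> i /eqP ->; rewrite -mulrA (om_comm p j) mulrA om_sq mul0r.
  rewrite (bet_split j) (exprD_sqr0 _ (om_sq j) (om_betP_comm _ _)) mulrDr.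
  rewrite (betP_kill _ _ (@om_kill p)) betP_eq0 ?mulr0 ?add0r.
    by rewrite mulr_natl -scaler_nat -scalerAr mulrA om_comm.
  have := cardC (pred2 j p); rewrite card2 jp card_ord /= !add2n ltnS => -[] hc.
  by rewrite -[X in (_ <= X)%N]hc; apply: eq_leq; apply: eq_card => i; rewrite !inE negb_or.
rewrite invfM mulrC -scalerA -(om_bet p) h scalerA.
by rewrite mulVf ?scale1r// pnatr_eq0.
Qed.

(** Three blocked indices leave n - 3 terms for the power n - 2. *)
Lemma theta_theta_kill j k p q a b c : a \in [:: j; k; p; q] ->
  b \in [:: j; k; p; q] -> c \in [:: j; k; p; q] ->
  uniq [:: a; b; c] -> theta j k * theta p q * bet ^+ m = 0.
Proof.
move=> aP bP cP abc.
have K i : i \in [:: j; k; p; q] -> theta j k * theta p q * om i = 0.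
  rewrite !inE => /or4P[] /eqP ->.
  - by rewrite theta_comm -mulrA theta_om_l mulr0.
  - by rewrite theta_comm -mulrA theta_om_r mulr0.
  - by rewrite -mulrA theta_om_l mulr0.
  - by rewrite -mulrA theta_om_r mulr0.
apply: (@bet_kill _ (mem [:: a; b; c])) => [i|].
  by rewrite /= !inE => /or3P[] /eqP ->; exact: K.
have := cardC (mem [:: a; b; c]); rewrite card_ord (card_uniqP abc) /= => h.
by apply: eq_leq; case: h.
Qed.

(** Products with j = p or k = q vanish by themselves, and three distinct indices are too many. What
    remains is j = k, p = q, or j = q, k = p; the latter differs from the former by an exchange of
    two dzbar factors, hence the sign. *)
Lemma theta_theta_bet j k p q :
  c0 ^+ 2 *: (theta j k * theta p q * bet ^+ m) =
  (((j == k) && (p == q))%:R - ((j == q) && (k == p))%:R) *: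
    ((n%:R * m.+1%:R)^-1 *: bet ^+ n).
Proof.
have om2 a b : c0 ^+ 2 *: (theta a a * theta b b * bet ^+ m) = om a * om b * bet ^+ m.
  by rewrite /om -scalerAl -scalerAr -!scalerAl scalerA.
have [<-|jp] := eqVneq j p.
  rewrite theta_killl mul0r scaler0 [k == j]eq_sym.
  by rewrite andbC subrr scale0r.
have [<-|kq] := eqVneq k q.
  rewrite theta_killr mul0r scaler0 [k == p]eq_sym.
  by rewrite subrr scale0r.
have [jk|jk] := eqVneq j k.
  subst k; have [pq|pq] := eqVneq p q.
    subst q; rewrite (negbTE jp) /= subr0 scale1r -(om_om_bet jp); exact: om2.
  rewrite (@theta_theta_kill _ _ _ _ j p q) ?inE ?eqxx ?orbT//= ?inE ?negb_or ?jp ?kq ?pq//.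
  by rewrite (negbTE kq) /= subrr scale0r scaler0.
have [jq|jq] := eqVneq j q.
  subst q; have [kp|kp] := eqVneq k p.
    subst p; rewrite theta_mul mulNr scalerN om2 om_om_bet// /= sub0r scaleN1r//.
  rewrite (@theta_theta_kill _ _ _ _ j k p) ?inE ?eqxx ?orbT//= ?inE ?negb_or ?jp ?jk ?kp//.
  by rewrite /= subrr scale0r scaler0.
rewrite (@theta_theta_kill _ _ _ _ j k q) ?inE ?eqxx ?orbT//= ?inE ?negb_or ?jq ?jk ?kq//.
by rewrite /= subrr scale0r scaler0.
Qed.

Definition frm (M : 'M[C]_n) : A := \sum_j \sum_k (c0 * M j k) *: theta j k.

Lemma frm_bet M : frm M * bet ^+ m.+1 = (\tr M / n%:R) *: bet ^+ n.
Proof.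
rewrite mulr_suml /mxtrace mulr_suml scaler_suml; apply: eq_bigr => j _.
rewrite mulr_suml (bigD1 j)//= big1 ?addr0; last first.
  by move=> k kj; rewrite -scalerAl theta_bet_offdiag ?scaler0// eq_sym.
have -> : (c0 * M j j) *: theta j j = M j j *: om j by rewrite /om scalerA mulrC.
by rewrite -scalerAl om_bet scalerA.
Qed.

Lemma frm_frm_bet M L : frm M * frm L * bet ^+ m =
  ((\tr M * \tr L - \tr (M *m L)) / (n%:R * m.+1%:R)) *: bet ^+ n.
Proof.
rewrite -scalerA; set X := _ *: bet ^+ n.
transitivity (\sum_j \sum_k \sum_p \sum_q
  (M j k * L p q * (((j == k) && (p == q))%:R - ((j == q) && (k == p))%:R)) *: X).
  rewrite /frm !mulr_suml; apply: eq_bigr => j _.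
  rewrite !mulr_suml; apply: eq_bigr => k _.
  rewrite mulr_sumr mulr_suml; apply: eq_bigr => p _.
  rewrite mulr_sumr mulr_suml; apply: eq_bigr => q _.
  rewrite -[RHS]scalerA -theta_theta_bet scalerA -!scalerAl -scalerAr -!scalerAl scalerA.
  by congr (_ *: _); rewrite /GRing.scale /=; ring.
rewrite scalerBl.
have -> : \tr M * \tr L = \sum_j \sum_k \sum_p \sum_q M j k * L p q * ((j == k) && (p == q))%:R.
  rewrite /mxtrace mulr_suml; apply: eq_bigr => j _; rewrite [RHS](bigD1 j)//= [X in _ + X]big1 ?addr0.
    rewrite mulr_sumr; apply: eq_bigr => p _; rewrite [RHS](bigD1 p)//= big1 ?addr0.
      by rewrite !eqxx mulr1.
    by move=> q; rewrite eq_sym => /negbTE ->; rewrite andbF mulr0.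
  move=> k; rewrite eq_sym => /negbTE jk; apply: big1 => p _; apply: big1 => q _.
  by rewrite jk mulr0.
have -> : \tr (M *m L) = \sum_j \sum_k \sum_p \sum_q M j k * L p q * ((j == q) && (k == p))%:R.
  rewrite /mxtrace; apply: eq_bigr => j _; rewrite mxE; apply: eq_bigr => k _.
  rewrite [RHS](bigD1 k)//= [X in _ + X]big1 ?addr0.
    rewrite [RHS](bigD1 j)//= big1 ?addr0; first by rewrite !eqxx mulr1.
    by move=> q; rewrite eq_sym => /negbTE ->; rewrite mulr0.
  move=> p; rewrite eq_sym => /negbTE kp; apply: big1 => q _.
  by rewrite kp andbF mulr0.
rewrite !scaler_suml -sumrB; apply: eq_bigr => j _.
rewrite !scaler_suml -sumrB; apply: eq_bigr => k _.
rewrite !scaler_suml -sumrB; apply: eq_bigr => p _.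
rewrite !scaler_suml -sumrB; apply: eq_bigr => q _.
by rewrite -scalerBl -mulrBr.
Qed.

Lemma frm_theta_comm M j k : theta j k * frm M = frm M * theta j k.
Proof.
rewrite /frm mulr_sumr mulr_suml; apply: eq_bigr => p _.
rewrite mulr_sumr mulr_suml; apply: eq_bigr => q _.
by rewrite -scalerAl -scalerAr theta_comm.
Qed.

Lemma frm_comm M L : GRing.comm (frm M) (frm L).
Proof.
rewrite /GRing.comm {1 4}/frm mulr_sumr mulr_suml; apply: eq_bigr => p _.
rewrite mulr_sumr mulr_suml; apply: eq_bigr => q _.
by rewrite -scalerAl -scalerAr frm_theta_comm.
Qed.

Lemma frm1 : frm 1%:M = bet.
Proof.
apply: eq_bigr => j _; rewrite (bigD1 j)//= mxE eqxx mulr1 big1 ?addr0// => k.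
by rewrite eq_sym mxE => /negbTE ->; rewrite mulr0 scale0r.
Qed.

Lemma frmB M L : frm (M - L) = frm M - frm L.
Proof.
rewrite -sumrB; apply: eq_bigr => j _; rewrite -sumrB; apply: eq_bigr => k _.
by rewrite -scalerBl !mxE -mulrBr.
Qed.

Lemma frmZ a M : frm (a *: M) = a *: frm M.
Proof.
rewrite scaler_sumr; apply: eq_bigr => j _; rewrite scaler_sumr; apply: eq_bigr => k _.
by rewrite scalerA mxE; congr (_ *: _); ring.
Qed.

Section RankOne.
Variables (x y : 'I_n -> C).
Let E : 'M[C]_n := \matrix_(j, k) (x j * y k).

(** Up to a scalar the form is a product X Y of a (1,0)-form and a (0,1)-form, and X X = 0. *)
Lemma frm_rank1_sq : frm E * frm E = 0.
Proof.
pose X := \sum_j x j *: gz j; pose Y := \sum_j y j *: gzb j.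
have XX : X * X = 0.
  have e : X * X = \sum_j \sum_k (x j * x k) *: (gz j * gz k).
    rewrite {1}/X mulr_suml; apply: eq_bigr => j _; rewrite /X mulr_sumr.
    by apply: eq_bigr => k _; rewrite -scalerAl -scalerAr scalerA.
  have hX : X * X = - (X * X).
    rewrite e [in LHS]exchange_big -sumrN; apply: eq_bigr => j _.
    rewrite -sumrN; apply: eq_bigr => k _.
    by rewrite gz_anti scalerN mulrC.
  move/eqP: hX; rewrite -addr_eq0 -mulr2n -scaler_nat scaler_eq0 pnatr_eq0 /=.
  by move/eqP.
have YX : Y * X = - (X * Y).
  have e1 : X * Y = \sum_j \sum_k (x j * y k) *: (gz j * gzb k).
    rewrite /X mulr_suml; apply: eq_bigr => j _; rewrite /Y mulr_sumr.
    by apply: eq_bigr => k _; rewrite -scalerAl -scalerAr scalerA.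
  rewrite e1 exchange_big /Y mulr_suml -sumrN; apply: eq_bigr => j _.
  rewrite /X mulr_sumr -sumrN; apply: eq_bigr => k _.
  by rewrite -scalerAl -scalerAr scalerA gzzb_anti scalerN mulrC.
have -> : frm E = c0 *: (X * Y).
  rewrite /frm /X mulr_suml scaler_sumr; apply: eq_bigr => j _.
  rewrite mulr_sumr scaler_sumr; apply: eq_bigr => k _.
  by rewrite mxE /theta -[in RHS]scalerAl -[in RHS]scalerAr !scalerA mulrA.
rewrite -scalerAl -scalerAr; have -> : X * Y * (X * Y) = 0; last by rewrite !scaler0.
by rewrite mulrA -[X * Y * X]mulrA YX mulrN mulrA XX mul0r oppr0 mul0r.
Qed.

Variable c : C.
Let al := frm (1%:M - c *: E).

(** The rank-one part squares to 0, so powers of [al] are affine in it; this makes the mixed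
    densities explicit. *)
Lemma al_exp k : al ^+ k.+1 = bet ^+ k.+1 - (k.+1%:R * c) *: (frm E * bet ^+ k).
Proof.
have -> : al = - (c *: frm E) + bet by rewrite /al frmB frm1 frmZ addrC.
rewrite exprD_sqr0; last 2 first.
- by rewrite mulrN mulNr opprK -scalerAl -scalerAr frm_rank1_sq !scaler0.
- rewrite /GRing.comm mulNr mulrN -scalerAl -scalerAr -frm1; congr (- (_ *: _)).
  exact: frm_comm.
by rewrite mulr_natl mulNr mulNrn -scalerAl -scaler_nat scalerA.
Qed.

Hypothesis trE : \tr E = 1.

Lemma al_bet k : (k <= n)%N -> al ^+ k * bet ^+ (n - k) = (1 - k%:R * c / n%:R) *: bet ^+ n.
Proof.
case: k => [|k] kn; first by rewrite expr0 mul1r subn0 mul0r mul0r subr0 scale1r.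
rewrite al_exp mulrBl -exprD subnKC// -scalerAl -[_ * bet ^+ k * _]mulrA -exprD.
have -> : (k + (n - k.+1))%N = m.+1 by rewrite subSS subnKC// -ltnS.
by rewrite frm_bet trE scalerA scalerBl scale1r mul1r.
Qed.

Lemma frm_al_bet M k : (k < m.+2)%N ->
  frm M * (al ^+ k * bet ^+ (m.+1 - k)) =
  ((\tr M - k%:R * c * (\tr M - \tr (M *m E)) / m.+1%:R) / n%:R) *: bet ^+ n.
Proof.
case: k => [|k] kn; first by rewrite expr0 mul1r subn0 frm_bet !mul0r subr0.
rewrite al_exp mulrBl -exprD subnKC// mulrBr frm_bet -scalerAl -[_ * bet ^+ k * _]mulrA -exprD.
have -> : (k + (m.+1 - k.+1))%N = m by rewrite subSS subnKC// -ltnS.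
rewrite -scalerAr mulrA frm_frm_bet trE scalerA -scalerBl; congr (_ *: _).
by rewrite invfM; ring.
Qed.
End RankOne.
End Grassmann.

Section Density.
Variables (R : realType) (n : nat).
Local Notation C := R[i].
Local Notation E := (ext R n).

Lemma gen_anti (g h : 'I_(n + n)) :
  (gen R g : E) * (gen R h : E) = - ((gen R h : E) * (gen R g : E)).
Proof.
rewrite -[LHS]/(wedge (mono R [set g]%SET) (mono R [set h]%SET)).
rewrite -[RHS]/(- wedge (mono R [set h]%SET) (mono R [set g]%SET)).
rewrite !wedge_mono !inversionsE !big_set1 finset.setUC disjC.
have [->|gh] := eqVneq g h.
  rewrite (_ : disj _ _ = false); last first.
    by rewrite /disj finset.setIid; apply/negP => /eqP/setP/(_ h); rewrite !inE eqxx.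
  by rewrite mul0r scale0r oppr0.
rewrite -scaleNr; congr (_ *: _); rewrite -mulrN; congr (_ * _).
by case: (ltngtP g h) gh => [||/val_inj ->]; rewrite ?eqxx// expr0 expr1 ?opprK.
Qed.

Lemma gen_sq (g : 'I_(n + n)) : (gen R g : E) * (gen R g : E) = 0.
Proof.
rewrite -[LHS]/(wedge (mono R [set g]%SET) (mono R [set g]%SET)) wedge_mono.
rewrite (_ : disj _ _ = false) ?mul0r ?scale0r//.
by rewrite /disj finset.setIid; apply/negP => /eqP/setP/(_ g); rewrite !inE eqxx.
Qed.

Definition gz (j : 'I_n) : E := dz R j.
Definition gzb (j : 'I_n) : E := dzbar R j.

Lemma gz_sq j : gz j * gz j = 0. Proof. exact: gen_sq. Qed.
Lemma gzb_sq j : gzb j * gzb j = 0. Proof. exact: gen_sq. Qed.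
Lemma gz_anti j k : gz j * gz k = - (gz k * gz j). Proof. exact: gen_anti. Qed.
Lemma gzb_anti j k : gzb j * gzb k = - (gzb k * gzb j). Proof. exact: gen_anti. Qed.
Lemma gzzb_anti j k : gzb j * gz k = - (gz k * gzb j). Proof. exact: gen_anti. Qed.

Lemma wedge_expE (w : E) k : wedge_exp w k = w ^+ k :> E.
Proof. by elim: k => // k IH; rewrite exprS -IH. Qed.

Lemma wedgesE (s : seq E) : wedges s = \prod_(w <- s) w :> E.
Proof. by elim: s => [|w s IH]; rewrite ?big_nil// big_cons -IH. Qed.

Let v (j : 'I_n) : E := ('i / 2 : C) *: (gz j * gzb j).

Lemma volume_formE : volume_form R n = \prod_(j <- enum 'I_n) v j :> E.
Proof. by rewrite /volume_form wedgesE big_map. Qed.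

Lemma gen_mulr_mono (g : 'I_(n + n)) (S : {set 'I_(n + n)}) : g \notin S ->
  exists2 a : C, a != 0 & (gen R g : E) * (mono R S : E) = a *: (mono R (g |: S) : E).
Proof.
move=> gS; exists ((-1) ^+ inversions [set g]%SET S); first by rewrite signr_eq0.
rewrite -[LHS]/(wedge (mono R [set g]%SET) (mono R S)) wedge_mono.
rewrite (_ : disj _ _ = true) ?mul1r//.
apply/eqP/setP => x; rewrite !inE; apply/andP => -[/eqP ->].
exact/negP.
Qed.

(** The nonvanishing of the top coefficient is the goal, so the signs produced by reordering the
    generators stay hidden in the scalar. *)
Lemma prod_v_mono (s : seq 'I_n) : uniq s -> exists2 a : C, a != 0 &
  \prod_(j <- s) v j =
  a *: (mono R [set g | match fintype.split g with inl j => j \in s | inr j => j \in s end] : E).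
Proof.
elim: s => [_|j s IH /= /andP[js us]].
  exists 1; first exact: oner_neq0; rewrite big_nil scale1r.
  rewrite -[LHS]/(form1 R n); apply/ffunP => T; rewrite !ffunE; congr (_ == _)%:R.
  by apply/setP => g; rewrite !inE; case: fintype.splitP.
have [a a0 aE] := IH us; rewrite big_cons aE.
set S := [set g | _]%SET in aE *.
have nr : rshift n j \notin S.
  by rewrite inE (unsplitK (inr j)).
have nl : lshift n j \notin (rshift n j |: S)%SET.
  rewrite !inE (unsplitK (inl j)) negb_or js andbT.
  by apply/eqP => /(congr1 val) /= h; have := ltn_ord j; rewrite h ltnNge leq_addr.
have [b b0 bE] := gen_mulr_mono nr; have [c c0 cE] := gen_mulr_mono nl.
exists ('i / 2 * a * b * c).
  by rewrite !mulf_neq0// ?invr_eq0 ?pnatr_eq0// eq_complex /= oner_eq0 andbF.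
have bE' : gzb j * (mono R S : E) = b *: (mono R (rshift n j |: S)%SET : E) := bE.
have cE' : gz j * (mono R (rshift n j |: S)%SET : E) =
  c *: (mono R (lshift n j |: (rshift n j |: S))%SET : E) := cE.
rewrite /v -scalerAl -scalerAr -[_ * gzb j * _]mulrA bE' -scalerAr cE' !scalerA.
rewrite [_ * (a * b)]mulrA; congr (_ *: mono R _); apply/setP => g; rewrite !inE.
case: (split_ordP g) => i ->; rewrite ?(unsplitK (inl i)) ?(unsplitK (inr i)) !inE.
  rewrite eq_lshift; case: eqP => //= _.
  by rewrite (_ : (lshift n i == rshift n j) = false)// eq_lrshift.
rewrite eq_rshift (_ : (rshift n i == lshift n j) = false) ?eq_rlshift//.
Qed.

Lemma volume_form_neq0 : volume_form R n [set: 'I_(n + n)]%SET != 0.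
Proof.
have [a a0] := prod_v_mono (enum_uniq 'I_n); rewrite -volume_formE => ->.
rewrite !ffunE.
have -> : ([set: 'I_(n + n)] == [set g | match fintype.split g with inl j => j \in enum 'I_n | inr j => j \in enum 'I_n end])%SET.
  by apply/eqP/setP => g; rewrite !inE; case: fintype.split => j; rewrite mem_enum.
by rewrite /GRing.scale /= mulr1.
Qed.

Lemma density_volume (a : C) : density (a *: (volume_form R n : E)) = a.
Proof. by rewrite /density ffunE mulfK// volume_form_neq0. Qed.

End Density.

(** * Extremal m-positive forms and the linear operators that they produce *)

Section HessianOperator.
Variables (R : realType) (k : nat).
Local Notation C := R[i].
Local Notation n := k.+2.
Local Notation E := (ext R n).
Local Notation gz := (@gz R n).
Local Notation gzb := (@gzb R n).
Local Notation bt := (bet gz gzb (2 * 'i)).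

Lemma form11E (M : 'M[C]_n) : form11 M = frm gz gzb (2 * 'i) M :> E.
Proof. by []. Qed.

Lemma form11_1 : form11 (1%:M : 'M[C]_n) = bt :> E.
Proof. by rewrite form11E frm1. Qed.

Lemma prod_scale (F : comNzRingType) (A : algType F) (I : Type) (s : seq I) (c : F) (b : I -> A) :
  \prod_(j <- s) (c *: b j) = c ^+ size s *: \prod_(j <- s) b j.
Proof.
elim: s => [|j s IH]; first by rewrite !big_nil scale1r.
by rewrite !big_cons IH exprS -scalerAl -scalerAr scalerA.
Qed.

Lemma natr_mul_scale (F : comNzRingType) (A : algType F) (j : nat) (c : F) (x : A) :
  j%:R * (c *: x) = (j%:R * c) *: x.
Proof. by rewrite mulr_natl -scaler_nat scalerA. Qed.

(** Each 2 i dz_j dzbar_j is 4 times the area form (i/2) dz_j dzbar_j; the factorial counts the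
    orders of the n factors. *)
Lemma bet_exp : bt ^+ n = (n`!%:R * 4 ^+ n) *: (volume_form R n : E).
Proof.
have omC := om_comm (2 * 'i : C) (@gz_anti R n) (@gzb_anti R n) (@gzzb_anti R n).
have om2 := om_sq (2 * 'i : C) (@gz_sq R n) (@gzzb_anti R n).
have [h _] := sum_sqr0_exp omC om2 (enum 'I_n).
rewrite size_enum_ord in h; rewrite /bet -big_enum h volume_formE.
have aux : \prod_(j <- enum 'I_n) om gz gzb (2 * 'i) j =
    4 ^+ size (enum 'I_n) *: \prod_(j <- enum 'I_n) (('i / 2 : C) *: (gz j * gzb j)) :> E.
  rewrite -prod_scale; apply: eq_bigr => j _.
  rewrite /om [RHS]scalerA; congr (_ *: _).
  by field.
rewrite aux size_enum_ord.
exact: natr_mul_scale.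
Qed.

Lemma density_bet (a : C) : density (a *: (bt ^+ n)) = a * (n`!%:R * 4 ^+ n).
Proof. by rewrite bet_exp scalerA density_volume. Qed.

Variables (m : nat) (e : 'rV[C]_n).
Hypothesis m1 : (1 <= m)%N.
Hypothesis mn : (m < n)%N.
Hypothesis e1 : sqnorm e = 1.

Let Em : 'M[C]_n := \matrix_(j, l) ((e 0 j)^* * e 0 l).

Let c : C := (n%:R / m%:R : R)%:C.

(* The densities of [alpha^l /\ beta^(n-l)] are positive multiples of [1 - l/m]. *)
Definition alpha : 'M[C]_n := 1%:M - c *: Em.

Lemma Re_conj (x : C) : complex.Re (x^*) = complex.Re x. Proof. by case: x. Qed.
Lemma Im_conj (x : C) : complex.Im (x^*) = - complex.Im x. Proof. by case: x. Qed.

Lemma tr_rank1 : \tr Em = 1.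
Proof.
rewrite /mxtrace -[RHS]/(1%:C) -e1 /sqnorm.
rewrite (big_morph (fun x : R => x%:C) (id1 := 0) (op1 := +%R)) //; last by move=> x y; apply: complex_eq; rewrite ?ReD ?ImD /= ?addr0.
apply: eq_bigr => j _; rewrite mxE; apply: complex_eq.
  by rewrite ReM Re_conj Im_conj /=; ring.
by rewrite ImM Re_conj Im_conj /=; ring.
Qed.

Let m0 : m%:R != 0 :> R. Proof. by rewrite pnatr_eq0 -lt0n. Qed.

Lemma alpha_m_positive : beta R n = form11 1%:M -> m_positive m alpha.
Proof.
move=> bE; split.
  move=> j l; apply: complex_eq; rewrite ?Re_conj ?Im_conj !mxE ?ReD ?ImD ?ReN ?ImN ?ReM ?ImM ?ReM ?ImM ?Re_conj ?Im_conj /= eq_sym.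
    by ring.
  by case: eqP => _ /=; ring.
move=> l /andP[l1 lm].
rewrite !wedge_expE bE form11_1.
have := @al_bet C E k gz gzb (2 * 'i) (@gz_sq R n) (@gzb_sq R n) (@gz_anti R n) (@gzb_anti R n) (@gzzb_anti R n)
  (fun j => (e 0 j)^*) (fun j => e 0 j) c tr_rank1 l.
move=> /(_ (leq_trans lm (ltnW mn))) h.
rewrite -[wedge _ _]/(frm gz gzb (2 * 'i) (1%:M - c *: Em) ^+ l * bt ^+ (n - l)) h density_bet.
have E q (r : nat) : (1 - l%:R * c / n%:R) * (r%:R * 4 ^+ q) = ((1 - l%:R / m%:R) * (r%:R * 4 ^+ q))%:C.
  rewrite /c !CMr CBr CXr !Cnat !CMr !CVr !Cnat; congr (_ * _).
  have mC : m%:R != 0 :> C by rewrite pnatr_eq0 -lt0n.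
  have k2 : k.+2%:R != 0 :> C by rewrite pnatr_eq0.
  rewrite -[1%:C]/(1 : C); move: k2; move: (k.+2%:R : C) => w k2.
  by field; rewrite mC k2.
have P (q r : nat) : 0 <= (1 - l%:R / m%:R) * (r%:R * 4 ^+ q) :> R.
  rewrite mulr_ge0 ?mulr_ge0 ?exprn_ge0//.
  by rewrite subr_ge0 ler_pdivrMr ?mul1r ?ler_nat// ltr0n.
by rewrite E ler0c P.
Qed.

Definition Hop (M : 'M[C]_n) : C :=
  (n%:R / m%:R - 1)%:C * \tr M + (m.-1%:R * (n%:R / m%:R))%:C * \tr (M *m Em).

(** With m - 1 factors alpha the trace formula yields (1 - s) tr M + s tr(M Em), where s = (m - 1) n
    / (m (n - 1)). Multiplied by n - 1, the coefficients become p and k0, and n! / (n (n - 1)) = (n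
    - 2)! is the remaining factorial. *)
Lemma density_alpha (M : 'M[C]_n) : beta R n = form11 1%:M ->
  density (wedge (form11 M)
    (wedge (wedges [seq form11 alpha | l <- enum 'I_m.-1]) (wedge_exp (beta R n) (n - m)))) =
  (k`!%:R * 4 ^+ n) * Hop M.
Proof.
move=> bE.
have -> : wedges [seq form11 alpha | l <- enum 'I_m.-1] = (form11 alpha : E) ^+ m.-1.
  rewrite wedgesE big_map big_const_seq count_predT size_enum_ord.
  by elim: (m.-1) => //= j ->; rewrite exprS.
rewrite wedge_expE bE form11_1.
have := @frm_al_bet C E k gz gzb (2 * 'i) (@gz_sq R n) (@gzb_sq R n) (@gz_anti R n) (@gzb_anti R n) (@gzzb_anti R n)
  (fun j => (e 0 j)^*) (fun j => e 0 j) c tr_rank1 M m.-1.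
have m1n : (m.-1 < k.+2)%N by apply: leq_ltn_trans (leq_pred _) _.
have -> : (n - m = k.+1 - m.-1)%N by case: (m) m1 => // m' _; rewrite subSS.
move=> /(_ m1n) h.
rewrite -[wedge _ _]/(frm gz gzb (2 * 'i) M * (frm gz gzb (2 * 'i) (1%:M - c *: Em) ^+ m.-1 *
        bt ^+ (k.+1 - m.-1))) h density_bet /Hop -/Em.
set t1 := \tr M; set t2 := \tr _.
have cE : c = n%:R / m%:R.
  by rewrite /c CMr CVr !Cnat.
have -> : (n%:R / m%:R - 1)%:C = n%:R / m%:R - 1 :> C.
  by rewrite CBr CMr CVr !Cnat.
have -> : (m.-1%:R * (n%:R / m%:R))%:C = m.-1%:R * (n%:R / m%:R) :> C.
  by rewrite !CMr CVr !Cnat.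
rewrite cE !factS !natrM.
have mC : m%:R != 0 :> C by rewrite pnatr_eq0 -lt0n.
have mE : m%:R = m.-1%:R + 1 :> C by rewrite natr1 prednK.
have k1 : k.+1%:R != 0 :> C by rewrite pnatr_eq0.
have k2 : k.+2%:R != 0 :> C by rewrite pnatr_eq0.
move: mC; rewrite mE; set q := m.-1%:R => mC.
have kE : k.+2%:R = k.+1%:R + 1 :> C by rewrite natr1.
rewrite kE in k2 *; move: k1 k2; set r := k.+1%:R => k1 k2.
field.
by rewrite mC /=; move: k1 k2; rewrite /r -natr1 ![_ + 1]addrC => -> ->.
Qed.
End HessianOperator.

(** * Smooth radial test functions *)

Section FlatExponential.
Variable R : realType.
Implicit Types (P : {poly R}) (x : R).
Local Notation D := has_deriv.

(** This family is stable under differentiation, P being replaced by X^2 (P - P'). Smoothness to all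
    orders thus reduces to a single derivative. *)
Definition flat P x : R := if 0 < x then P.[x^-1] * expR (- x^-1) else 0.

Lemma has_deriv_horner P x : D (horner P) x P^`().[x].
Proof. exact: is_derive_poly. Qed.

Lemma has_deriv_quadratic (f : R -> R) (K d : R) : 0 < d ->
  f 0 = 0 -> (forall x, `|x| < d -> `|f x| <= K * x ^+ 2) -> D f 0 0.
Proof.
move=> d0 f0 fK.
have lim : (h^-1 *: (f (h *: 1 + 0) - f 0)) @[h --> 0^'] --> (0 : R).
  apply/cvgrPdist_le => e e0.
  have K1 : 0 < `|K| + 1 by rewrite ltr_wpDl.
  near=> h.
  have h0 : h != 0 by near: h; exact: nbhs_dnbhs_neq.
  have hd : `|h| < d.
    near: h; exact: dnbhs0_lt.
  have he : `|h| < e / (`|K| + 1).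
    near: h; apply: dnbhs0_lt; exact: divr_gt0.
  rewrite /GRing.scale /= mulr1 addr0 f0 subr0 sub0r normrN normrM normfV.
  have hp : 0 < `|h| by rewrite normr_gt0.
  rewrite ler_pdivrMl//; apply: le_trans (fK _ hd) _.
  apply: le_trans (_ : `|K| * `|h| ^+ 2 <= _).
    by rewrite real_normK ?num_real// ler_wpM2r ?sqr_ge0// ler_norm.
  rewrite expr2 mulrA [leLHS]mulrC ler_pM2l//.
  move: he; rewrite ltr_pdivlMr// => /ltW; apply: le_trans.
  by rewrite mulrC ler_pM2l// lerDl.
split; first by apply/cvg_ex; exists 0.
exact: cvg_lim lim.
Unshelve. all: by end_near. Qed.

Lemma horner_bound P : exists k, exists2 K : R, 0 <= K &
  forall y, 1 <= y -> `|P.[y]| <= K * y ^+ k.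
Proof.
elim/poly_ind: P => [|P c [k [K K0 IH]]].
  by exists 0%N, 0 => // y _; rewrite horner0 normr0 mul0r.
exists k.+1, (K + `|c|) => [|y y1]; first by rewrite addr_ge0.
have y0 : 0 <= y by apply: le_trans y1.
rewrite hornerMXaddC mulrDl; apply: le_trans (ler_normD _ _) _; apply: lerD.
  by rewrite normrM (ger0_norm y0) exprSr mulrA ler_wpM2r// IH.
by rewrite ler_peMr// exprn_ege1.
Qed.

(** With y = 1/x and P bounded by K y^k, the exponential series gives y^(k+2) <= (k+2)! exp y. The
    two extra powers yield the factor x^2, and with it differentiability at 0. *)
Lemma flat_quadratic P : exists K : R, forall x, `|x| < 1 -> `|flat P x| <= K * x ^+ 2.
Proof.
have [k [K K0 PK]] := horner_bound P.
exists (K * (k.+2)`!%:R) => x; rewrite /flat; case: ifPn => [x0|_ _]; last first.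
  by rewrite normr0 mulr_ge0 ?sqr_ge0 ?mulr_ge0.
rewrite (gtr0_norm x0) => x1; set y := x^-1.
have y1 : 1 <= y by rewrite invf_ge1// ltW.
have y0 : 0 < y by rewrite invr_gt0.
rewrite normrM (ger0_norm (expR_ge0 _)) expRN.
rewrite ler_pdivrMr ?expR_gt0//; apply: le_trans (PK _ y1) _.
rewrite -!mulrA ler_wpM2l//.
have := @expR_ge1Dxn R y k.+1 (ltW y0).
have f0 : 0 < (k.+2)`!%:R :> R by rewrite ltr0n fact_gt0.
move=> h; have {h} : y ^+ k.+2 <= (k.+2)`!%:R * expR y.
  rewrite mulrC -ler_pdivrMr//; apply: le_trans h; by rewrite lerDr.
have y2 : 0 < y ^+ 2 by rewrite exprn_gt0.
move=> h; rewrite -(ler_pM2r y2) -exprD addn2; apply: le_trans h _.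
rewrite (_ : _ * y ^+ 2 = (k.+2)`!%:R * expR y)//.
have -> : x = y^-1 by rewrite invrK.
move: (y) (y0) => w w0 /=.
by move: (expR w) => v; field; rewrite gt_eqF.
Qed.

Lemma has_deriv_flat P x : D (flat P) x (flat ('X^2 * (P - P^`())) x).
Proof.
have [x0|x0|->] := ltgtP x 0.
- rewrite [X in D _ _ X](_ : _ = 0); last by rewrite /flat ltNge ltW.
  apply: (@has_deriv_near _ (fun=> 0)); last exact: has_deriv_cst.
  near=> y; have y0 : y < 0 by near: y; exact: lt_nbhsl.
  by rewrite /flat ltNge ltW.
- rewrite /flat x0; have x0' : x != 0 by rewrite gt_eqF.
  apply: (@has_deriv_near _ (fun y => P.[y^-1] * expR (- y^-1))).
    by near=> y; have -> : 0 < y by near: y; exact: lt_nbhsr.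
  have dV := has_derivV x0' (has_deriv_id x).
  apply: has_deriv_eq.
    apply: has_derivM; first exact: has_deriv_comp (has_deriv_horner _ _) dV.
    by apply: has_deriv_comp; [exact: is_derive_expR|exact: has_derivN dV].
  rewrite hornerM hornerXn hornerD hornerN exprVn.
  by move: (expR _) => w; field.
- rewrite [X in D _ _ X](_ : _ = 0); last by rewrite /flat ltxx.
  have [K PK] := flat_quadratic P.
  by apply: (has_deriv_quadratic ltr01 _ PK); rewrite /flat ltxx.
Unshelve. all: by end_near. Qed.

End FlatExponential.

Section SmoothFunctions.
Variables (R : realType) (n : nat).
Local Notation V := 'rV[R[i]]_n.

(** An explicit class that contains the radial test functions used later and is stable under
    directional derivatives. It therefore lies in [smooth], which quantifies over all iterated
    derivatives. *)
Inductive elementary : (V -> R) -> Prop :=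
| elementary_cst c : elementary (fun=> c)
| elementary_rdot v : elementary (fun z => rdot z v)
| elementary_add f g : elementary f -> elementary g -> elementary (fun z => f z + g z)
| elementary_mul f g : elementary f -> elementary g -> elementary (fun z => f z * g z)
| elementary_flat P f : elementary f -> elementary (fun z => flat P (f z)).

Lemma has_deriv_rdot (z v w : V) (x : R) :
  has_deriv (fun t : R => rdot (z + t%:C *: v) w) x (rdot v w).
Proof.
apply: (@has_deriv_ext _ (fun t => rdot v w * t + rdot z w)).
  by move=> t; rewrite rdotDl rdotZl; ring.
apply: has_deriv_eq.
  by apply: has_derivD; [apply: has_derivZ; exact: has_deriv_id|exact: has_deriv_cst].
by rewrite mulr1 addr0.
Qed.

Lemma elementary_deriv f (v : V) : elementary f -> exists2 f', elementary f' &
  forall z, has_deriv (fun t : R => f (z + t%:C *: v)) 0 (f' z).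
Proof.
have z0 (z : V) : z + 0%:C *: v = z by rewrite scale0r addr0.
elim=> [c|w|g h eg [g' eg' dg] eh [h' eh' dh]|g h eg [g' eg' dg] eh [h' eh' dh]|P g eg [g' eg' dg]].
- by exists (fun=> 0) => [|z]; [exact: elementary_cst|exact: has_deriv_cst].
- exists (fun=> rdot v w) => [|z]; first exact: elementary_cst.
  exact: has_deriv_rdot.
- exists (fun z => g' z + h' z) => [|z]; first exact: elementary_add.
  exact: has_derivD.
- exists (fun z => g' z * h z + g z * h' z) => [|z].
    by apply: elementary_add; apply: elementary_mul.
  by have := has_derivM (dg z) (dh z); rewrite z0.
- exists (fun z => flat ('X^2 * (P - P^`())) (g z) * g' z) => [|z].
    by apply: elementary_mul => //; exact: elementary_flat.
  have := has_deriv_flat P (g (z + 0%:C *: v)).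
  by move=> h; have := has_deriv_comp h (dg z); rewrite z0.
Qed.

Lemma continuous_rdot (w : V) : continuous (fun z : V => rdot z w).
Proof.
move=> z A /nbhs_ballP[e /= e0 eA]; apply/nbhs_eballP; exists (e / (enorm w + 1)).
  by rewrite divr_gt0// ltr_wpDl ?enorm_ge0.
move=> x; rewrite /eball /= => zx; apply: eA; rewrite /ball /= -rdotNl -rdotDl.
apply: le_lt_trans (ler_rdot _ _) _.
have w1 : 0 < enorm w + 1 by rewrite ltr_wpDl ?enorm_ge0.
move: zx; rewrite ltr_pdivlMr//; apply: le_lt_trans; rewrite enormB.
by rewrite ler_wpM2l ?enorm_ge0// lerDl.
Qed.

Lemma elementary_continuous f : elementary f -> continuous f.
Proof.
elim=> [c|w|g h eg cg eh ch|g h eg cg eh ch|P g eg cg].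
- exact: cst_continuous.
- exact: continuous_rdot.
- by move=> z; exact: cvgD (cg z) (ch z).
- by move=> z; exact: cvgM (cg z) (ch z).
- move=> z; apply: (@continuous_comp _ _ _ g (flat P)); first exact: cg.
  exact: has_deriv_continuous (has_deriv_flat _ _).
Qed.

Lemma elementary_rderive f v : elementary f -> elementary (rderive v f).
Proof.
move=> /(@elementary_deriv _ v)[f' ef' df'].
rewrite (_ : rderive v f = f')//; apply/funext => z.
by have [] := has_derivP (df' z).
Qed.

Lemma elementary_smooth f : elementary f -> smooth f.
Proof.
move=> ef s; have eg : elementary (foldr (@rderive R n) f s).
  by elim: s => //= v s IH; exact: elementary_rderive.
split=> [|z v]; first exact: elementary_continuous.
have [f' _ df] := elementary_deriv v eg.
by have [] := has_derivP (df z).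
Qed.

Lemma rdot_delta (z : V) j : rdot z (delta_mx 0 j) = complex.Re (z 0 j).
Proof.
rewrite /rdot (bigD1 j)//= big1 => [|k kj]; rewrite !mxE ?eqxx /=; last first.
  by rewrite (negPf kj) /= !mulr0 addr0.
by rewrite mulr1 mulr0 !addr0.
Qed.

Lemma rdot_Idelta (z : V) j : rdot z ('i *: delta_mx 0 j) = complex.Im (z 0 j).
Proof.
rewrite /rdot (bigD1 j)//= big1 => [|k kj]; rewrite !mxE ?eqxx /=; last first.
  by rewrite (negPf kj) !(ReM, ImM) /=; ring.
by rewrite /=; ring.
Qed.

Lemma elementary_sum (I : Type) (s : seq I) (f : I -> V -> R) :
  (forall j, elementary (f j)) -> elementary (fun z => \sum_(j <- s) f j z).
Proof.
move=> ef; elim: s => [|j s IH].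
  by rewrite (_ : (fun z => _) = fun=> 0); [exact: elementary_cst|apply/funext => z; rewrite big_nil].
rewrite (_ : (fun z => _) = fun z => f j z + \sum_(j <- s) f j z).
  exact: elementary_add.
by apply/funext => z; rewrite big_cons.
Qed.

Lemma elementary_sqnorm (c : V) : elementary (fun z => sqnorm (z - c)).
Proof.
rewrite (_ : (fun z => _) = fun z => \sum_j rdot z (delta_mx 0 j) * rdot z (delta_mx 0 j) +
    \sum_j rdot z ('i *: delta_mx 0 j) * rdot z ('i *: delta_mx 0 j)
    + (rdot z ((-2)%:C *: c) + sqnorm c)).
  by do ?apply: elementary_add; do ?[apply: elementary_sum => j; apply: elementary_mul];
    do ?[exact: elementary_rdot|exact: elementary_cst].
apply/funext => z; rewrite sqnormD sqnormN rdotNr rdotZr mulNr mulrN -addrA; congr (_ + _).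
rewrite -big_split /=; apply: eq_bigr => j _.
by rewrite rdot_delta rdot_Idelta !expr2.
Qed.

Lemma has_deriv_sqnorm (c z v : V) (x : R) :
  has_deriv (fun t : R => sqnorm (z + t%:C *: v - c)) x (2 * rdot (z + x%:C *: v - c) v).
Proof.
apply: (@has_deriv_ext _ (fun t => t ^+ 2 * sqnorm v + (2 * rdot (z - c) v * t + sqnorm (z - c)))).
  by move=> t; rewrite (addrAC z) [in RHS]sqnormD sqnormZ rdotZr; ring.
apply: has_deriv_eq.
  apply: has_derivD; first exact: has_deriv_sqrM.
  apply: has_derivD; last exact: has_deriv_cst.
  by apply: has_derivZ; exact: has_deriv_id.
by rewrite (addrAC z) [in RHS]rdotDl rdotZl sqnormE; ring.
Qed.

Section Radial.
Variables (g g1 g2 : R -> R) (c : V).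
Hypothesis dg : forall x, has_deriv g x (g1 x).
Hypothesis dg1 : forall x, has_deriv g1 x (g2 x).

Lemma has_deriv_radial (z v : V) (x : R) : has_deriv (fun t : R => g (sqnorm (z + t%:C *: v - c))) x
  (g1 (sqnorm (z + x%:C *: v - c)) * (2 * rdot (z + x%:C *: v - c) v)).
Proof. by apply: has_deriv_comp; [exact: dg|exact: has_deriv_sqnorm]. Qed.

Lemma rderive_radial (z v : V) :
  rderive v (fun w => g (sqnorm (w - c))) z = g1 (sqnorm (z - c)) * (2 * rdot (z - c) v).
Proof.
by have [_ h] := has_derivP (has_deriv_radial z v 0); rewrite scale0r addr0 in h.
Qed.

Lemma rderive_cst (z v : V) (a : R) : rderive v (fun=> a) z = 0.
Proof. by rewrite /rderive derive1_cst. Qed.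

Lemma dwbar_radial k (z : V) : dwbar k (fun w => (g (sqnorm (w - c)))%:C) z =
  (g1 (sqnorm (z - c)))%:C * (z - c) 0 k.
Proof.
rewrite /dwbar /cderive /= !rderive_cst !rderive_radial rdot_delta rdot_Idelta.
have -> : forall a b : R, (g1 (sqnorm (z - c)) * (2 * a) +i* 0 +
    'i * (g1 (sqnorm (z - c)) * (2 * b) +i* 0)) / 2 = (g1 (sqnorm (z - c)))%:C * (a +i* b).
  move=> a b; apply: (@mulIf _ 2); rewrite ?pnatr_eq0// divfK ?pnatr_eq0//.
  by apply: complex_eq; rewrite !(ReD, ImD, ReM, ImM) /=; ring.
by case: ((z - c) 0 k).
Qed.

Lemma cderive_radial k (z v : V) : cderive v (fun w => (g1 (sqnorm (w - c)))%:C * (w - c) 0 k) z =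
  (g2 (sqnorm (z - c)) * (2 * rdot (z - c) v))%:C * (z - c) 0 k + (g1 (sqnorm (z - c)))%:C * v 0 k.
Proof.
have d1 : has_deriv (fun t : R => g1 (sqnorm (z + t%:C *: v - c))) 0
    (g2 (sqnorm (z - c)) * (2 * rdot (z - c) v)).
  have := has_deriv_comp (dg1 _) (has_deriv_sqnorm c z v 0).
  by rewrite scale0r addr0.
have dl (w : V) : has_deriv (fun t : R => rdot (z + t%:C *: v - c) w) 0 (rdot v w).
  apply: (@has_deriv_ext _ (fun t => rdot (z - c + t%:C *: v) w)).
    by move=> t; rewrite addrAC.
  exact: has_deriv_rdot.
rewrite /cderive; apply: complex_eq => /=.
  have [_] := has_derivP (has_derivM d1 (dl (delta_mx 0 k))).
  rewrite scale0r addr0 !rdot_delta !(ReD, ReM) /= !mul0r !subr0 => <-.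
  rewrite /rderive; congr (derive1 _ 0); apply/funext => t.
  by rewrite rdot_delta ReM /= mul0r subr0.
have [_] := has_derivP (has_derivM d1 (dl ('i *: delta_mx 0 k))).
rewrite scale0r addr0 !rdot_Idelta !(ImD, ImM) /= !mul0r !addr0 => <-.
rewrite /rderive; congr (derive1 _ 0); apply/funext => t.
by rewrite rdot_Idelta ImM /= mul0r addr0.
Qed.

Lemma ddc_radial (z : V) : ddc (fun w => g (sqnorm (w - c))) z =
  form11 (\matrix_(j, k) ((g1 (sqnorm (z - c)))%:C * (j == k)%:R +
     (g2 (sqnorm (z - c)))%:C * (((z - c) 0 j)^* * (z - c) 0 k))).
Proof.
rewrite /ddc; congr form11; apply/matrixP => j k; rewrite !mxE.
rewrite /dw (_ : dwbar k _ = fun z => (g1 (sqnorm (z - c)))%:C * (z - c) 0 k); last first.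
  by apply/funext => w; rewrite dwbar_radial.
rewrite !cderive_radial rdot_delta rdot_Idelta !mxE eqxx /= [k == j]eq_sym.
move: (g1 _) (g2 _) (j == k) => u1 u2 b.
case: (z 0 j) => xj yj; case: (z 0 k) => xk yk; case: (c 0 j) => cj dj; case: (c 0 k) => ck dk.
apply: (@mulIf _ 2); rewrite ?pnatr_eq0// divfK ?pnatr_eq0//.
by apply: complex_eq; rewrite !(ReD, ImD, ReN, ImN, ReM, ImM) /=; case: b; rewrite /=; ring.
Qed.

End Radial.

Lemma beta_form11 : beta R n = form11 1%:M.
Proof.
rewrite /beta (_ : @sqnorm R n = fun w => sqnorm (w - 0)); last first.
  by apply/funext => w; rewrite subr0.
rewrite (@ddc_radial id (fun=> 1) (fun=> 0)).
- congr form11; apply/matrixP => j k; rewrite !mxE mul0r addr0 mul1r.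
  by [].
- by move=> x; exact: has_deriv_id.
- by move=> x; exact: has_deriv_cst.
Qed.

End SmoothFunctions.

(** * The Hessian inequality for radial test functions *)

Section RadialHessian.
Variables (R : realType) (k : nat).
Local Notation C := R[i].
Local Notation n := k.+2.
Local Notation V := 'rV[C]_n.
Local Notation Re := complex.Re.
Local Notation Im := complex.Im.

Lemma Re_sum (I : finType) (f : I -> C) : Re (\sum_j f j) = \sum_j Re (f j).
Proof. by rewrite (big_morph (@complex.Re R) (@ReD R) (erefl : Re (0 : C) = 0)). Qed.
Lemma Im_sum (I : finType) (f : I -> C) : Im (\sum_j f j) = \sum_j Im (f j).
Proof. by rewrite (big_morph (@complex.Im R) (@ImD R) (erefl : Im (0 : C) = 0)). Qed.

Definition hop (m : nat) (e : V) (g1 g2 : R -> R) (x : V) : R :=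
  (n%:R / m%:R - 1) * (n%:R * g1 (sqnorm x) + sqnorm x * g2 (sqnorm x)) +
  m.-1%:R * (n%:R / m%:R) *
  (g1 (sqnorm x) + g2 (sqnorm x) * (rdot x e ^+ 2 + rdot x ('i *: e) ^+ 2)).

Lemma Re_Hop m (e : V) g1 g2 (x : V) : sqnorm e = 1 ->
  Re (Hop m e (\matrix_(j, l) ((g1 (sqnorm x))%:C * (j == l)%:R +
     (g2 (sqnorm x))%:C * ((x 0 j)^* * x 0 l)))) = hop m e g1 g2 x.
Proof.
move=> e1; rewrite /Hop /hop.
move: (g1 _) (g2 _) (n%:R / m%:R - 1) (m.-1%:R * (n%:R / m%:R)) => a b q r.
have trE : \tr (\matrix_(j, l) (a%:C * (j == l)%:R + b%:C * ((x 0 j)^* * x 0 l))) =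
    (n%:R * a + sqnorm x * b)%:C.
  rewrite /mxtrace; apply: complex_eq; rewrite ?Re_sum ?Im_sum.
    rewrite (eq_bigr (fun j => a + (Re (x 0 j) ^+ 2 + Im (x 0 j) ^+ 2) * b)); last first.
      by move=> j _; rewrite mxE eqxx; case: (x 0 j) => u v /=; ring.
    by rewrite big_split /= sumr_const card_ord -mulr_suml -/(sqnorm x) [in RHS]mulr_natl.
  rewrite big1 // => j _; rewrite mxE eqxx; case: (x 0 j) => u v /=; ring.
have tr2E : \tr ((\matrix_(j, l) (a%:C * (j == l)%:R + b%:C * ((x 0 j)^* * x 0 l))) *m
     (\matrix_(j, l) ((e 0 j)^* * e 0 l))) =
    (a + b * (rdot x e ^+ 2 + rdot x ('i *: e) ^+ 2))%:C.
  (* The Hermitian product of [x] and [e], with real and imaginary parts [rdot x e] and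
     [rdot x ('i *: e)]; the rank-one part of the Hessian contributes its squared modulus. *)
  pose w := \sum_l x 0 l * (e 0 l)^*.
  have wR : Re w = rdot x e.
    by rewrite Re_sum; apply: eq_bigr => j _; rewrite ReM Re_conj Im_conj; ring.
  have wI : Im w = rdot x ('i *: e).
    rewrite Im_sum; apply: eq_bigr => j _.
    by rewrite mxE ImM Re_conj Im_conj ReM ImM /=; ring.
  have w' : \sum_j (x 0 j)^* * e 0 j = conjc w.
    apply: complex_eq; rewrite ?Re_conj ?Im_conj ?wR ?wI.
      by rewrite Re_sum; apply: eq_bigr => j _; rewrite ReM Re_conj Im_conj; ring.
    rewrite Im_sum -sumrN; apply: eq_bigr => j _.
    by rewrite mxE ImM Re_conj Im_conj ReM ImM /=; ring.
  have -> : \tr ((\matrix_(j, l) (a%:C * (j == l)%:R + b%:C * ((x 0 j)^* * x 0 l))) *m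
     (\matrix_(j, l) ((e 0 j)^* * e 0 l))) = a%:C * 1 + b%:C * (conjc w * w).
    rewrite -[in RHS](tr_rank1 e1) -w' /mxtrace mulr_suml !mulr_sumr -big_split /=.
    apply: eq_bigr => j _; rewrite !mxE.
    rewrite (eq_bigr (fun l => (if l == j then a%:C * ((e 0 j)^* * e 0 j) else 0) +
      b%:C * ((x 0 j)^* * e 0 j) * (x 0 l * (e 0 l)^*))); last first.
      move=> l _; rewrite !mxE [j == l]eq_sym; case: eqP => [->|_]; rewrite ?mulr1 ?mulr0; ring.
    by rewrite big_split /= -big_mkcond big_pred1_eq -mulr_sumr -/w -[_ * w]mulrA.
  by apply: complex_eq; rewrite ?(ReD, ImD, ReM, ImM) /= ?Re_conj ?Im_conj ?wR ?wI /=; ring.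
by rewrite trE tr2E ReD !ReM /= !mul0r !subr0.
Qed.

Lemma test_function_radial Om (g : R -> R) (c : V) (r : R) :
  elementary (fun z => g (sqnorm (z - c))) -> (forall x, r ^+ 2 < x -> g x = 0) ->
  ecball c r `<=` Om -> 0 <= r -> test_function Om (fun z => g (sqnorm (z - c))).
Proof.
move=> eg g0 cO r0; rewrite /test_function; set S := [set z | _].
have SE : S `<=` ecball c r.
  move=> z; rewrite /S /ecball /= => /eqP gz.
  rewrite leNgt; apply/negP => rz; apply: gz; apply: g0.
  by rewrite -sqr_enorm ltr_pXn2r// ?nnegrE ?enorm_ge0.
have cS : closure S `<=` ecball c r.
  by rewrite [X in _ `<=` X](closure_id _).1; [exact: closureS|exact: closed_ecball].
split; first exact: elementary_smooth.
  by apply: (subclosed_compact _ (@compact_ecball R n c r)) => //; exact: closed_closure.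
exact: subset_trans cO.
Qed.

(** All the forms in the Hessian inequality are taken equal to [alpha m e], and the resulting
    current is paired with a radial function centred at [c]. *)
Lemma radial_hessian m Om (u : V -> \bar R) (e c : V) (g g1 g2 : R -> R) (r : R) :
  (1 <= m)%N -> (m < n)%N -> hessian_nonneg m Om u -> sqnorm e = 1 ->
  elementary (fun z => g (sqnorm (z - c))) ->
  (forall x, has_deriv g x (g1 x)) -> (forall x, has_deriv g1 x (g2 x)) ->
  (forall x, 0 <= g x) -> (forall x, r ^+ 2 < x -> g x = 0) -> 0 <= r -> ecball c r `<=` Om ->
  (0 <= \int[leb R n]_(t in @toC R n @^-1` Om)
     (u (toC t) * (k`!%:R * 4 ^+ n * hop m e g1 g2 (toC t - c)%R)%:E))%E.
Proof.
move=> m1 mn hu e1 eg dg dg1 g0 gr r0 cO.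
have bE := @beta_form11 R n.
have hm : forall l : 'I_m.-1, m_positive m (alpha m e) by move=> _; exact: alpha_m_positive.
have := hu _ hm _ (test_function_radial eg gr cO r0) (fun z => g0 _).
rewrite /=; congr (_ <= _)%E; apply: eq_integral => t _; congr (_ * _%:E)%E.
rewrite (ddc_radial c dg dg1) density_alpha// ReM Re_Hop// [X in _ - X * _](_ : _ = 0).
  rewrite mul0r subr0; congr (_ * _).
  by rewrite -!natrX -!natrM -[RHS]/(Re ((k`! * 4 ^ n)%:R : R)%:C) Cnat.
by rewrite -!natrX -!natrM -Cnat.
Qed.
End RadialHessian.

(** * Second differences *)

Section SecondDifferences.
Variables (R : realType) (n : nat) (p k0 : R).
Local Notation V := 'rV[R[i]]_n.
Implicit Types (e x z c d : V) (H : V -> R).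
Hypothesis p0 : 0 <= p.
Hypothesis k00 : 0 <= k0.

(* The value at [x], in the notation of the introduction, of [D_e] on a radial function
   [G(|x|^2)], with [a = G'] and [b = G'']. *)
Definition hopr e (a b : R) x : R :=
  p * (n%:R * a + sqnorm x * b) + k0 * (a + b * (rdot x e ^+ 2 + rdot x ('i *: e) ^+ 2)).

(** The trace of the complex Hessian is a quarter of the Laplacian, so the 2n real axes carry the
    weight p; the complex line of [e] is represented by e and i e with the weight k0. This is the
    source of the factor 4 between [SD] and [hopr]. *)
Definition dirs e : seq (R * V) :=
  [seq (p, delta_mx 0 j) | j : 'I_n] ++ [seq (p, 'i *: delta_mx 0 j) | j : 'I_n] ++
  [:: (k0, e); (k0, 'i *: e)].

(* A second difference approximating [4 t^2 D_e H z]. *)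
Definition SD e H z (t : R) : R := \sum_(q <- dirs e)
  q.1 * (H (z + t%:C *: q.2) + H (z + (- t)%:C *: q.2) - 2 * H z).

Lemma sqnorm_delta j : sqnorm (delta_mx 0 j : V) = 1.
Proof. by rewrite sqnormE rdot_delta mxE !eqxx. Qed.

Lemma dirs_unit e q : sqnorm e = 1 -> q \in dirs e -> 0 <= q.1 /\ sqnorm q.2 = 1.
Proof.
move=> e1; rewrite /dirs !mem_cat => /orP[/mapP[j _ ->]|/orP[/mapP[j _ ->]|]].
- by rewrite sqnorm_delta.
- by rewrite sqnormI sqnorm_delta.
- by rewrite !inE => /orP[/eqP ->|/eqP ->]; rewrite ?sqnormI.
Qed.

(** The bracket is the second derivative of G(|x + t d|^2) at t = 0 with d = [q.2], where a = G' and
    b = G''. *)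
Lemma sum_dirs e x (a b : R) : sqnorm e = 1 ->
  \sum_(q <- dirs e) q.1 * (4 * b * rdot x q.2 ^+ 2 + 2 * a * sqnorm q.2) = 4 * hopr e a b x.
Proof.
move=> e1; rewrite /dirs !big_cat /= !big_cons big_nil /= !big_map -!big_enum /=.
under eq_bigr do rewrite rdot_delta sqnorm_delta.
under [X in _ + (X + _)]eq_bigr do rewrite rdot_Idelta sqnormI sqnorm_delta.
rewrite addrA -big_split /= sqnormI e1 /hopr.
rewrite (eq_bigr (fun j => p * (4 * b) * (complex.Re (x 0 j) ^+ 2 + complex.Im (x 0 j) ^+ 2) + 4 * p * a)); last first.
  by move=> j _; ring.
rewrite big_split /= -mulr_sumr big_const_seq count_predT size_enum_ord iter_addr_0.
rewrite big_enum /= -/(sqnorm x) -[_ *+ n]mulr_natl; ring.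
Qed.

Lemma SD_add e H1 H2 z t : SD e (fun w => H1 w + H2 w) z t = SD e H1 z t + SD e H2 z t.
Proof.
have split_sum (v b1 b2 c1 c2 a1 a2 : R) : v * (b1 + b2 + (c1 + c2) - 2 * (a1 + a2)) =
  v * (b1 + c1 - 2 * a1) + v * (b2 + c2 - 2 * a2) by ring.
by rewrite /SD -big_split /=; apply: eq_bigr => q _; exact: split_sum.
Qed.

Lemma SD_cst e (a : R) z t : SD e (fun=> a) z t = 0.
Proof. by rewrite /SD big1// => q _; ring. Qed.

Lemma SD_scale e (a : R) H z t : SD e (fun w => a * H w) z t = a * SD e H z t.
Proof.
have factor (v b1 c1 a1 : R) : v * (a * b1 + a * c1 - 2 * (a * a1)) = a * (v * (b1 + c1 - 2 * a1)) by ring.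
by rewrite /SD mulr_sumr; apply: eq_bigr => q _; exact: factor.
Qed.

Lemma SD_min_ge0 e H z t : sqnorm e = 1 ->
  (forall d, sqnorm d = 1 -> forall s, `|s| = `|t| -> H z <= H (z + s%:C *: d)) ->
  0 <= SD e H z t.
Proof.
move=> e1 Hz; rewrite /SD big_seq; apply: sumr_ge0 => q qe.
have [q0 q1] := dirs_unit e1 qe; apply: mulr_ge0 => //.
have twice (b1 c1 a1 : R) : a1 <= b1 -> a1 <= c1 -> 0 <= b1 + c1 - 2 * a1 by lra.
exact: twice (Hz _ q1 t erefl) (Hz _ q1 (- t) (normrN _)).
Qed.

Section Radial.
Variables (G G1 : R -> R) (c : V).

Lemma sqnorm_line z d s : sqnorm d = 1 ->
  sqnorm (z + s%:C *: d - c) = sqnorm (z - c) + 2 * s * rdot (z - c) d + s ^+ 2.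
Proof. by move=> d1; rewrite (addrAC z) [in LHS]sqnormD sqnormZ rdotZr d1; ring. Qed.

Lemma SD_radial_near (g2 eta : R) e z : sqnorm e = 1 -> 0 < eta ->
  (\forall s \near sqnorm (z - c), has_deriv G s (G1 s)) ->
  has_deriv G1 (sqnorm (z - c)) g2 ->
  exists2 t0, 0 < t0 & forall t, 0 < t < t0 ->
  `|SD e (fun w => G (sqnorm (w - c))) z t - t ^+ 2 * (4 * hopr e (G1 (sqnorm (z - c))) g2 (z - c))|
    <= eta * t ^+ 2.
Proof.
move=> e1 eta0 dG dG1; set s0 := sqnorm (z - c).
pose K := \sum_(q <- dirs e) q.1.
have K0 : 0 <= K.
  by rewrite /K big_seq; apply: sumr_ge0 => q /(dirs_unit e1)[].
have K1 : 0 < K + 1 by rewrite ltr_wpDl.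
have one d : sqnorm d = 1 -> exists2 t0, 0 < t0 & forall t, 0 < t < t0 ->
    `|G (sqnorm (z + t%:C *: d - c)) + G (sqnorm (z + (- t)%:C *: d - c)) - 2 * G s0
      - t ^+ 2 * (4 * g2 * rdot (z - c) d ^+ 2 + 2 * G1 s0 * sqnorm d)| <= eta / (K + 1) * t ^+ 2.
  move=> d1; move: dG => /nbhs_ballP[r /= r0 Gr].
  pose L := 2 * `|rdot (z - c) d| + 1.
  have L0 : 0 < L by rewrite ltr_wpDl// mulr_ge0.
  pose f1 t := G1 (sqnorm (z + t%:C *: d - c)) * (2 * rdot (z + t%:C *: d - c) d).
  have := @second_difference_near _ (fun t => G (sqnorm (z + t%:C *: d - c))) f1
    (4 * g2 * rdot (z - c) d ^+ 2 + 2 * G1 s0 * sqnorm d) (Num.min 1 (r / L)) (eta / (K + 1)).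
  rewrite scale0r addr0 -/s0; apply.
  - by rewrite lt_min ltr01 divr_gt0.
  - exact: divr_gt0.
  - move=> s; rewrite lt_min => /andP[s1 sr].
    apply: has_deriv_comp; last exact: has_deriv_sqnorm.
    apply: Gr; rewrite /ball /= -/s0 sqnorm_line// -/s0.
    have -> : s0 - (s0 + 2 * s * rdot (z - c) d + s ^+ 2) = - (s * (2 * rdot (z - c) d + s)) by ring.
    rewrite normrN normrM.
    move: sr; rewrite ltr_pdivlMr//; apply: le_lt_trans; rewrite ler_wpM2l//.
    apply: le_trans (ler_normD _ _) _; rewrite normrM ger0_norm//.
    by rewrite lerD2l ltW.
  - have dl : has_deriv (fun t : R => rdot (z + t%:C *: d - c) d) 0 (rdot d d).
      apply: (@has_deriv_ext _ (fun t => rdot (z - c + t%:C *: d) d)).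
        by move=> t; rewrite addrAC.
      exact: has_deriv_rdot.
    have e0 : z + 0%:C *: d - c = z - c by rewrite scale0r addr0.
    apply: has_deriv_eq.
      apply: has_derivM; last by apply: has_derivZ; exact: dl.
      apply: has_deriv_comp; last exact: has_deriv_sqnorm.
      by rewrite e0; exact: dG1.
    by rewrite !e0 -/s0 sqnormE; ring.
have : exists2 t0, 0 < t0 & forall t, 0 < t < t0 -> forall q, q \in dirs e ->
    `|G (sqnorm (z + t%:C *: q.2 - c)) + G (sqnorm (z + (- t)%:C *: q.2 - c)) - 2 * G s0
      - t ^+ 2 * (4 * g2 * rdot (z - c) q.2 ^+ 2 + 2 * G1 s0 * sqnorm q.2)| <= eta / (K + 1) * t ^+ 2.
  have : forall q, q \in dirs e -> sqnorm q.2 = 1 by move=> q /(dirs_unit e1)[].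
  elim: (dirs e) => [_|q s IH qs]; first by exists 1.
  have [t1 t10 h1] := IH (fun q' h => qs q' (mem_behead (h : q' \in behead (q :: s)))).
  have [t2 t20 h2] := one _ (qs q (mem_head _ _)).
  exists (Num.min t1 t2) => [|t]; first by rewrite lt_min t10.
  rewrite lt_min => /and3P[t0 tt1 tt2] q'; rewrite inE => /orP[/eqP ->|q's].
    by apply: h2; rewrite t0.
  by apply: h1; rewrite ?t0.
move=> [t0 t00 h]; exists t0 => // t tt.
rewrite -(sum_dirs _ _ _ e1) mulr_sumr /SD -sumrB.
apply: le_trans (ler_norm_sum _ _ _) _.
rewrite big_seq; apply: le_trans (_ : \sum_(q <- dirs e | q \in dirs e) q.1 * (eta / (K + 1) * t ^+ 2) <= _).
  apply: ler_sum => q qe; have [q0 q1] := dirs_unit e1 qe.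
  rewrite mulrCA -mulrBr normrM (ger0_norm q0) ler_wpM2l//.
  exact: h.
rewrite -big_seq -mulr_suml -/K mulrA ler_wpM2r ?sqr_ge0//.
by rewrite mulrCA ger_pMr// ler_pdivrMr// mul1r lerDl.
Qed.

End Radial.

Definition SDlim e H z (b : R) := forall eta, 0 < eta -> exists2 t0, 0 < t0 &
  forall t, 0 < t < t0 -> `|SD e H z t - t ^+ 2 * b| <= eta * t ^+ 2.

Lemma SDlim_radial (G G1 : R -> R) c (g2 : R) e z : sqnorm e = 1 ->
  (\forall s \near sqnorm (z - c), has_deriv G s (G1 s)) ->
  has_deriv G1 (sqnorm (z - c)) g2 ->
  SDlim e (fun w => G (sqnorm (w - c))) z (4 * hopr e (G1 (sqnorm (z - c))) g2 (z - c)).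
Proof. by move=> e1 dG dG1 eta eta0; exact: SD_radial_near. Qed.

Lemma SDlim_add e H1 H2 z b1 b2 : SDlim e H1 z b1 -> SDlim e H2 z b2 ->
  SDlim e (fun w => H1 w + H2 w) z (b1 + b2).
Proof.
move=> h1 h2 eta eta0; have e2 : 0 < eta / 2 by rewrite divr_gt0.
have [t1 t10 k1] := h1 _ e2; have [t2 t20 k2] := h2 _ e2.
exists (Num.min t1 t2) => [|t]; first by rewrite lt_min t10.
rewrite lt_min => /and3P[t0 tt1 tt2]; rewrite SD_add.
have -> : SD e H1 z t + SD e H2 z t - t ^+ 2 * (b1 + b2) =
  (SD e H1 z t - t ^+ 2 * b1) + (SD e H2 z t - t ^+ 2 * b2) by ring.
apply: le_trans (ler_normD _ _) _.
have -> : eta * t ^+ 2 = eta / 2 * t ^+ 2 + eta / 2 * t ^+ 2 by field.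
by apply: lerD; [apply: k1|apply: k2]; rewrite t0.
Qed.

Lemma SDlim_scale e (q : R) H z b : SDlim e H z b -> SDlim e (fun w => q * H w) z (q * b).
Proof.
move=> h eta eta0; have q1 : 0 < `|q| + 1 by rewrite ltr_wpDl.
have [t0 t00 k] := h _ (divr_gt0 eta0 q1); exists t0 => // t tt.
rewrite SD_scale [t ^+ 2 * _]mulrCA -mulrBr normrM.
apply: le_trans (ler_wpM2l (normr_ge0 q) (k t tt)) _.
rewrite mulrA ler_wpM2r ?sqr_ge0// mulrCA ger_pMr// ler_pdivrMr// mul1r.
by rewrite lerDl.
Qed.

Lemma SDlim_cst e (q : R) z : SDlim e (fun=> q) z 0.
Proof.
move=> eta eta0; exists 1 => // t _.
by rewrite SD_cst mulr0 subrr normr0 mulr_ge0 ?sqr_ge0// ltW.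
Qed.

Lemma SDlim_pos e H z b : 0 < b -> SDlim e H z b ->
  exists2 c, 0 < c & exists2 t0, 0 < t0 & forall t, 0 < t < t0 -> c * t ^+ 2 <= SD e H z t.
Proof.
move=> b0 h; have b2 : 0 < b / 2 by rewrite divr_gt0.
have [t0 t00 k] := h _ b2; exists (b / 2) => //; exists t0 => // t tt.
have := k t tt; rewrite ler_norml => /andP[+ _].
by have -> : t ^+ 2 * b = b / 2 * t ^+ 2 + b / 2 * t ^+ 2; [field|lra].
Qed.

(** In the radial direction x.e = |x|, while i e is orthogonal to x. *)
Lemma hopr_radial e x (u v : R) : x != 0 -> e = ((enorm x)^-1)%:C *: x ->
  hopr e u v x = (p * n%:R + k0) * u + (p + k0) * (sqnorm x * v).
Proof.
move=> x0 ->; have r0 : enorm x != 0 by rewrite gt_eqF// enorm_gt0.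
rewrite /hopr (_ : 'i *: ((enorm x)^-1%:C *: x) = (enorm x)^-1%:C *: ('i *: x)); last first.
  by rewrite !scalerA mulrC.
rewrite !rdotZr rdotxI -sqnormE -sqr_enorm.
by field.
Qed.

Lemma sqnorm_unit x : x != 0 -> sqnorm (((enorm x)^-1)%:C *: x) = 1.
Proof.
by move=> x0; rewrite sqnormZ -sqr_enorm -exprMn mulVf ?expr1n// gt_eqF// enorm_gt0.
Qed.

(** The error does not depend on the point [z] nor on the centre [c]; this permits integration over
    the centre in [SD_moll]. *)
Lemma SD_radial_le (g g1 g2 g3 : R -> R) (C t : R) e c z : sqnorm e = 1 -> 0 <= t ->
  (forall y, has_deriv g y (g1 y)) -> (forall y, has_deriv g1 y (g2 y)) ->
  (forall y, has_deriv g2 y (g3 y)) ->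
  (forall x d, sqnorm d = 1 -> `|8 * g3 (sqnorm x) * rdot x d ^+ 3 + 12 * g2 (sqnorm x) * rdot x d| <= C) ->
  `|SD e (fun w => g (sqnorm (w - c))) z t
    - t ^+ 2 * (4 * hopr e (g1 (sqnorm (z - c))) (g2 (sqnorm (z - c))) (z - c))|
    <= (\sum_(q <- dirs e) q.1) * (2 * C * t ^+ 3).
Proof.
move=> e1 t0 dg dg1 dg2 gC.
rewrite -(sum_dirs _ _ _ e1) mulr_sumr /SD -sumrB mulr_suml.
apply: le_trans (ler_norm_sum _ _ _) _.
rewrite big_seq [leRHS]big_seq; apply: ler_sum => q qe.
have [q0 q1] := dirs_unit e1 qe; move: (q.2) q1 => d d1.
rewrite mulrCA -mulrBr normrM (ger0_norm q0) ler_wpM2l//.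
have dl s : has_deriv (fun t : R => rdot (z + t%:C *: d - c) d) s 1.
  rewrite -d1 sqnormE; apply: (@has_deriv_ext _ (fun t => rdot (z - c + t%:C *: d) d)).
    by move=> r; rewrite addrAC.
  exact: has_deriv_rdot.
pose x s := z + s%:C *: d - c.
have dc h h1 s : (forall y, has_deriv h y (h1 y)) ->
    has_deriv (fun t => h (sqnorm (x t))) s (h1 (sqnorm (x s)) * (2 * rdot (x s) d)).
  by move=> dh; apply: has_deriv_comp; [exact: dh|exact: has_deriv_sqnorm].
have := @second_difference_le _ (fun s => g (sqnorm (x s)))
  (fun s => g1 (sqnorm (x s)) * (2 * rdot (x s) d))
  (fun s => 4 * g2 (sqnorm (x s)) * rdot (x s) d ^+ 2 + 2 * g1 (sqnorm (x s)))
  (fun s => 8 * g3 (sqnorm (x s)) * rdot (x s) d ^+ 3 + 12 * g2 (sqnorm (x s)) * rdot (x s) d) t C t0.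
have -> : x 0 = z - c by rewrite /x scale0r addr0.
rewrite d1 mulr1; apply => [s|s|s|s _].
- exact: dc.
- apply: has_deriv_eq; first apply: has_derivM; first exact: (dc _ _ _ dg1).
    by apply: has_derivZ; exact: dl.
  by rewrite /=; ring.
- apply: has_deriv_eq; first apply: has_derivD.
  + apply: has_derivM; first by apply: has_derivZ; exact: (dc _ _ _ dg2).
    by apply: has_derivX; exact: dl.
  + by apply: has_derivZ; exact: (dc _ _ _ dg1).
  + by rewrite /=; ring.
- exact: gC.
Qed.

End SecondDifferences.

(** * Supersolutions *)

Section WeightedIntegral.
Context d (T : measurableType d) (R : realType) (mu : {measure set T -> \bar R}).
Variable f : T -> R.
Hypothesis intf : mu.-integrable setT (EFin \o f).
Hypothesis f0 : forall t, 0 <= f t.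
Implicit Types (w : T -> R) (C : R).

Definition wint w : R := Rintegral mu setT (fun t => f t * w t).

(** The admissible weights: an algebra of functions, integrable against the density [f], on which
    [wint] is linear. *)
Definition bnd_measurable w := measurable_fun setT w /\ exists C, forall t, `|w t| <= C.

Lemma bnd_measurable_int w : bnd_measurable w -> mu.-integrable setT (EFin \o (fun t => f t * w t)).
Proof.
move=> [mw [C wC]].
apply: (le_integrable measurableT (g := fun t => (C%:E * (f t)%:E)%E)).
- apply/measurable_EFinP; apply: measurable_funM => //.
  by apply/measurable_EFinP; exact: measurable_int intf.
- move=> t _ /=; rewrite lee_fin normrM [leRHS]normrM mulrC ler_wpM2r//.
  exact: le_trans (wC t) (ler_norm _).
- exact: integrableZl.
Qed.

Lemma bnd_measurableD w1 w2 : bnd_measurable w1 -> bnd_measurable w2 ->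
  bnd_measurable (fun t => w1 t + w2 t).
Proof.
move=> [m1 [C1 h1]] [m2 [C2 h2]]; split; first exact: measurable_funD.
by exists (C1 + C2) => t; apply: le_trans (ler_normD _ _) _; exact: lerD.
Qed.

Lemma bnd_measurableM w1 w2 : bnd_measurable w1 -> bnd_measurable w2 ->
  bnd_measurable (fun t => w1 t * w2 t).
Proof.
move=> [m1 [C1 h1]] [m2 [C2 h2]]; split; first exact: measurable_funM.
by exists (C1 * C2) => t; rewrite normrM ler_pM.
Qed.

Lemma bnd_measurable_cst C : bnd_measurable (fun=> C).
Proof. by split; [exact: measurable_cst|exists `|C|]. Qed.

Lemma bnd_measurableZ C w : bnd_measurable w -> bnd_measurable (fun t => C * w t).
Proof. by move=> h; exact: bnd_measurableM (bnd_measurable_cst C) h. Qed.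

Lemma bnd_measurableB w1 w2 : bnd_measurable w1 -> bnd_measurable w2 ->
  bnd_measurable (fun t => w1 t - w2 t).
Proof.
move=> h1 h2; rewrite (_ : (fun t => _) = fun t => w1 t + (-1) * w2 t).
  by apply: bnd_measurableD => //; exact: bnd_measurableZ.
by apply/funext => t; rewrite mulN1r.
Qed.

Lemma wintD w1 w2 : bnd_measurable w1 -> bnd_measurable w2 ->
  wint (fun t => w1 t + w2 t) = wint w1 + wint w2.
Proof.
move=> h1 h2; rewrite /wint -RintegralD//; try exact: bnd_measurable_int.
by apply: eq_Rintegral => t _; rewrite mulrDr.
Qed.

Lemma wintZ C w : bnd_measurable w -> wint (fun t => C * w t) = C * wint w.
Proof.
move=> h; rewrite /wint -RintegralZl//; try exact: bnd_measurable_int.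
by apply: eq_Rintegral => t _; rewrite mulrCA.
Qed.

Lemma wintB w1 w2 : bnd_measurable w1 -> bnd_measurable w2 ->
  wint (fun t => w1 t - w2 t) = wint w1 - wint w2.
Proof.
move=> h1 h2; rewrite /wint -RintegralB//; try exact: bnd_measurable_int.
by apply: eq_Rintegral => t _; rewrite mulrBr.
Qed.

Lemma wint_le w1 w2 : bnd_measurable w1 -> bnd_measurable w2 ->
  (forall t, f t != 0 -> w1 t <= w2 t) -> wint w1 <= wint w2.
Proof.
move=> h1 h2 w12; apply: le_Rintegral => //; try exact: bnd_measurable_int.
move=> t _; have [->|ft] := eqVneq (f t) 0; first by rewrite !mul0r.
by apply: ler_wpM2l => //; exact: w12.
Qed.

Lemma wint_ge0 w : (forall t, 0 <= w t) -> 0 <= wint w.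
Proof. by move=> w0; apply: Rintegral_ge0 => t _; exact: mulr_ge0. Qed.

Lemma wint_sum (I : Type) (s : seq I) (w : I -> T -> R) :
  (forall i, bnd_measurable (w i)) ->
  bnd_measurable (fun t => \sum_(i <- s) w i t) /\
  wint (fun t => \sum_(i <- s) w i t) = \sum_(i <- s) wint (w i).
Proof.
move=> h; elim: s => [|i s [IH1 IH2]].
  have E : (fun t => \sum_(i <- [::]) w i t) = fun t => 0 * 0 :> R.
    by apply/funext => t; rewrite big_nil mulr0.
  rewrite E; have := bnd_measurable_cst 0; move=> h0; split.
    exact: bnd_measurableZ.
  by rewrite (wintZ _ h0) mul0r big_nil.
have E : (fun t => \sum_(j <- i :: s) w j t) = fun t => w i t + \sum_(j <- s) w j t.
  by apply/funext => t; rewrite big_cons.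
rewrite E; split; first exact: bnd_measurableD.
by rewrite wintD// IH2 big_cons.
Qed.

End WeightedIntegral.

Section SphereInt.
Variables (R : realType) (n : nat).
Local Notation mR := (measurableTypeR R).
Local Notation mC := ((n + n).-tuple mR).
Local Notation V := 'rV[R[i]]_n.
Local Notation N := (n + n)%N.
Local Notation mu := (leb R n).
Local Notation lebR := (@lebesgue_measure R).

Definition vol : R := fine (mu [set t : mC | enorm (toC t) < 1]).

Lemma unit_ballE : [set t : mC | enorm (toC t) < 1] = @toC R n @^-1` eball 0 1.
Proof. by apply/seteqP; split=> t; rewrite /eball /= subr0. Qed.

Lemma volE : mu [set t : mC | enorm (toC t) < 1] = vol%:E.
Proof.
by rewrite fineK// ge0_fin_numE// unit_ballE; exact: leb_eball_lty.
Qed.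

Lemma vol_gt0 : 0 < vol.
Proof. by rewrite -lte_fin -volE unit_ballE; exact: leb_eball_gt0. Qed.

Lemma sphere_meanE (h : V -> \bar R) c x :
  sphere_mean h c x = (vol^-1%:E * sphere_int h c x)%E.
Proof. by []. Qed.

Lemma sphere_intE (h : V -> \bar R) c x :
  sphere_int h c x = (vol%:E * sphere_mean h c x)%E.
Proof. by rewrite sphere_meanE muleVK// vol_gt0. Qed.

Lemma sphere_int_ge0 (h : V -> \bar R) c x : (forall z, 0 <= h z)%E -> (0 <= sphere_int h c x)%E.
Proof. by move=> h0; apply: integral_ge0 => t _; exact: h0. Qed.

Lemma sphere_int_cst (C : \bar R) (c : V) x : (0 <= C)%E ->
  sphere_int (fun=> C) c x = (C * vol%:E)%E.
Proof.
move=> C0; rewrite /sphere_int integral_cst.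
  by congr (_ * _)%E; exact: volE.
rewrite [X in measurable X]unit_ballE; exact: measurable_eballC.
Qed.

Lemma measurable_sphere_int (h : V -> \bar R) c :
  measurable_fun setT (h \o @toC R n) -> (forall z, 0 <= h z)%E ->
  measurable_fun setT (sphere_int h c : R -> \bar R).
Proof.
move=> mh h0.
pose H (q : R * mC) := (h (c + (q.1 / enorm (toC q.2))%:C *: toC q.2)%R *
  (if (enorm (toC q.2) < 1)%R then 1 else 0))%E.
have -> : (sphere_int h c : R -> \bar R) = fubini_F mu H.
  apply/funext => x; apply: etrans (_ : \int[mu]_t H (x, t) = _)%E; last by [].
  rewrite /sphere_int integral_mkcond; apply: eq_integral => t _.
  rewrite /H patchE; have [ht|ht] := boolP (enorm (toC t) < 1).
    by rewrite mem_set// mule1.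
  by rewrite memNset ?mule0//; exact/negP.
apply: measurable_fun_fubini_tonelli_F; last first.
  by move=> q; rewrite /H mule_ge0//; case: ifP.
apply: emeasurable_funM.
  apply: measurable_h_comp => //; move=> j;
   [apply: measurable_Re_affine|apply: measurable_Im_affine]; try exact: measurable_snd.
   apply: measurable_funM; first exact: measurable_fst.
   apply: measurable_invr; apply: (measurableT_comp (@measurable_enormC R n)).
   exact: measurable_snd.
  apply: measurable_funM; first exact: measurable_fst.
  apply: measurable_invr; apply: (measurableT_comp (@measurable_enormC R n)).
  exact: measurable_snd.
apply: measurable_fun_ifT; [|exact: measurable_cst|exact: measurable_cst].
apply: measurable_fun_ltr; last exact: measurable_cst.
apply: (measurableT_comp (@measurable_enormC R n)).
exact: measurable_snd.
Qed.

End SphereInt.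

Section Potential.
Variables (R : realType) (n : nat).
Local Notation mR := (measurableTypeR R).
Local Notation mC := ((n + n).-tuple mR).
Local Notation V := 'rV[R[i]]_n.
Local Notation N := (n + n)%N.
Local Notation mu := (leb R n).
Local Notation lebR := (@lebesgue_measure R).
Local Notation toC := (@toC R n).
Local Notation vol := (vol R n).
Variables (F : V -> \bar R) (a : V) (R0 p k0 : R).
Hypothesis n0 : (0 < n)%N.
Hypothesis R00 : 0 < R0.
Hypothesis F0 : forall z, (0 <= F z)%E.
Hypothesis mF : measurable_fun setT (F \o toC).
Hypothesis iF : (\int[mu]_t F (toC t) < +oo)%E.

(* [fine +oo = 0] is harmless here: [F] is finite almost everywhere. *)
Definition dens (t : mC) : R := fine (F (toC t)).

Lemma dens_ge0 t : 0 <= dens t.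
Proof. by rewrite /dens fine_ge0. Qed.

Lemma F_integrable : mu.-integrable setT (F \o toC).
Proof.
apply/integrableP; split=> //; under eq_integral do rewrite gee0_abs ?F0//.
exact: iF.
Qed.

Lemma ae_dens : ae_eq mu setT (F \o toC) (EFin \o dens).
Proof.
have := integrable_ae measurableT F_integrable.
by apply: filterS => t /(_ Logic.I) h _; rewrite /= /dens fineK.
Qed.

Lemma measurable_dens : measurable_fun setT dens.
Proof. exact: measurableT_comp. Qed.

Lemma dens_int : mu.-integrable setT (EFin \o dens).
Proof.
apply: (le_integrable measurableT _ _ F_integrable).
  by apply/measurable_EFinP; exact: measurable_dens.
move=> t _ /=; rewrite ger0_norm ?dens_ge0// gee0_abs//.
by rewrite /dens; case: (F _) (F0 (toC t)) => //= *; rewrite leey.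
Qed.

Local Notation J := (wint mu dens).

Lemma int_F_wint (w : mC -> R) : bnd_measurable w ->
  (\int[mu]_t (F (toC t) * (w t)%:E) = (J w)%:E)%E.
Proof.
move=> hw; have [mw _] := hw.
have mw' : measurable_fun setT (fun t => (w t)%:E) by apply/measurable_EFinP.
rewrite /wint /Rintegral fineK; last first.
  by apply: integrable_fin_num => //; exact: (bnd_measurable_int dens_int).
apply: ae_eq_integral => //.
- exact: emeasurable_funM.
- by apply/measurable_EFinP/measurable_funM => //; exact: measurable_dens.
- have := ae_dens; apply: filterS => t /(_ Logic.I) h _ /=.
  by rewrite EFinM -[(dens t)%:E]h.
Qed.

Hypothesis supermean : forall z r, 0 < r -> ecball z r `<=` eball a R0 ->
  (sphere_mean F z r <= F z)%E.

(** In polar coordinates about [z], the supermean inequality applies on every sphere on which the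
    kernel is not zero. *)
Lemma mollify_le (z : V) (eps : R) (k : R -> R) :
  ecball z eps `<=` eball a R0 -> measurable_fun setT k -> (forall x, 0 <= k x) ->
  (forall x, eps < x -> k x = 0) ->
  (\int[mu]_t (F (toC t) * (k (enorm (toC t - z)%R))%:E) <=
   F z * \int[mu]_t (k (enorm (toC t - z)%R))%:E)%E.
Proof.
move=> zE mk k0' kz; set W := fun x : R => ((0 < x)%R%:R * (N%:R * x ^+ N.-1 * k x))%:E.
have W0 x : (0 <= W x)%E.
  by rewrite lee_fin; apply: ind_mulr_ge0 => x0; rewrite !mulr_ge0// exprn_ge0// ltW.
have mW : measurable_fun setT W.
  apply/measurable_EFinP; apply: measurable_funM; first exact: measurable_pos.
  apply: measurable_funM => //; apply: measurable_funM => //.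
have E1 : (\int[mu]_t (k (enorm (toC t - z)%R))%:E =
    \int[mu]_t ((cst 1 (toC t)) * (k (enorm (toC t - z)%R))%:E))%E.
  by apply: eq_integral => t _; rewrite mul1e.
have m1 : measurable_fun setT ((cst 1%E : V -> \bar R) \o toC) by exact: measurable_cst.
rewrite E1 (@polar_integral R n (cst 1%E) k z n0 m1 (fun=> lee01) mk k0').
rewrite (@polar_integral R n F k z n0 mF F0 mk k0') -/W.
have v0 : (0 <= vol%:E)%E by rewrite lee_fin ltW// vol_gt0.
have -> : (\int[lebR]_x (sphere_int (cst 1) z x * ((0 < x)%R%:R * (N%:R * x ^+ N.-1 * k x))%:E) =
    \int[lebR]_x (vol%:E * W x))%E.
  by apply: eq_integral => x _; rewrite sphere_int_cst// mul1e.
rewrite -ge0_integral_cstM; last 3 first.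
- exact: emeasurable_funM.
- by move=> x; rewrite mule_ge0.
- exact: F0.
apply: ge0_le_integral => //.
- by move=> x _; rewrite mule_ge0 ?sphere_int_ge0//; exact: W0.
- by apply: emeasurable_funM => //; exact: measurable_sphere_int.
- by apply: emeasurable_funM => //; apply: emeasurable_funM.
move=> x _; apply: le_trans (_ : sphere_int F z x * W x <= _)%E; first by [].
have [x0|x0] := ltP 0 x; last first.
  by have -> : W x = 0%E; [rewrite /W ltNge x0 mul0r|rewrite !mule0].
have [ex|xe] := ltP eps x.
  by have -> : W x = 0%E; [rewrite /W kz// !mulr0|rewrite !mule0].
rewrite [in leRHS]muleA; apply: lee_wpmul2r; first exact: W0.
rewrite sphere_intE muleC; apply: lee_wpmul2r => //.
apply: supermean => // w; rewrite /ecball /= => wx; apply: zE.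
exact: le_trans xe.
Qed.


Lemma JD w1 w2 : bnd_measurable w1 -> bnd_measurable w2 ->
  J (fun t => w1 t + w2 t) = J w1 + J w2.
Proof. by move=> h1 h2; exact: (wintD dens_int h1 h2). Qed.

Lemma JB w1 w2 : bnd_measurable w1 -> bnd_measurable w2 ->
  J (fun t => w1 t - w2 t) = J w1 - J w2.
Proof. by move=> h1 h2; exact: (wintB dens_int h1 h2). Qed.

Lemma JZ C w : bnd_measurable w -> J (fun t => C * w t) = C * J w.
Proof. by move=> h; exact: (wintZ dens_int C h). Qed.

Lemma J_le w1 w2 : bnd_measurable w1 -> bnd_measurable w2 ->
  (forall t, dens t != 0 -> w1 t <= w2 t) -> J w1 <= J w2.
Proof. by move=> h1 h2; exact: (wint_le dens_int dens_ge0 h1 h2). Qed.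

Lemma J_ge0 w : (forall t, 0 <= w t) -> 0 <= J w.
Proof. exact: (wint_ge0 mu dens_ge0). Qed.

Lemma J_comb q w1 w2 w3 : bnd_measurable w1 -> bnd_measurable w2 -> bnd_measurable w3 ->
  J (fun t => q * (w1 t + w2 t - 2 * w3 t)) = q * (J w1 + J w2 - 2 * J w3).
Proof.
move=> h1 h2 h3; have h4 := bnd_measurableD h1 h2; have h5 := bnd_measurableZ 2 h3.
by rewrite -(JZ 2 h3) -(JD h1 h2) -(JB h4 h5) -(JZ q (bnd_measurableB h4 h5)).
Qed.

Hypothesis p0 : 0 < p.
Hypothesis k00 : 0 <= k0.
Hypothesis lsc : forall z c, eball a R0 z -> (c%:E < F z)%E -> \forall w \near z, (c%:E < F w)%E.
(** The inequality D_e F <= 0 in the sense of distributions, tested on radial functions about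
    arbitrary centres; this is the form suited to mollification by a radial kernel. *)
Hypothesis hopF : forall e c (g g1 g2 : R -> R) r, sqnorm e = 1 ->
  elementary (fun z : V => g (sqnorm (z - c))) ->
  (forall x, has_deriv g x (g1 x)) -> (forall x, has_deriv g1 x (g2 x)) ->
  continuous g2 ->
  (forall x, 0 <= g x) -> (forall x, r ^+ 2 < x -> g x = 0) -> 0 <= r ->
  ecball c r `<=` eball a R0 ->
  J (fun t => hopr p k0 e (g1 (sqnorm (toC t - c))) (g2 (sqnorm (toC t - c))) (toC t - c)) <= 0.

Lemma measurable_rdotC (c e : V) : measurable_fun setT (fun t : mC => rdot (toC t - c) e).
Proof.
rewrite (_ : (fun t => _) = fun t : mC => \sum_j (complex.Re (toC t 0 j) * complex.Re (e 0 j) +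
    complex.Im (toC t 0 j) * complex.Im (e 0 j)) + rdot (- c) e); last first.
  by apply/funext => t; rewrite rdotDl.
apply: measurable_funD; last exact: measurable_cst.
apply: measurable_sum => j; apply: measurable_funD.
  by apply: measurable_funM; [exact: measurable_ReC|exact: measurable_cst].
by apply: measurable_funM; [exact: measurable_ImC|exact: measurable_cst].
Qed.

Lemma measurable_sqnormC (c : V) : measurable_fun setT (fun t : mC => sqnorm (toC t - c)).
Proof.
rewrite (_ : (fun t => _) = fun t : mC => enorm (toC t - c) ^+ 2); last first.
  by apply/funext => t; rewrite sqr_enorm.
by apply: measurable_funX; exact: measurable_enormC_sub.
Qed.

Lemma sqr_norm_le (x : R) (y : R) : x ^+ 2 <= y ^+ 2 -> 0 <= y -> `|x| <= y.
Proof. by move=> h y0; rewrite -(ger0_norm y0) -ler_sqr ?nnegrE// !real_normK ?num_real. Qed.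

Lemma bnd_radial (h : R -> R) (c e : V) (C r : R) : sqnorm e = 1 -> measurable_fun setT h -> 0 <= r ->
  (forall x, 0 <= x -> `|h x| <= C) -> (forall x, r ^+ 2 < x -> h x = 0) ->
  [/\ bnd_measurable (fun t : mC => h (sqnorm (toC t - c))),
      bnd_measurable (fun t : mC => sqnorm (toC t - c) * h (sqnorm (toC t - c))) &
      bnd_measurable (fun t : mC => h (sqnorm (toC t - c)) * rdot (toC t - c) e ^+ 2)].
Proof.
move=> e1 mh r0 hC hr.
have m1 : measurable_fun setT (fun t : mC => h (sqnorm (toC t - c))).
  by apply: measurableT_comp => //; exact: measurable_sqnormC.
have C0 : 0 <= C by apply: le_trans (hC 0 (lexx _)).
have supp (t : mC) : `|sqnorm (toC t - c) * h (sqnorm (toC t - c))| <= r ^+ 2 * C.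
  have s0 := sqnorm_ge0 (toC t - c).
  have [sr|sr] := leP (sqnorm (toC t - c)) (r ^+ 2).
    by rewrite normrM ger0_norm// ler_pM// hC.
  by rewrite hr// mulr0 normr0 mulr_ge0 ?sqr_ge0.
split; split => //.
- by exists C => t; apply: hC; exact: sqnorm_ge0.
- by apply: measurable_funM => //; exact: measurable_sqnormC.
- by exists (r ^+ 2 * C).
- apply: measurable_funM => //; apply: measurable_funX; exact: measurable_rdotC.
- exists (r ^+ 2 * C) => t; apply: le_trans (supp t).
  rewrite [leLHS]normrM [leRHS]normrM mulrC ler_wpM2r// !ger0_norm ?sqr_ge0 ?sqnorm_ge0//.
  by apply: le_trans (rdot_sqr_le _ _) _; rewrite e1 mulr1.
Qed.

Lemma bnd_hopr (e c : V) (h1 h2 : R -> R) (C r : R) : sqnorm e = 1 -> 0 <= r ->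
  measurable_fun setT h1 -> (forall x, 0 <= x -> `|h1 x| <= C) -> (forall x, r ^+ 2 < x -> h1 x = 0) ->
  measurable_fun setT h2 -> (forall x, 0 <= x -> `|h2 x| <= C) -> (forall x, r ^+ 2 < x -> h2 x = 0) ->
  bnd_measurable (fun t : mC => hopr p k0 e (h1 (sqnorm (toC t - c))) (h2 (sqnorm (toC t - c))) (toC t - c)).
Proof.
move=> e1 r0 m1 b1 s1 m2 b2 s2.
have [A1 A2 A3] := bnd_radial c e1 m1 r0 b1 s1.
have [B1 B2 B3] := bnd_radial c e1 m2 r0 b2 s2.
have e1' : sqnorm ('i *: e) = 1 by rewrite sqnormI.
have [_ _ B4] := bnd_radial c e1' m2 r0 b2 s2.
rewrite /hopr; apply: bnd_measurableD; apply: bnd_measurableZ; apply: bnd_measurableD => //.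
  exact: bnd_measurableZ.
rewrite (_ : (fun t => _) = fun t : mC => h2 (sqnorm (toC t - c)) * rdot (toC t - c) e ^+ 2 +
   h2 (sqnorm (toC t - c)) * rdot (toC t - c) ('i *: e) ^+ 2); first exact: bnd_measurableD.
by apply/funext => t; rewrite mulrDr.
Qed.

(** * Mollification by a radial kernel *)

Section Bump.
Variable eps : R.
Hypothesis eps0 : 0 < eps.

(** As a function of the squared distance s, [bump 1 0] is the kernel exp (- 1 / (1 - s / eps^2)),
    extended by 0. The prefactor is arranged so that a derivative raises [k] by one and replaces [P]
    as for [flat]. *)
Definition bump (P : {poly R}) (k : nat) (s : R) : R :=
  (- (eps ^+ 2)^-1) ^+ k * flat P (1 - (eps ^+ 2)^-1 * s).

Let dP (P : {poly R}) := 'X^2 * (P - P^`()).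

Lemma has_deriv_bump P k s : has_deriv (bump P k) s (bump (dP P) k.+1 s).
Proof.
rewrite /bump [(- _) ^+ k.+1]exprSr -mulrA; apply: has_derivZ; rewrite mulrC.
apply: has_deriv_comp; first exact: has_deriv_flat.
apply: has_deriv_eq.
  apply: has_derivB; first exact: has_deriv_cst.
  by apply: has_derivZ; exact: has_deriv_id.
by rewrite mulr1 sub0r.
Qed.

Lemma flat_bounded (P : {poly R}) : exists2 C, 0 <= C & forall x, x <= 1 -> `|flat P x| <= C.
Proof.
have [K PK] := flat_quadratic P.
exists (`|K| + `|flat P 1|) => [|x]; first by rewrite addr_ge0.
rewrite le_eqVlt => /orP[/eqP ->|x1]; first by rewrite lerDr.
have [x0|x0] := ltP 0 x; last by rewrite /flat ltNge x0 normr0 addr_ge0.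
apply: le_trans (PK x _) _; first by rewrite gtr0_norm.
apply: le_trans (_ : `|K| * 1 <= _); last by rewrite mulr1 lerDl.
apply: le_trans (ler_wpM2r (sqr_ge0 x) (ler_norm K)) _.
by rewrite ler_wpM2l// expr_le1// ltW.
Qed.

Lemma bump_bounded P k : exists2 C, 0 <= C & forall s, 0 <= s -> `|bump P k s| <= C.
Proof.
have [C C0 PC] := flat_bounded P.
exists (`|(- (eps ^+ 2)^-1) ^+ k| * C) => [|s s0]; first by rewrite mulr_ge0.
rewrite /bump normrM ler_wpM2l// PC// gerBl mulr_ge0// invr_ge0.
exact: sqr_ge0.
Qed.

Lemma bump_supp P k s : eps ^+ 2 < s -> bump P k s = 0.
Proof.
move=> es; rewrite /bump /flat ifF ?mulr0//; apply/negP; rewrite subr_gt0.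
rewrite ltNge => /negP; apply.
by rewrite -ler_pdivrMl ?invr_gt0 ?exprn_gt0// invrK mulr1 ltW.
Qed.

Lemma measurable_bump P k : measurable_fun setT (bump P k).
Proof.
apply: continuous_measurable_fun => s.
exact: has_deriv_continuous (has_deriv_bump P k s).
Qed.

Lemma bump_ge0 s : 0 <= bump 1 0 s.
Proof.
rewrite /bump expr0 mul1r /flat; case: ifP => // _.
by rewrite hornerC mul1r expR_ge0.
Qed.

Lemma elementary_bump (c : V) : elementary (fun z => bump 1 0 (sqnorm (z - c))).
Proof.
apply: elementary_mul; first exact: elementary_cst.
apply: elementary_flat; rewrite (_ : (fun z => _) = fun z : V => 1 + (- (eps ^+ 2)^-1) * sqnorm (z - c)).
  apply: elementary_add; first exact: elementary_cst.
  by apply: elementary_mul; [exact: elementary_cst|exact: elementary_sqnorm].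
by apply/funext => z; rewrite mulNr.
Qed.

Let g1 := bump (dP 1) 1.
Let g2 := bump (dP (dP 1)) 2.
Let g3 := bump (dP (dP (dP 1))) 3.

(** The expression is the third derivative of the kernel along a line of unit direction [d]. Outside
    the support it vanishes; inside, |x.d| <= eps. *)
Lemma bump_third : exists C, forall (x d : V), sqnorm d = 1 ->
  `|8 * g3 (sqnorm x) * rdot x d ^+ 3 + 12 * g2 (sqnorm x) * rdot x d| <= C.
Proof.
have [C2 C20 h2] := bump_bounded (dP (dP 1)) 2.
have [C3 C30 h3] := bump_bounded (dP (dP (dP 1))) 3.
exists (8 * C3 * eps ^+ 3 + 12 * C2 * eps) => x d d1.
have s0 := sqnorm_ge0 x.
have [se|se] := leP (sqnorm x) (eps ^+ 2); last first.
  rewrite /g3 /g2 !bump_supp// !(mulr0, mul0r) addr0 normr0.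
  by rewrite addr_ge0// !mulr_ge0// ?exprn_ge0// ltW.
have rd : `|rdot x d| <= eps.
  apply: sqr_norm_le; last exact: ltW.
  by apply: le_trans (rdot_sqr_le _ _) _; rewrite d1 mulr1.
have rd3 : `|rdot x d ^+ 3| <= eps ^+ 3.
  by rewrite normrX lerXn2r// ?nnegrE// ltW.
move: (h2 _ s0) (h3 _ s0); rewrite -/g2 -/g3.
move: (g2 _) (g3 _) (rdot x d ^+ 3) (eps ^+ 3) rd3 => y2 y3 q3 e3 q3e h2' h3'.
have aux (c y q C e : R) : 0 <= c -> `|y| <= C -> `|q| <= e -> `|c * y * q| <= c * C * e.
  by move=> c0 yC qe; rewrite -!mulrA normrM ger0_norm// ler_wpM2l// normrM ler_pM.
by apply: le_trans (ler_normD _ _) _; apply: lerD; apply: aux.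
Qed.

(** An unnormalized mollification of [F]; [mass] below is the total mass of the kernel. *)
Definition moll (z : V) : R := J (fun t => bump 1 0 (sqnorm (toC t - z))).

Lemma bnd_bump (z : V) P k : bnd_measurable (fun t : mC => bump P k (sqnorm (toC t - z))).
Proof.
split; first by apply: measurableT_comp; [exact: measurable_bump|exact: measurable_sqnormC].
by have [C _ h] := bump_bounded P k; exists C => t; apply: h; exact: sqnorm_ge0.
Qed.

(** The second difference passes under the integral. There it equals 4 t^2 D_e of the kernel up to a
    uniform O(t^3), and the main term integrates to at most 0 by [hopF]. Differentiation under the
    integral sign is thereby avoided. *)
Lemma SD_moll e z : sqnorm e = 1 -> ecball z eps `<=` eball a R0 ->
  exists C, forall t, 0 <= t -> SD p k0 e moll z t <= C * t ^+ 3.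
Proof.
move=> e1 zE; have [C hC] := bump_third.
pose K := \sum_(q <- dirs p k0 e) q.1.
exists (K * (2 * C) * J (fun=> 1)) => t t0.
pose S (s : mC) := SD p k0 e (fun w => bump 1 0 (sqnorm (w - toC s))) z t.
have sw (x y : V) : sqnorm (x - y) = sqnorm (y - x) by rewrite -sqnormN opprB.
have [bS SE] : bnd_measurable S /\ SD p k0 e moll z t = J S.
  have := @wint_sum _ _ _ mu dens dens_int _ (dirs p k0 e) (fun q (s : mC) =>
     q.1 * (bump 1 0 (sqnorm (z + t%:C *: q.2 - toC s)) +
     bump 1 0 (sqnorm (z + (- t)%:C *: q.2 - toC s)) - 2 * bump 1 0 (sqnorm (z - toC s)))).
  have b1 w : bnd_measurable (fun s : mC => bump 1 0 (sqnorm (w - toC s))).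
    rewrite (_ : (fun s => _) = fun s : mC => bump 1 0 (sqnorm (toC s - w))); first exact: bnd_bump.
    by apply/funext => s; rewrite sw.
  have mE w : moll w = J (fun s : mC => bump 1 0 (sqnorm (w - toC s))).
    by rewrite /moll; congr wint; apply/funext => s; rewrite sw.
  move=> /(_ _)[q|h1 h2].
    apply: bnd_measurableZ; apply: bnd_measurableB; first exact: bnd_measurableD.
    exact: bnd_measurableZ.
  split; first exact: h1.
  rewrite h2; apply: eq_bigr => q _.
  have b3 := bnd_measurableZ 2 (b1 z).
  have b4 := bnd_measurableD (b1 (z + t%:C *: q.2)) (b1 (z + (- t)%:C *: q.2)).
  rewrite !mE; exact: esym (J_comb _ (b1 _) (b1 _) (b1 _)).
pose H (s : mC) := hopr p k0 e (g1 (sqnorm (toC s - z))) (g2 (sqnorm (toC s - z))) (toC s - z).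
have bH : bnd_measurable H.
  have [C1 _ h1] := bump_bounded (dP 1) 1; have [C2 _ h2] := bump_bounded (dP (dP 1)) 2.
  apply: (@bnd_hopr e z g1 g2 (Num.max C1 C2) eps) => //; try exact: measurable_bump.
  - exact: ltW.
  - by move=> x x0; rewrite le_max h1.
  - by move=> x; exact: bump_supp.
  - by move=> x x0; rewrite le_max h2// orbT.
  - by move=> x; exact: bump_supp.
have JH : J H <= 0.
  exact: (hopF e1 (elementary_bump z) (has_deriv_bump 1 0) (has_deriv_bump _ 1)
    (fun x => has_deriv_continuous (has_deriv_bump _ 2 x)) bump_ge0 (fun x => @bump_supp 1 0 x) (ltW eps0) zE).
have b1 := bnd_measurable_cst mC (1 : R).
rewrite SE; apply: le_trans (_ : J (fun s => t ^+ 2 * 4 * H s + K * (2 * C * t ^+ 3) * 1) <= _).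
  apply: (J_le bS (bnd_measurableD (bnd_measurableZ _ bH) (bnd_measurableZ _ b1))).
  move=> s _; rewrite mulr1 -lerBlDl.
  have := SD_radial_le (ltW p0) k00 (toC s) z e1 t0 (has_deriv_bump 1 0)
    (has_deriv_bump (dP 1) 1) (has_deriv_bump (dP (dP 1)) 2) hC.
  move=> h; have {h} := le_trans (ler_norm _) h; rewrite -/K -/(S s).
  suff -> : hopr p k0 e (bump (dP 1) 1 (sqnorm (z - toC s)))
     (bump (dP (dP 1)) 2 (sqnorm (z - toC s))) (z - toC s) = H s by rewrite mulrA.
  rewrite /H /hopr (sw (toC s)) -/g1 -/g2.
  by rewrite -(opprB z (toC s)) !rdotNl !sqrrN.
rewrite (JD (bnd_measurableZ _ bH) (bnd_measurableZ _ b1)) (JZ _ bH) (JZ _ b1).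
have t2 : 0 <= t ^+ 2 * 4 by rewrite mulr_ge0// exprn_ge0.
have := mulr_ge0_le0 t2 JH.
have -> : K * (2 * C) * J (fun=> 1) * t ^+ 3 = K * (2 * C * t ^+ 3) * J (fun=> 1) by ring.
by lra.
Qed.

(** The kernel is Lipschitz with a constant independent of its centre, by the mean value inequality
    along a segment. The resulting continuity provides minimum points in [comparison]. *)
Lemma moll_lipschitz : exists2 L, 0 <= L & forall z w, `|moll z - moll w| <= L * enorm (z - w).
Proof.
have [C C0 hC] := bump_bounded (dP 1) 1.
pose L := C * (2 * eps).
have L0 : 0 <= L by rewrite !mulr_ge0// ltW.
have J1 : 0 <= J (fun=> 1) by apply: J_ge0.
have pt (c z w : V) : bump 1 0 (sqnorm (z - c)) - bump 1 0 (sqnorm (w - c)) <= L * enorm (z - w).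
  have [->|zw] := eqVneq z w; first by rewrite subrr mulr_ge0 ?enorm_ge0.
  pose r := enorm (z - w); have r0 : 0 < r by rewrite /r enorm_gt0 subr_eq0.
  pose d := (r^-1)%:C *: (z - w).
  have d1 : sqnorm d = 1 by rewrite sqnormZ -sqr_enorm -/r -exprMn mulVf ?expr1n// gt_eqF.
  have zE : z = w + r%:C *: d.
    rewrite scalerA -CMr divff ?gt_eqF// scale1r.
    by rewrite addrC subrK.
  pose f s := bump 1 0 (sqnorm (w + s%:C *: d - c)).
  have -> : bump 1 0 (sqnorm (z - c)) - bump 1 0 (sqnorm (w - c)) = f r - f 0.
    by rewrite /f -zE scale0r addr0.
  apply: le_trans (ler_norm _) _; rewrite -/r.
  apply: (MVT_abs_le (ltW r0) (g := fun s => g1 (sqnorm (w + s%:C *: d - c)) *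
      (2 * rdot (w + s%:C *: d - c) d))) => s _.
    by apply: has_deriv_comp; [exact: has_deriv_bump|exact: has_deriv_sqnorm].
  move: (w + s%:C *: d - c) => x.
  have [se|se] := leP (sqnorm x) (eps ^+ 2); last first.
    by rewrite /g1 bump_supp// mul0r normr0.
  rewrite normrM /L; apply: ler_pM => //; first by apply: hC; exact: sqnorm_ge0.
  rewrite normrM ger0_norm// ler_wpM2l//.
  apply: sqr_norm_le; last exact: ltW.
  by apply: le_trans (rdot_sqr_le _ _) _; rewrite d1 mulr1.
have half z w : moll z - moll w <= L * J (fun=> 1) * enorm (z - w).
  have bz := bnd_bump z 1 0; have bw := bnd_bump w 1 0.
  have b1 := bnd_measurable_cst mC (1 : R).
  rewrite /moll -(JB bz bw) mulrAC -(JZ _ b1).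
  apply: (J_le (bnd_measurableB bz bw) (bnd_measurableZ _ b1)).
  move=> t _; rewrite mulr1.
  have := pt (toC t) z w.
  by rewrite -[sqnorm (z - toC t)]sqnormN -[sqnorm (w - toC t)]sqnormN !opprB.
exists (L * J (fun=> 1)) => [|z w]; first exact: mulr_ge0.
by rewrite ler_norml half andbT -lerN2 opprK opprB enormB half.
Qed.

Definition mass : R := fine (\int[mu]_t (bump 1 0 (sqnorm (toC t)))%:E).

End Bump.


Lemma near_right0 (P : R -> Prop) : (\forall x \near 0^'+, P x) <->
  exists2 d : R, 0 < d & forall x, 0 < x < d -> P x.
Proof.
split=> [/nbhs_ballP[d /= d0 h]|[d d0 h]].
  by exists d => // x /andP[x0 xd]; apply: h => //; rewrite /ball /= sub0r normrN gtr0_norm.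
near=> x; apply: h; apply/andP; split.
  by near: x; exact: nbhs_right_gt.
by near: x; exact: nbhs_right_lt.
Unshelve. all: end_near. Qed.

Section Mass.
Variable eps : R.
Hypothesis eps0 : 0 < eps.

Lemma int_bump_lty : (\int[mu]_t (bump eps 1 0 (sqnorm (toC t)))%:E < +oo)%E.
Proof.
have [C C0 hC] := bump_bounded eps 1 0.
apply: (@le_lt_trans _ _ (\int[mu]_t (C%:E * (\1_(toC @^-1` ecball 0 eps) t)%:E))%E).
  apply: ge0_le_integral => //.
  - by move=> t _; rewrite lee_fin bump_ge0.
  - have [m _] := bnd_bump eps 0 1 0; apply/measurable_EFinP; move: m.
    by congr measurable_fun; apply/funext => t; rewrite subr0.
  - apply: emeasurable_funM; first exact: measurable_cst.
    by apply/measurable_EFinP; exact: measurable_indic (measurable_ecballC _ _).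
  - move=> t _; rewrite -EFinM lee_fin indicE.
    have [te|te] := boolP (t \in _).
      by rewrite mulr1; apply: le_trans (ler_norm _) _; apply: hC; exact: sqnorm_ge0.
    rewrite mulr0 bump_supp//; move: te; rewrite notin_setE /= /ecball /= subr0 => /negP.
    by rewrite -ltNge -sqr_enorm => te; rewrite ltrXn2r// ?nnegrE ?enorm_ge0// ltW.
rewrite ge0_integral_cstM.
- rewrite integral_indic ?setIT//; last exact: measurable_ecballC.
  rewrite lte_mul_pinfty ?lee_fin//.
  apply: (@le_lt_trans _ _ (mu (toC @^-1` eball 0 (eps + 1)))); last exact: leb_eball_lty.
  apply: le_measure; rewrite ?inE; [exact: measurable_ecballC|exact: measurable_eballC|].
  by move=> t; rewrite /ecball /eball /= => h; apply: le_lt_trans h _; rewrite ltrDl.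
- by apply/measurable_EFinP; exact: measurable_indic (measurable_ecballC _ _).
- by move=> t; rewrite lee_fin.
- by rewrite lee_fin.
Qed.

Lemma int_bump z : (\int[mu]_t (bump eps 1 0 (sqnorm (toC t - z)))%:E = (mass eps)%:E)%E.
Proof.
rewrite (integral_translate (- z) (f := fun w => (bump eps 1 0 (sqnorm w))%:E)).
- by rewrite fineK// ge0_fin_numE ?int_bump_lty// integral_ge0// => t _; rewrite lee_fin bump_ge0.
- have [m _] := bnd_bump eps 0 1 0; apply/measurable_EFinP; move: m.
  by congr measurable_fun; apply/funext => t; rewrite /= subr0.
- by move=> w; rewrite lee_fin bump_ge0.
Qed.

Lemma mass_gt0 : 0 < mass eps.
Proof.
rewrite -lte_fin -(int_bump 0).
have e2 : 0 < eps / 2 by rewrite divr_gt0.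
(* On the ball of half radius 1 - |t|^2 / eps^2 is at least 1/2, so the kernel is at least exp (-
   2). *)
apply: (@lt_le_trans _ _ (\int[mu]_t ((expR (- 2))%:E * (\1_(toC @^-1` eball 0 (eps / 2)) t)%:E))%E).
  rewrite ge0_integral_cstM.
  - rewrite integral_indic ?setIT//; last exact: measurable_eballC.
    by rewrite mule_gt0 ?lte_fin ?expR_gt0// leb_eball_gt0.
  - by apply/measurable_EFinP; exact: measurable_indic (measurable_eballC _ _).
  - by move=> t; rewrite lee_fin.
  - by rewrite lee_fin expR_ge0.
apply: ge0_le_integral => //.
- apply: emeasurable_funM; first exact: measurable_cst.
  by apply/measurable_EFinP; exact: measurable_indic (measurable_eballC _ _).
- by have [m _] := bnd_bump eps 0 1 0; apply/measurable_EFinP.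
move=> t _; rewrite -EFinM lee_fin indicE; have [te|te] := boolP (t \in _); last first.
  by rewrite mulr0 bump_ge0.
rewrite mulr1; move: te; rewrite in_setE /eball /= => te.
have s4 : (eps ^+ 2)^-1 * sqnorm (toC t - 0) <= 2^-1.
  rewrite mulrC ler_pdivrMr ?exprn_gt0// -sqr_enorm.
  apply: le_trans (_ : (eps / 2) ^+ 2 <= _).
    by rewrite lerXn2r// ?nnegrE ?enorm_ge0// ltW.
  by rewrite expr_div_n mulrC ler_wpM2r ?sqr_ge0//; lra.
rewrite /bump expr0 mul1r /flat ifT; last by lra.
rewrite hornerC mul1r ler_expR lerN2.
by rewrite -[leRHS]invrK lef_pV2 ?posrE; lra.
Qed.

Lemma moll_le z y : ecball z eps `<=` eball a R0 -> F z = y%:E -> moll eps z <= y * mass eps.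
Proof.
move=> zE Fz; rewrite -lee_fin EFinM -(int_bump z) -Fz.
rewrite /moll -(int_F_wint (bnd_bump eps z 1 0)).
under eq_integral do rewrite -sqr_enorm.
under [X in (_ <= _ * X)%E]eq_integral do rewrite -sqr_enorm.
apply: (@mollify_le z eps (fun x => bump eps 1 0 (x ^+ 2)) zE).
- apply: (measurableT_comp (measurable_bump eps 1 0)).
  by apply: measurable_funX.
- by move=> x; exact: bump_ge0.
- by move=> x ex; rewrite bump_supp// ltrXn2r// ?nnegrE ltW// (lt_trans eps0).
Qed.

Lemma moll_ge z c : (forall w, eball z eps w -> (c%:E <= F w)%E) -> c * mass eps <= moll eps z.
Proof.
move=> h; have [c0|c0] := leP 0 c; last first.
  apply: le_trans (_ : 0 <= _); first by rewrite nmulr_rle0 ?ltW// mass_gt0.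
  by apply: J_ge0 => t; exact: bump_ge0.
rewrite -lee_fin EFinM -(int_bump z).
rewrite /moll -(int_F_wint (bnd_bump eps z 1 0)).
have [m _] := bnd_bump eps z 1 0.
have m' : measurable_fun setT (fun t => (bump eps 1 0 (sqnorm (toC t - z)))%:E) by apply/measurable_EFinP.
rewrite -ge0_integral_cstM; [|exact: m'|by move=> t; rewrite lee_fin bump_ge0|by rewrite lee_fin].
apply: ge0_le_integral => //.
- by move=> t _; rewrite mule_ge0 ?lee_fin ?bump_ge0.
- by apply: emeasurable_funM => //; exact: measurable_cst.
- exact: emeasurable_funM.
move=> t _; have [te|te] := ltP (enorm (toC t - z)) eps.
  by apply: lee_wpmul2r; [rewrite lee_fin bump_ge0|exact: h].
have -> : bump eps 1 0 (sqnorm (toC t - z)) = 0; last by rewrite !mule0.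
rewrite /bump /flat ifF ?mulr0//; apply/negP; rewrite subr_gt0 ltNge => /negP; apply.
rewrite -ler_pdivrMl ?invr_gt0 ?exprn_gt0// invrK mulr1 -sqr_enorm.
by rewrite lerXn2r// ?nnegrE ?enorm_ge0// ltW.
Qed.

End Mass.

Lemma continuous_moll eps : 0 < eps -> continuous (moll eps).
Proof.
move=> e0 z A /nbhs_ballP[d /= d0 dA]; have [L L0 hL] := moll_lipschitz e0.
have L1 : 0 < L + 1 by rewrite ltr_wpDl.
apply/nbhs_eballP; exists (d / (L + 1)); first exact: divr_gt0.
move=> w; rewrite /eball /= ltr_pdivlMr// => zw; apply: dA; rewrite /ball /=.
apply: le_lt_trans (hL z w) _; apply: le_lt_trans zw.
by rewrite enormB mulrC ler_wpM2l ?enorm_ge0// lerDl.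
Qed.

(** [F] is only lower semicontinuous and its inequality is distributional, so the minimum is taken
    for v = moll - mass H. If F < H at some point, v is negative there, whereas v >= 0 on K minus U
    once the radius is small. Hence v has a minimum in U, where its second difference is at most C
    t^3 - mass c t^2; this is negative for small t, against minimality. *)
Lemma comparison (K U : set V) (H : V -> R) :
  compact K -> K `<=` eball a R0 -> U `<=` K -> open U ->
  (forall z, K z -> {for z, continuous H}) ->
  (forall z, K z -> ~ U z -> ((H z)%:E < F z)%E) ->
  (forall z, U z -> exists2 e, sqnorm e = 1 & exists2 c, 0 < c & exists2 t0, 0 < t0 &
     forall t, 0 < t < t0 -> c * t ^+ 2 <= SD p k0 e H z t) ->
  forall z, K z -> ((H z)%:E <= F z)%E.
Proof.
move=> cK KE UK oU cH HF HS z1 Kz1; rewrite leNgt; apply/negP => Fz1.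
have cK1 : compact (K `&` ~` U).
  by apply: compact_closedI => //; exact: open_closedC.
(* The strict inequality H < F, made uniform on the compact set K minus U by lower semicontinuity:
   one mollification radius serves all of its points. *)
have near1 : \forall eps \near 0^'+, K `&` ~` U `<=` [set z | forall w, eball z eps w -> ((H z)%:E <= F w)%E].
  move/compact_near_coveringP : cK1; apply => z [Kz Uz].
  have [c Hc cF] : exists2 c, H z < c & (c%:E < F z)%E.
    have := HF z Kz Uz; case: (F z) => [y| |]//; last by exists (H z + 1); rewrite ?ltrDl ?ltry.
    rewrite lte_fin => hy; exists ((H z + y) / 2); rewrite ?lte_fin; lra.
  have /nbhs_eballP[d d0 dF] := lsc (KE _ Kz) cF.
  have : nbhs z [set z' | H z' < c].
    apply: (cH z Kz [set y | y < c]); apply/nbhs_ballP; exists (c - H z) => /=; first by rewrite subr_gt0.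
    by move=> x; rewrite /ball /= ltr_norml => /andP[]; lra.
  move=> /nbhs_eballP[d1 d10 d1H].
  exists (eball z (Num.min (d / 2) d1), [set eps | 0 < eps < d / 2]).
    split; last by apply/near_right0; exists (d / 2); rewrite ?divr_gt0.
    by apply/nbhs_eballP; exists (Num.min (d / 2) d1) => //; rewrite lt_min d10 divr_gt0.
  move=> [z' eps] [/= ] ; rewrite /eball /= lt_min => /andP[z'd z'd1] /andP[e0 ed] w wz'.
  apply: ltW; apply: (@lt_trans _ _ c%:E).
    by rewrite lte_fin; exact: d1H.
  apply: dF; rewrite /eball /=.
  by apply: le_lt_trans (ler_enorm_dist _ z' _) _; lra.
have near2 : \forall eps \near 0^'+, K `<=` [set z | ecball z eps `<=` eball a R0].
  move/compact_near_coveringP : cK; apply => z Kz.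
  have d0 : 0 < R0 - enorm (z - a) by rewrite subr_gt0; exact: KE.
  pose d := (R0 - enorm (z - a)) / 2.
  have d20 : 0 < d by rewrite divr_gt0.
  exists (eball z d, [set eps | 0 < eps < d]).
    split; last by apply/near_right0; exists d.
    by apply/nbhs_eballP; exists d.
  move=> [z' eps] [/= ]; rewrite /eball /= => z'd /andP[e0 ed] w; rewrite /ecball /eball /= => wz'.
  apply: le_lt_trans (ler_enorm_dist _ z' _) _.
  have := ler_enorm_dist z' z a.
  by move: z'd ed; rewrite /d; lra.
have [eps [e0 h1 h2]] : exists eps, [/\ 0 < eps,
    K `&` ~` U `<=` [set z | forall w, eball z eps w -> ((H z)%:E <= F w)%E] &
    K `<=` [set z | ecball z eps `<=` eball a R0]].
  have [d1 d10 hd1] := (near_right0 _).1 near1; have [d2 d20 hd2] := (near_right0 _).1 near2.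
  have m0 : 0 < Num.min d1 d2 by rewrite lt_min d10.
  exists (Num.min d1 d2 / 2); split; first exact: divr_gt0.
  - apply: hd1; rewrite divr_gt0//=.
    by apply: (@lt_le_trans _ _ (Num.min d1 d2)); [lra|rewrite ge_min lexx].
  - apply: hd2; rewrite divr_gt0//=.
    by apply: (@lt_le_trans _ _ (Num.min d1 d2)); [lra|rewrite ge_min lexx orbT].
have M0 := mass_gt0 e0.
pose v z := moll eps z + (- mass eps) * H z.
have cv : {within K, continuous v}.
  apply: continuous_in_subspaceT => z /set_mem Kz.
  exact: (cvgD (continuous_moll e0 (x:=z)) (cvgM (@cst_continuous _ _ (- mass eps) z) (cH z Kz))).
have [z0 /set_mem Kz0 z0min] := compact_EVT_min (ex_intro _ z1 Kz1) cK cv.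
have v1 : v z1 < 0.
  have [y Fy] : exists y, F z1 = y%:E.
    by move: Fz1 (F0 z1); case: (F z1) => // y _ _; exists y.
  have := moll_le e0 (h2 _ Kz1) Fy; rewrite /v.
  move: Fz1; rewrite Fy lte_fin -(ltr_pM2r M0); lra.
have v0 : v z0 < 0 by apply: le_lt_trans v1; apply: z0min; exact: mem_set.
have Uz0 : U z0.
  apply: contrapT => nU; have := moll_ge e0 (h1 z0 (conj Kz0 nU)).
  by move: v0; rewrite /v; lra.
have [e e1 [c c0 [t0 t00 hS]]] := HS z0 Uz0.
have [C hC] := SD_moll e0 e1 (h2 _ Kz0).
have /nbhs_eballP[d d0 dU] : nbhs z0 U by exact: open_nbhs_nbhs.
have C0 : 0 < `|C| + 1 by rewrite ltr_wpDl.
(* Three thresholds for t: validity of the lower bound on the second difference of H, points staying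
   in [U], and the cubic error being smaller than the quadratic gain. *)
pose m := Num.min (Num.min t0 d) (mass eps * c / (`|C| + 1)).
have m0 : 0 < m by rewrite !lt_min t00 d0 divr_gt0// mulr_gt0.
pose t := m / 2.
have t_0 : 0 < t by rewrite divr_gt0.
have tm : t < m by rewrite /t; lra.
have tt0 : t < t0 by apply: lt_le_trans tm _; rewrite !ge_min lexx.
have td : t < d by apply: lt_le_trans tm _; rewrite !ge_min lexx orbT.
have tC : t * (`|C| + 1) < mass eps * c.
  by rewrite -ltr_pdivlMr//; apply: lt_le_trans tm _; rewrite ge_min lexx orbT.
have : 0 <= SD p k0 e v z0 t.
  apply: SD_min_ge0 => //; first exact: ltW.
  move=> w w1 s st; apply: z0min; apply: mem_set; apply: UK; apply: dU.
  rewrite /eball /= addrAC subrr add0r enormZ st gtr0_norm//.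
  by rewrite [enorm w]/enorm w1 sqrtr1 mulr1.
rewrite /v SD_add SD_scale.
have h3 := hC t (ltW t_0); have := hS t; rewrite t_0 => /(_ tt0) h4.
have h5 := ler_wpM2l (ltW M0) h4.
have t2 : 0 < t ^+ 2 by rewrite exprn_gt0.
have : C * t ^+ 3 < mass eps * c * t ^+ 2.
  have -> : C * t ^+ 3 = (t * C) * t ^+ 2 by ring.
  rewrite ltr_pM2r//; apply: le_lt_trans tC; rewrite ler_pM2l//.
  by apply: le_trans (ler_norm _) _; rewrite lerDl.
by lra.
Qed.

(** * Comparison with the fundamental solution *)

(** For p = n/m - 1 and k0 = (m - 1) n/m both sides are n (n - 1)/m. This relation makes the
    exponent - p the one annihilated by the radial operator. *)
Hypothesis pk : p * n%:R + k0 = (p + 1) * (p + k0).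
Hypothesis Fpos : forall z, eball a R0 z -> (0 < F z)%E.
Hypothesis Fa : F a = +oo%E.

Lemma open_eball (c : V) r : open (eball c r).
Proof.
rewrite openE => z /= zr; apply/nbhs_eballP; exists (r - enorm (z - c)); first by rewrite subr_gt0.
move=> w; rewrite /eball /= => wz; apply: le_lt_trans (ler_enorm_dist _ z _) _; lra.
Qed.

Definition Psi (s : R) : R := s `^ (- p).
Definition Psi1 (s : R) : R := - p * s `^ (- p - 1).
Definition Psi2 (s : R) : R := - p * ((- p - 1) * s `^ (- p - 1 - 1)).

Lemma has_deriv_Psi s : 0 < s -> has_deriv Psi s (Psi1 s).
Proof. by move=> s0; exact: is_derive1_powR. Qed.

Lemma has_deriv_Psi1 s : 0 < s -> has_deriv Psi1 s (Psi2 s).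
Proof. by move=> s0; apply: has_derivZ; exact: is_derive1_powR. Qed.

Lemma near_deriv_Psi (s : R) : 0 < s -> \forall x \near s, has_deriv Psi x (Psi1 x).
Proof.
move=> s0; near=> x; apply: has_deriv_Psi; near: x; exact: lt_nbhsr.
Unshelve. all: end_near. Qed.

Lemma Psi_gt0 s : 0 < s -> 0 < Psi s.
Proof. exact: powR_gt0. Qed.

Lemma Psi_eq s : 0 < s -> (p + 1) * Psi1 s + s * Psi2 s = 0.
Proof.
move=> s0; rewrite /Psi1 /Psi2.
have -> : s * (- p * ((- p - 1) * s `^ (- p - 1 - 1))) = p * (p + 1) * (s * s `^ (- p - 1 - 1)) by ring.
have -> : s * s `^ (- p - 1 - 1) = s `^ (- p - 1).
  rewrite -{1}[s]powRr1 ?ltW// -powRD; first by congr powR; ring.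
  by rewrite (gt_eqF s0) implybT.
by ring.
Qed.

Lemma Psi_le s t : 0 < s -> s <= t -> Psi t <= Psi s.
Proof.
move=> s0 st; rewrite /Psi !powRN lef_pV2 ?posrE ?powR_gt0// ?(lt_le_trans s0)//.
by rewrite ge0_ler_powR// ?nnegrE ltW// (lt_le_trans s0).
Qed.

Lemma Psi_lt s t : 0 < s -> s < t -> Psi t < Psi s.
Proof.
move=> s0 st; rewrite /Psi !powRN ltf_pV2 ?posrE ?powR_gt0// ?(lt_trans s0)//.
by rewrite gt0_ltr_powR// ?nnegrE ltW// (lt_trans s0).
Qed.

Lemma PsiM s t : 0 <= s -> 0 <= t -> Psi (s * t) = Psi s * Psi t.
Proof. by move=> s0 t0; rewrite /Psi powRM. Qed.

(** By [pk] the radial operator is (p + k0) ((p + 1) Psi' + s Psi''), which vanishes. *)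
Lemma SDlim_Psi z : z != a ->
  SDlim p k0 ((enorm (z - a))^-1%:C *: (z - a)) (fun w => Psi (sqnorm (w - a))) z 0.
Proof.
move=> za; have x0 : z - a != 0 by rewrite subr_eq0.
have s0 : 0 < sqnorm (z - a) by rewrite -sqr_enorm exprn_gt0// enorm_gt0.
have := SDlim_radial (ltW p0) k00 (sqnorm_unit x0) (near_deriv_Psi s0) (has_deriv_Psi1 s0).
rewrite (hopr_radial _ _ _ _ x0 (erefl _)) pk.
have -> : 4 * ((p + 1) * (p + k0) * Psi1 (sqnorm (z - a)) + (p + k0) * (sqnorm (z - a) * Psi2 (sqnorm (z - a)))) = 0.
  have := Psi_eq s0; move: (Psi1 _) (Psi2 _) => u v uv.
  have -> : 4 * ((p + 1) * (p + k0) * u + (p + k0) * (sqnorm (z - a) * v)) =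
    4 * (p + k0) * ((p + 1) * u + sqnorm (z - a) * v) by ring.
  by rewrite uv mulr0.
by [].
Qed.

Lemma SDlim_sqnorm (e z c : V) : sqnorm e = 1 ->
  SDlim p k0 e (fun w => sqnorm (w - c)) z (4 * (p * n%:R + k0)).
Proof.
move=> e1; have := @SDlim_radial R n p k0 (ltW p0) k00 id (fun=> 1) c 0 e z e1.
rewrite /hopr mulr0 addr0 mul0r addr0 !mulr1; apply.
  by near=> s; exact: has_deriv_id.
exact: has_deriv_cst.
Unshelve. all: end_near. Qed.

Lemma continuous_sqnorm_comp (c z : V) (g : R -> R) : {for sqnorm (z - c), continuous g} ->
  {for z, continuous (fun w : V => g (sqnorm (w - c)))}.
Proof.
move=> cg; apply: (@continuous_comp _ _ _ (fun w : V => sqnorm (w - c)) g) => //.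
exact: (elementary_continuous (elementary_sqnorm c)).
Qed.

Lemma closed_annulus_compact d r : compact (ecball a r `&` ~` eball a d).
Proof.
apply: compact_closedI; first exact: compact_ecball.
by apply: open_closedC; apply: open_eball.
Qed.

Lemma le_limit_scale (x : \bar R) (y k : R) :
  (forall tau, 0 < tau -> ((y - tau * k)%:E <= x)%E) -> (y%:E <= x)%E.
Proof.
case: x => [x| |] h; rewrite ?leey//; last by have := h _ ltr01.
rewrite lee_fin leNgt; apply/negP => xy.
have k1 : 0 < `|k| + 1 by rewrite ltr_wpDl.
have t0 : 0 < (y - x) / (`|k| + 1) by rewrite divr_gt0// subr_gt0.
have := h _ t0; rewrite lee_fin; apply/negP; rewrite -ltNge.
have : (y - x) / (`|k| + 1) * k < y - x.
  rewrite mulrAC ltr_pdivrMr// ltr_pM2l ?subr_gt0//.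
  by apply: le_lt_trans (ler_norm _) _; rewrite ltrDl.
by lra.
Qed.

(** The competitor is perturbed by tau (|w - a|^2 - r^2). This term makes it a strict subsolution,
    is negative on the inner sphere and vanishes on the outer one, where the whole competitor is 0
    and [F] is positive. *)
Lemma annulus (d r q : R) : 0 < d -> d < r -> r < R0 ->
  (forall z, enorm (z - a) = d -> ((q * (Psi (d ^+ 2) - Psi (r ^+ 2)))%:E <= F z)%E) ->
  forall z, d <= enorm (z - a) <= r -> ((q * (Psi (sqnorm (z - a)) - Psi (r ^+ 2)))%:E <= F z)%E.
Proof.
move=> d0 dr rR hd z1 z1a.
apply: (@le_limit_scale _ _ (r ^+ 2 - sqnorm (z1 - a))) => tau tau0.
pose H w := (q * Psi (sqnorm (w - a)) + tau * sqnorm (w - a)) + - (q * Psi (r ^+ 2) + tau * r ^+ 2).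
have -> : q * (Psi (sqnorm (z1 - a)) - Psi (r ^+ 2)) - tau * (r ^+ 2 - sqnorm (z1 - a)) = H z1.
  by rewrite /H; ring.
apply: (@comparison (ecball a r `&` ~` eball a d) (eball a r `&` ~` ecball a d) H).
- exact: closed_annulus_compact.
- by move=> w [+ _]; rewrite /ecball /eball /= => /le_lt_trans; apply.
- move=> w [+ +]; rewrite /ecball /eball /= => h1 h2; split; first exact: ltW.
  by rewrite /= => h3; apply: h2; rewrite ltW.
- apply: openI; first exact: open_eball.
  by apply: closed_openC; apply: closed_ecball.
- move=> w [_ +]; rewrite /eball /= => /negP; rewrite -leNgt => dw.
  have s0 : 0 < sqnorm (w - a) by rewrite -sqr_enorm exprn_gt0// (lt_le_trans d0).
  apply: (@continuous_sqnorm_comp a w (fun s => (q * Psi s + tau * s) + - (q * Psi (r ^+ 2) + tau * r ^+ 2))).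
  apply: has_deriv_continuous; apply: has_derivD; last exact: has_deriv_cst.
  apply: has_derivD; apply: has_derivZ; first exact: has_deriv_Psi.
  exact: has_deriv_id.
- move=> w [+ +]; rewrite /ecball /eball /= => wr /negP; rewrite -leNgt => dw nU.
  have [wE|wd] := eqVneq (enorm (w - a)) d.
    apply: lt_le_trans (hd w wE); rewrite lte_fin /H -sqr_enorm wE.
    have : tau * d ^+ 2 < tau * r ^+ 2 by rewrite ltr_pM2l// ltrXn2r// ?nnegrE ltW// (lt_trans d0).
    by lra.
  have wE : enorm (w - a) = r.
    apply/eqP; rewrite eq_le wr /= leNgt; apply/negP => wr'; apply: nU; split => //=.
    by apply/negP; rewrite -ltNge lt_neqAle eq_sym wd.
  rewrite /H -sqr_enorm wE subrr.
  by apply: Fpos; rewrite /eball /= wE.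
- move=> w [_ +]; rewrite /ecball /= => /negP; rewrite -ltNge => dw.
  have wa : w != a by apply: contraTneq dw => ->; rewrite subrr enorm0 -leNgt ltW.
  have x0 : w - a != 0 by rewrite subr_eq0.
  exists ((enorm (w - a))^-1%:C *: (w - a)); first exact: sqnorm_unit.
  have h1 := SDlim_scale q (SDlim_Psi wa).
  have h2 := SDlim_scale tau (SDlim_sqnorm w a (sqnorm_unit x0)).
  have h3 := SDlim_add (SDlim_add h1 h2)
    (SDlim_cst p k0 ((enorm (w - a))^-1%:C *: (w - a)) (- (q * Psi (r ^+ 2) + tau * r ^+ 2)) w).
  apply: SDlim_pos h3; rewrite mulr0 add0r addr0 !mulr_gt0//.
  by apply: ltr_wpDr => //; rewrite mulr_gt0// ltr0n.
- move: z1a => /andP[h1 h2]; split => //=.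
  by apply/negP; rewrite -leNgt.
Qed.

Variable R1 : R.
Hypothesis R10 : 0 < R1.
Hypothesis R1R0 : R1 < R0.

Let SQ := [set q : R | 0 <= q /\ forall z, 0 < enorm (z - a) < R1 ->
  ((q * (Psi (sqnorm (z - a)) - Psi (R1 ^+ 2)))%:E <= F z)%E].

(** If [F] were infinite on a ball, its mollification at the centre would exceed every real
    number. *)
Lemma exists_finite (z : V) r : 0 < r -> exists w, eball z r w /\ (F w < +oo)%E.
Proof.
move=> r0; apply: contrapT => nex.
have Finf w : eball z r w -> F w = +oo%E.
  move=> wr; apply/eqP; rewrite -leye_eq leNgt; apply/negP => h; apply: nex.
  by exists w.
have M0 := mass_gt0 r0.
have := @moll_ge r r0 z ((moll r z + 1) / mass r).
rewrite divfK ?gt_eqF// => h.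
have {h} := h (fun w wr => eq_ind_r (fun x => (_ <= x)%E) (leey _) (Finf w wr)).
by lra.
Qed.

Lemma exists_at_distance (x : R) : 0 <= x -> exists z : V, enorm (z - a) = x.
Proof.
move=> x0; exists (a + x%:C *: delta_mx 0 (Ordinal n0)).
by rewrite addrAC subrr add0r enormZ /enorm sqnorm_delta sqrtr1 mulr1 ger0_norm.
Qed.

Lemma finite_in_punctured r : 0 < r -> exists z, [/\ 0 < enorm (z - a), enorm (z - a) < r & (F z < +oo)%E].
Proof.
move=> r0; have [z zr] := @exists_at_distance (r / 2) (ltW (divr_gt0 r0 (ltr0n _ 2))).
have [w [wz Fw]] := @exists_finite z (r / 4) (divr_gt0 r0 (ltr0n _ 4)).
exists w; split => //.
  have := ler_enorm_dist z w a; rewrite [enorm (z - w)]enormB zr.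
  by move: wz; rewrite /eball /=; lra.
have := ler_enorm_dist w z a; rewrite zr.
by move: wz; rewrite /eball /=; lra.
Qed.

Lemma fin_le (z : V) (y : R) : (F z < +oo)%E -> (y%:E <= F z)%E -> y <= fine (F z).
Proof. by move=> h; rewrite -lee_fin fineK// ge0_fin_numE. Qed.

(** [l] is the supremum of [SQ], finite because [F] is finite somewhere in the punctured ball. Its
    maximality gives the last clause: if F >= (l + eps) Psi(r^2) held on arbitrarily small balls,
    comparison on annuli would put l + eps/2 into [SQ]. *)
Lemma ell_exists : exists l, [/\ 0 <= l,
  forall z, 0 < enorm (z - a) < R1 -> ((l * (Psi (sqnorm (z - a)) - Psi (R1 ^+ 2)))%:E <= F z)%E &
  forall eps, 0 < eps -> exists2 r1, 0 < r1 & forall r, 0 < r < r1 ->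
    exists2 z, eball a r z & (F z < ((l + eps) * Psi (r ^+ 2))%:E)%E].
Proof.
have dif z : 0 < enorm (z - a) < R1 -> 0 < Psi (sqnorm (z - a)) - Psi (R1 ^+ 2).
  move=> /andP[z0 zR]; rewrite subr_gt0 -sqr_enorm; apply: Psi_lt; first exact: exprn_gt0.
  by rewrite ltrXn2r// ?nnegrE ltW.
have S0 : SQ 0 by split => // z _; rewrite mul0r.
have [z0 [z00 z0R Fz0]] := finite_in_punctured R10.
have z0P : 0 < enorm (z0 - a) < R1 by rewrite z00.
have ubS : ubound SQ (fine (F z0) / (Psi (sqnorm (z0 - a)) - Psi (R1 ^+ 2))).
  move=> q [q0 /(_ _ z0P) /(fin_le Fz0) h]; rewrite ler_pdivlMr//; exact: dif.
have supS : has_sup SQ by split; [exists 0|exists (fine (F z0) / (Psi (sqnorm (z0 - a)) - Psi (R1 ^+ 2)))].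
pose l := sup SQ.
have l0 : 0 <= l by exact: (ub_le_sup supS.2 S0).
have lS z : 0 < enorm (z - a) < R1 -> ((l * (Psi (sqnorm (z - a)) - Psi (R1 ^+ 2)))%:E <= F z)%E.
  move=> zP; have [Fz|] := ltP (F z) +oo%E; last by rewrite leye_eq => /eqP ->; rewrite leey.
  rewrite -(fineK (_ : F z \is a fin_num)) ?ge0_fin_numE// lee_fin -ler_pdivlMr ?dif//.
  apply: ge_sup; first by exists 0.
  move=> q [q0 /(_ _ zP) /(fin_le Fz)]; rewrite ler_pdivlMr//; exact: dif.
exists l; split => // eps eps0; apply: contrapT => nex.
have big d : 0 < d -> exists2 r, 0 < r < d & forall z, eball a r z -> (((l + eps) * Psi (r ^+ 2))%:E <= F z)%E.
  move=> d0; apply: contrapT => h; apply: nex; exists d => // r rd.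
  apply: contrapT => h'; apply: h; exists r => // z zr; rewrite leNgt; apply/negP => Fz.
  by apply: h'; exists z.
suff : SQ (l + eps / 2).
  by move=> /(ub_le_sup supS.2); rewrite -/l; lra.
have le0 : 0 < l + eps by lra.
split=> [|z zP]; first by lra.
move: (zP) => /andP[za zR].
have [r /andP[r0 rz] hr] := big _ za.
(* The margin between eps/2 and eps. It pays for replacing the sphere of radius r, which the open
   ball misses, by the one of radius r t < r, where Psi(t^2) = 1/c. *)
pose c := (l + eps / 2) / (l + eps).
have c0 : 0 < c by rewrite divr_gt0//; lra.
have c1 : c < 1 by rewrite ltr_pdivrMr// mul1r; lra.
have [t [t0 t1 tc]] : exists t, [/\ 0 < t, t < 1 & c * Psi (t ^+ 2) <= 1].
  pose t := c `^ (2 * p)^-1.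
  have p2 : 0 < (2 * p)^-1 by rewrite invr_gt0 mulr_gt0.
  have t0 : 0 < t by exact: powR_gt0.
  exists t; split => //.
    have := @gt0_ltr_powR R _ p2 c 1; rewrite powR1; apply => //; by rewrite nnegrE ltW.
  rewrite /Psi -(powR_mulrn _ (ltW t0)) /t -!powRrM.
  have -> : (2 * p)^-1 * (2 * - p) = -1 by field; rewrite gt_eqF.
  by rewrite (powR_inv1 (ltW c0)) divff ?lexx// gt_eqF.
have rt0 : 0 < r * t by exact: mulr_gt0.
have rtr : r * t < r by rewrite gtr_pMr.
have Pr : 0 < Psi (r ^+ 2) by apply: Psi_gt0; exact: exprn_gt0.
have PR : 0 < Psi (R1 ^+ 2) by apply: Psi_gt0; exact: exprn_gt0.
apply: (@annulus (r * t)) => //; last by apply/andP; split; apply: ltW => //; lra.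
  by apply: lt_trans rtr _; lra.
move=> w wE; apply: le_trans (hr w _); last by rewrite /eball /= wE.
rewrite lee_fin exprMn PsiM ?sqr_ge0//.
have -> : l + eps / 2 = (l + eps) * c by rewrite /c; field; rewrite gt_eqF.
rewrite -mulrA ler_pM2l// mulrBr mulrCA.
apply: le_trans (_ : Psi (r ^+ 2) * (c * Psi (t ^+ 2)) <= _).
  by rewrite gerBl mulr_ge0// ltW.
by rewrite ger_pMr.
Qed.


Lemma limn_einf_ge (u : (\bar R)^nat) (x : \bar R) :
  (0 <= x)%E -> (forall c : R, (c%:E < x)%E -> exists m, forall k, (m <= k)%N -> (c%:E <= u k)%E) ->
  (x <= limn_einf u)%E.
Proof.
move=> x0 h; rewrite limn_einf_lim (cvg_lim (@ereal_hausdorff R) (@cvg_einfs_sup R u)).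
have key c : (c%:E < x)%E -> (c%:E <= ereal_sup (range (einfs u)))%E.
  move=> /h[m hm]; apply: le_trans (ereal_sup_ubound _); last by exists m.
  by apply: le_ereal_inf_tmp => _ [k /= mk <-]; exact: hm.
case: x x0 h key => [x| |]// _ _ key.
  by apply/lee_subgt0Pr => e e0; rewrite -EFinB; apply: key; rewrite lte_fin; lra.
rewrite leye_eq; apply/eqP/eqyP => A A0.
by apply: key; rewrite ltry.
Qed.

Lemma limn_einf_le (u : (\bar R)^nat) (x : \bar R) : (forall k, u k <= x)%E -> (limn_einf u <= x)%E.
Proof.
move=> h; rewrite limn_einf_lim (cvg_lim (@ereal_hausdorff R) (@cvg_einfs_sup R u)).
apply: ge_ereal_sup => _ [m _ <-]; apply: le_trans (h m).
by apply: ereal_inf_lbound; exists m => //=.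
Qed.

Lemma measurable_sphere_map (x : R) :
  measurable_fun setT (fun t : mC => F (a + (x / enorm (toC t))%:C *: toC t)).
Proof.
have mx : measurable_fun setT (fun t : mC => x / enorm (toC t)).
  apply: measurable_funM; first exact: measurable_cst.
  by apply: measurable_invr; exact: measurable_enormC.
by apply: measurable_h_comp => // j; [apply: measurable_Re_affine|apply: measurable_Im_affine].
Qed.

(** Fatou's lemma along radii tending to r from below, combined with the lower semicontinuity of [F]
    at each point of the sphere of radius r. *)
Lemma sphere_int_lsc (r : R) (L : R) : 0 < r -> r < R0 -> (L%:E < sphere_int F a r)%E ->
  exists2 d, 0 < d & forall x, r - d < x <= r -> (L%:E < sphere_int F a x)%E.
Proof.
move=> r0 rR Lr; apply: contrapT => nex.
have hx k : exists x, [/\ r - k.+1%:R^-1 < x, x <= r & (sphere_int F a x <= L%:E)%E].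
  apply: contrapT => h; apply: nex; exists k.+1%:R^-1; first by rewrite invr_gt0 ltr0n.
  move=> x /andP[x1 x2].
  by rewrite ltNge; apply/negP => h'; apply: h; exists x.
have [x xP] := choice hx.
have mB : measurable [set t : mC | enorm (toC t) < 1].
  by rewrite unit_ballE; exact: measurable_eballC.
pose f k (t : mC) := F (a + (x k / enorm (toC t))%:C *: toC t).
have mf k : measurable_fun [set t : mC | enorm (toC t) < 1] (f k).
  by apply: measurable_funTS; exact: measurable_sphere_map.
have := fatou mu mB mf (fun k t _ => F0 _).
rewrite leNgt => /negP; apply.
apply: (@le_lt_trans _ _ L%:E); first by apply: limn_einf_le => k; have [_ _] := xP k.
apply: lt_le_trans Lr _; apply: ge0_le_integral => //.
- by apply: measurable_funTS; exact: measurable_sphere_map.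
- have -> : (fun t => limn_einf (f^~ t)) = (fun t => (- limn_esup (fun k => - f k t))%E) by [].
  by apply: measurableT_comp => //; apply: measurable_fun_limn_esup => k; exact: measurableT_comp.
move=> t _; apply: limn_einf_ge => // c cF.
set w := a + (r / enorm (toC t))%:C *: toC t in cF.
have wr : enorm (w - a) <= r.
  rewrite /w addrAC subrr add0r enormZ.
  have [->|t0] := eqVneq (toC t) 0; first by rewrite enorm0 mulr0 ltW.
  have te : 0 < enorm (toC t) by rewrite enorm_gt0.
  by rewrite ger0_norm ?(divr_ge0 (ltW r0) (ltW te))// divfK ?gt_eqF.
have /nbhs_eballP[d d0 dF] := lsc (le_lt_trans wr rR) cF.
have [m md] := ltr_add_invr d0; rewrite add0r in md.
exists m => k mk; apply: ltW; apply: dF; rewrite /eball /f /= /w.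
have -> : a + (x k / enorm (toC t))%:C *: toC t - (a + (r / enorm (toC t))%:C *: toC t) =
   ((x k - r) / enorm (toC t))%:C *: toC t.
  by rewrite opprD addrACA subrr add0r -scalerBl -CBr -mulrBl.
rewrite enormZ.
have [->|t0] := eqVneq (toC t) 0; first by rewrite enorm0 mulr0.
have te : 0 < enorm (toC t) by rewrite enorm_gt0.
rewrite normrM normfV (gtr0_norm te) divfK ?gt_eqF//.
have [x1 x2 _] := xP k.
have km : k.+1%:R^-1 <= m.+1%:R^-1 :> R by rewrite lef_pV2 ?posrE// ler_nat.
move: x1 km md; move: (k.+1%:R^-1) (m.+1%:R^-1) => y1 y2 x1 km md.
by rewrite ler0_norm; lra.
Qed.

(** Summed over the n coordinate directions, the directional terms rebuild a trace: the D_e add up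
    to n p + k0 times n g' + s g'', a quarter of the Laplacian. So [F] is superharmonic when tested
    on radial functions. *)
Lemma J_laplace (c : V) (g g1 g2 : R -> R) r C :
  elementary (fun z : V => g (sqnorm (z - c))) ->
  (forall x, has_deriv g x (g1 x)) -> (forall x, has_deriv g1 x (g2 x)) -> continuous g2 ->
  (forall x, 0 <= g x) -> (forall x, r ^+ 2 < x -> g x = 0) -> 0 <= r ->
  ecball c r `<=` eball a R0 ->
  (forall x, 0 <= x -> `|g1 x| <= C) -> (forall x, r ^+ 2 < x -> g1 x = 0) ->
  (forall x, 0 <= x -> `|g2 x| <= C) -> (forall x, r ^+ 2 < x -> g2 x = 0) ->
  J (fun t => n%:R * g1 (sqnorm (toC t - c)) + sqnorm (toC t - c) * g2 (sqnorm (toC t - c))) <= 0.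
Proof.
move=> eg dg dg1 cg2 g0 gr r0 cR g1C g1r g2C g2r.
have m1 : measurable_fun setT g1.
  by apply: continuous_measurable_fun => x; exact: has_deriv_continuous (dg1 x).
have m2 : measurable_fun setT g2 by exact: continuous_measurable_fun.
pose e j : V := delta_mx 0 j; have e1 j : sqnorm (e j) = 1 by exact: sqnorm_delta.
pose h j (t : mC) := hopr p k0 (e j) (g1 (sqnorm (toC t - c))) (g2 (sqnorm (toC t - c))) (toC t - c).
have bh j : bnd_measurable (h j) by exact: (bnd_hopr c (e1 j) r0 m1 g1C g1r m2 g2C g2r).
have [A1 A2 A3] := bnd_radial c (e1 (Ordinal n0)) m1 r0 g1C g1r.
have [B1 B2 B3] := bnd_radial c (e1 (Ordinal n0)) m2 r0 g2C g2r.
have q0 : 0 < n%:R * p + k0 by rewrite ltr_wpDr// mulr_gt0// ltr0n.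
rewrite -(pmulr_rle0 _ q0) -(JZ _ (bnd_measurableD (bnd_measurableZ _ A1) B2)).
have := wint_sum dens_int (enum 'I_n) bh => -[_].
rewrite (_ : (fun t => \sum_(j <- enum 'I_n) h j t) = fun t : mC => (n%:R * p + k0) *
   (n%:R * g1 (sqnorm (toC t - c)) + sqnorm (toC t - c) * g2 (sqnorm (toC t - c)))); last first.
  apply/funext => t; rewrite /h /hopr; set x := toC t - c; move: (g1 _) (g2 _) => u v.
  rewrite big_enum /= (eq_bigr (fun j => p * (n%:R * u + sqnorm x * v) + k0 * u +
     k0 * v * (complex.Re (x 0 j) ^+ 2 + complex.Im (x 0 j) ^+ 2))); last first.
    by move=> j _; rewrite rdot_delta rdot_Idelta; ring.
  rewrite big_split /= sumr_const card_ord -mulr_sumr -/(sqnorm x) -[_ *+ n]mulr_natl; ring.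
move=> ->; rewrite big_enum /=; apply: sumr_le0 => j _.
exact: (hopF (e1 j) eg dg dg1 cg2 g0 gr r0 cR).
Qed.

(** * Radial test functions concentrated near a sphere *)

Lemma elementary_exp (f : V -> R) j : elementary f -> elementary (fun z => f z ^+ j).
Proof.
move=> ef; elim: j => [|j IH].
  by rewrite (_ : (fun z => _) = fun=> 1); [exact: elementary_cst|apply/funext => z; rewrite expr0].
rewrite (_ : (fun z => _) = fun z => f z * f z ^+ j); first exact: elementary_mul.
by apply/funext => z; rewrite exprS.
Qed.

Lemma bernoulli_le (t : R) m : 0 <= t <= 1 -> 1 - m%:R * t <= (1 - t) ^+ m.
Proof.
move=> /andP[t0 t1]; elim: m => [|m IH]; first by rewrite mul0r subr0 expr0.
rewrite exprS; apply: le_trans (ler_wpM2l _ IH); last by rewrite subr_ge0.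
have : 0 <= m%:R * t ^+ 2 by rewrite mulr_ge0 ?sqr_ge0 ?ler0n.
by rewrite -natr1; move: (m%:R) => x; rewrite expr2; lra.
Qed.

Lemma le_limit_small (x y K t0 : R) : 0 < t0 -> (forall t, 0 < t < t0 -> x - t * K <= y) -> x <= y.
Proof.
move=> t00 h; rewrite leNgt; apply/negP => yx.
have K1 : 0 < `|K| + 1 by rewrite ltr_wpDl.
pose t := Num.min (t0 / 2) ((x - y) / (`|K| + 1) / 2).
have xy : 0 < x - y by rewrite subr_gt0.
have t_0 : 0 < t by rewrite lt_min !divr_gt0.
have tt0 : t < t0 by apply: (@le_lt_trans _ _ (t0 / 2)); [rewrite ge_min lexx|lra].
have tK : t * (`|K| + 1) <= (x - y) / 2.
  rewrite -ler_pdivlMr// mulrAC; apply: le_trans (_ : (x - y) / (`|K| + 1) / 2 <= _).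
    by rewrite ge_min lexx orbT.
  by rewrite mulrAC.
have := h t; rewrite t_0 tt0 => /(_ isT).
have : t * K <= t * (`|K| + 1).
  by rewrite ler_pM2l//; apply: le_trans (ler_norm K) _; rewrite lerDl.
lra.
Qed.

(** With v = 1/u the value is (1 + v) exp (- v): up to scaling, the derivative of the regularized
    positive part introduced below. *)
Lemma flat1X_bounds (u : R) : 0 <= flat (1 + 'X) u <= 1.
Proof.
rewrite /flat; case: ifP => u0; last by rewrite lexx ler01.
rewrite hornerD hornerC hornerX; have v0 : 0 < u^-1 by rewrite invr_gt0.
move: (u^-1) v0 => v v0; rewrite expRN mulr_ge0 ?invr_ge0 ?expR_ge0//; last by lra.
by rewrite ler_pdivrMr ?expR_gt0// mul1r expR_ge1Dx.
Qed.

Lemma flat1X_ge (u : R) : 0 < u -> 1 - u^-1 <= flat (1 + 'X) u.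
Proof.
move=> u0; rewrite /flat u0 hornerD hornerC hornerX.
have v0 : 0 < u^-1 by rewrite invr_gt0.
move: (u^-1) v0 => v v0; apply: le_trans (expR_ge1Dx (- v)) _.
by rewrite ler_peMl ?expR_ge0//; lra.
Qed.

Lemma flatX3_bounds (u : R) : 0 <= flat 'X^3 u <= 6.
Proof.
rewrite /flat; case: ifP => u0; last by rewrite lexx ler0n.
rewrite hornerXn; have v0 : 0 < u^-1 by rewrite invr_gt0.
move: (u^-1) v0 => v v0; rewrite mulr_ge0 ?expR_ge0 ?exprn_ge0 ?(ltW v0)//=.
rewrite expRN ler_pdivrMr ?expR_gt0//.
have := @expR_ge1Dxn R v 2 (ltW v0).
rewrite (_ : 3`! = 6%N)// => h.
have : v ^+ 3 / 6 <= expR v by apply: le_trans h; rewrite lerDr.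
by rewrite ler_pdivrMr ?ltr0n// mulrC.
Qed.

(* The test function is [T (1 - (|z - a|^2 / r^2)^(k+1))] with [T x = x exp (- c / x)] for
   [x > 0]; as [c] tends to 0, [T] tends to the positive part. *)
Section Theta.
Variables (r c : R) (k : nat).
Hypothesis r0 : 0 < r.
Hypothesis c0 : 0 < c.
Let q := (r ^+ 2)^-1.
Let q0 : 0 < q. Proof. by rewrite invr_gt0 exprn_gt0. Qed.

Let y s := 1 - (q * s) ^+ k.+1.
Let y1 s := - (k.+1%:R * q) * (q * s) ^+ k.
Let y2 s := - (k.+1%:R * q) * (k%:R * (q * s) ^+ k.-1 * q).
Let T x := x * flat 1 (c^-1 * x).
Let T1 x := flat (1 + 'X) (c^-1 * x).
Let T2 x := c^-1 * flat 'X^3 (c^-1 * x).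

Let dlin (u x : R) : has_deriv (fun x => u * x) x u.
Proof. by have := has_derivZ u (has_deriv_id x); rewrite mulr1. Qed.

Let dT x : has_deriv T x (T1 x).
Proof.
apply: has_deriv_eq.
  apply: has_derivM; first exact: has_deriv_id.
  by apply: has_deriv_comp; [exact: has_deriv_flat|exact: dlin].
rewrite /T1 /flat; case: ifP => cx; last by rewrite mul0r !mulr0 addr0.
have p1 : (1 : {poly R}) = 1%:P by [].
rewrite p1 derivC subr0 mulr1 hornerXn hornerD hornerX !hornerC.
have x0 : x != 0 by apply: contraTneq cx => ->; rewrite mulr0 ltxx.
by move: (expR _) => w; field; rewrite x0 gt_eqF.
Qed.

Let dT1 x : has_deriv T1 x (T2 x).
Proof.
apply: has_deriv_eq.
  by apply: has_deriv_comp; [exact: has_deriv_flat|exact: dlin].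
by rewrite derivD derivC derivX add0r addrAC subrr add0r -exprSr mulrC.
Qed.

Let cT2 : continuous T2.
Proof.
move=> x; apply: has_deriv_continuous; apply: has_derivZ.
by apply: has_deriv_comp; [exact: has_deriv_flat|exact: dlin].
Qed.

Let dy s : has_deriv y s (y1 s).
Proof.
apply: has_deriv_eq.
  by apply: has_derivB; [exact: has_deriv_cst|apply: has_derivX; exact: dlin].
by rewrite /y1 /=; ring.
Qed.

Let dy1 s : has_deriv y1 s (y2 s).
Proof. by apply: has_derivZ; apply: has_derivX; exact: dlin. Qed.

Let cy2 : continuous y2.
Proof.
move=> s; apply: has_deriv_continuous; apply: has_derivZ.
apply: has_derivM; last exact: has_deriv_cst.
by apply: has_derivZ; apply: has_derivX; exact: dlin.
Qed.

Let g s := T (y s).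
Let g1 s := T1 (y s) * y1 s.
Let g2 s := T2 (y s) * y1 s ^+ 2 + T1 (y s) * y2 s.

Let dg s : has_deriv g s (g1 s).
Proof. exact: (has_deriv_comp (dT (y s)) (dy s)). Qed.

Let dg1 s : has_deriv g1 s (g2 s).
Proof.
apply: has_deriv_eq.
  by apply: has_derivM; [apply: has_deriv_comp; [exact: dT1|exact: dy]|exact: dy1].
by rewrite /g2; ring.
Qed.

Let cg2 : continuous g2.
Proof.
move=> s; have cy := has_deriv_continuous (dy s).
have c1 : {for s, continuous (T1 \o y)}.
  by apply: continuous_comp cy _; exact: has_deriv_continuous (dT1 _).
have c2 : {for s, continuous (T2 \o y)} by apply: continuous_comp cy _; exact: cT2.
have c3 := has_deriv_continuous (has_derivX 2 (dy1 s)).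
have h1 : (T1 \o y) x @[x --> s] --> (T1 \o y) s := c1.
have h2 : (T2 \o y) x @[x --> s] --> (T2 \o y) s := c2.
have h3 : (y1 x ^+ 2) @[x --> s] --> (y1 s ^+ 2) := c3.
exact: cvgD (cvgM h2 h3) (cvgM h1 (cy2 (x:=s))).
Qed.

Let T1b x : 0 <= T1 x <= 1. Proof. exact: flat1X_bounds. Qed.
Let T2b x : 0 <= T2 x <= c^-1 * 6.
Proof.
have /andP[h1 h2] := flatX3_bounds (c^-1 * x).
by rewrite /T2 mulr_ge0 ?invr_ge0 ?(ltW c0)//= ler_pM2l ?invr_gt0.
Qed.

Let supp (P : {poly R}) s : r ^+ 2 <= s -> flat P (c^-1 * y s) = 0.
Proof.
move=> rs; rewrite /flat ifF//; apply/negP; rewrite pmulr_rgt0 ?invr_gt0//.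
rewrite /y subr_gt0 ltNge => /negP; apply; apply: exprn_ege1.
by rewrite /q ler_pdivlMl ?exprn_gt0// mulr1.
Qed.

Let g1r s : r ^+ 2 < s -> g1 s = 0.
Proof. by move=> /ltW rs; rewrite /g1 /T1 supp// mul0r. Qed.

Let g2r s : r ^+ 2 < s -> g2 s = 0.
Proof. by move=> /ltW rs; rewrite /g2 /T1 /T2 !supp// mulr0 !mul0r addr0. Qed.

Let g0 s : 0 <= g s.
Proof.
rewrite /g /T /flat; case: ifP => h; last by rewrite mulr0.
move: h; rewrite pmulr_rgt0 ?invr_gt0// => h.
by rewrite hornerC mul1r mulr_ge0 ?expR_ge0 ?ltW.
Qed.

Let qs s : 0 <= s -> s <= r ^+ 2 -> 0 <= q * s <= 1.
Proof.
move=> s0 sr; rewrite mulr_ge0 ?(ltW q0)//=.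
by rewrite /q ler_pdivrMl ?exprn_gt0// mulr1.
Qed.

Let y1b s : 0 <= s -> s <= r ^+ 2 -> `|y1 s| <= k.+1%:R * q.
Proof.
move=> s0 sr; have /andP[h1 h2] := qs s0 sr.
have kq : 0 <= k.+1%:R * q by rewrite mulr_ge0 ?(ltW q0).
rewrite /y1 mulNr normrN normrM (ger0_norm kq) ler_piMr//.
by rewrite ger0_norm ?exprn_ge0// exprn_ile1.
Qed.

Let y2b s : 0 <= s -> s <= r ^+ 2 -> `|y2 s| <= k.+1%:R * q * (k%:R * q).
Proof.
move=> s0 sr; have /andP[h1 h2] := qs s0 sr.
have kq : 0 <= k.+1%:R * q by rewrite mulr_ge0 ?(ltW q0).
rewrite /y2 mulNr normrN normrM (ger0_norm kq) ler_wpM2l//.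
have h3 : 0 <= (q * s) ^+ k.-1 by exact: exprn_ge0.
rewrite ger0_norm ?mulr_ge0 ?(ltW q0)// ler_wpM2r ?(ltW q0)//.
by rewrite ler_piMr// exprn_ile1.
Qed.

Let C := c^-1 * 6 * (k.+1%:R * q) ^+ 2 + k.+1%:R * q * (k%:R * q) + k.+1%:R * q.

Let C1 : 0 <= k.+1%:R * q. Proof. by rewrite mulr_ge0 ?(ltW q0). Qed.
Let C2 : 0 <= k.+1%:R * q * (k%:R * q). Proof. by rewrite mulr_ge0 ?C1// mulr_ge0 ?(ltW q0). Qed.
Let C3 : 0 <= c^-1 * 6 * (k.+1%:R * q) ^+ 2.
Proof. by rewrite mulr_ge0 ?sqr_ge0// mulr_ge0 ?invr_ge0 ?(ltW c0). Qed.

Let g1C s : 0 <= s -> `|g1 s| <= C.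
Proof.
move=> s0; have [sr|sr] := leP s (r ^+ 2); last first.
  by rewrite g1r// normr0 !addr_ge0 ?C1 ?C2 ?C3.
have /andP[t0 t1] := T1b (y s).
rewrite /g1 normrM (ger0_norm t0); apply: le_trans (_ : k.+1%:R * q <= _).
  by apply: le_trans (y1b s0 sr); rewrite ler_piMl.
by rewrite /C lerDr addr_ge0 ?C2 ?C3.
Qed.

Let g2C s : 0 <= s -> `|g2 s| <= C.
Proof.
move=> s0; have [sr|sr] := leP s (r ^+ 2); last first.
  by rewrite g2r// normr0 !addr_ge0 ?C1 ?C2 ?C3.
have /andP[t0 t1] := T1b (y s); have /andP[u0 u1] := T2b (y s).
rewrite /g2; apply: le_trans (ler_normD _ _) _.
apply: le_trans (_ : c^-1 * 6 * (k.+1%:R * q) ^+ 2 + k.+1%:R * q * (k%:R * q) <= _); last first.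
  by rewrite /C lerDl C1.
apply: lerD; rewrite normrM ger0_norm//.
  apply: ler_pM => //; rewrite normrX lerXn2r ?nnegrE//; exact: y1b.
by apply: le_trans (y2b s0 sr); rewrite ler_piMl.
Qed.

Let eg : elementary (fun z : V => g (sqnorm (z - a))).
Proof.
have ey : elementary (fun z : V => y (sqnorm (z - a))).
  rewrite (_ : (fun z => _) = fun z : V => 1 + (-1) * (q * sqnorm (z - a)) ^+ k.+1); last first.
    by apply/funext => z; rewrite /y mulN1r.
  apply: elementary_add; first exact: elementary_cst.
  apply: elementary_mul; first exact: elementary_cst.
  apply: elementary_exp; apply: elementary_mul; first exact: elementary_cst.
  exact: elementary_sqnorm.
apply: elementary_mul => //; apply: elementary_flat; apply: elementary_mul => //.
exact: elementary_cst.
Qed.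

(** The radial Laplacian is [Af - Bf]. [Af] carries the second derivative of the regularized
    positive part and concentrates on |z - a| = r as c tends to 0; [Bf] is bounded by a multiple of
    the weight [pw], independently of c. *)
Let Af s := s * (T2 (y s) * y1 s ^+ 2).
Let Bf s := T1 (y s) * (k.+1%:R * q * ((n%:R + k%:R) * (q * s) ^+ k)).

Let AB s : n%:R * g1 s + s * g2 s = Af s - Bf s.
Proof.
have h : s * (k%:R * (q * s) ^+ k.-1 * q) = k%:R * (q * s) ^+ k.
  case: k => [|j]; first by rewrite !mul0r mulr0.
  by rewrite exprS /=; ring.
rewrite /g1 /g2 /Af /Bf /y2 mulrDr.
have -> : s * (T1 (y s) * (- (k.+1%:R * q) * (k%:R * (q * s) ^+ k.-1 * q))) =
  - (T1 (y s) * (k.+1%:R * q)) * (s * (k%:R * (q * s) ^+ k.-1 * q)) by ring.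
by rewrite h /y1; ring.
Qed.

(** The weight (|z - a| / r)^(2k) on the ball of radius r; a large [k] pushes it towards the
    sphere. *)
Definition pw (t : mC) : R :=
  if enorm (toC t - a) < r then (q * sqnorm (toC t - a)) ^+ k else 0.

Lemma bnd_pw : bnd_measurable pw.
Proof.
split.
  apply: measurable_fun_ifT; last exact: measurable_cst.
    by apply: measurable_fun_ltr; [exact: measurable_enormC_sub|exact: measurable_cst].
  apply: measurable_funX; apply: measurable_funM; first exact: measurable_cst.
  exact: measurable_sqnormC.
exists 1 => t; rewrite /pw; case: ifP => [h|_]; last by rewrite normr0.
have /andP[h1 h2] : 0 <= q * sqnorm (toC t - a) <= 1.
  apply: qs; first exact: sqnorm_ge0.
  by rewrite -sqr_enorm lerXn2r// ?nnegrE ?enorm_ge0// ltW.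
by rewrite ger0_norm ?exprn_ge0// exprn_ile1.
Qed.

Lemma pw_ge0 t : 0 <= pw t.
Proof.
by rewrite /pw; case: ifP => // _; rewrite exprn_ge0// mulr_ge0 ?sqnorm_ge0// ltW.
Qed.

Let e1 : sqnorm (delta_mx 0 (Ordinal n0) : V) = 1. Proof. exact: sqnorm_delta. Qed.

Let hA s := T2 (y s) * y1 s ^+ 2.

Let chA : continuous hA.
Proof.
move=> s; have cy := has_deriv_continuous (dy s).
have c2 : {for s, continuous (T2 \o y)} by apply: continuous_comp cy _; exact: cT2.
have c3 := has_deriv_continuous (has_derivX 2 (dy1 s)).
have h2 : (T2 \o y) x @[x --> s] --> (T2 \o y) s := c2.
have h3 : (y1 x ^+ 2) @[x --> s] --> (y1 s ^+ 2) := c3.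
exact: cvgM h2 h3.
Qed.

Let hA0 s : 0 <= hA s.
Proof. by rewrite /hA mulr_ge0 ?sqr_ge0//; case/andP: (T2b (y s)). Qed.

Let hAr s : r ^+ 2 < s -> hA s = 0.
Proof. by move=> /ltW rs; rewrite /hA /T2 supp// mulr0 mul0r. Qed.

Let hAC s : 0 <= s -> `|hA s| <= C.
Proof.
move=> s0; have [sr|sr] := leP s (r ^+ 2); last first.
  by rewrite hAr// normr0 !addr_ge0 ?C1 ?C2 ?C3.
have /andP[u0 u1] := T2b (y s).
apply: le_trans (_ : c^-1 * 6 * (k.+1%:R * q) ^+ 2 <= _); last first.
  by rewrite /C -addrA lerDl addr_ge0 ?C1 ?C2.
rewrite normrM (ger0_norm u0); apply: ler_pM => //.
by rewrite normrX lerXn2r ?nnegrE//; exact: y1b.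
Qed.

Let mhA : measurable_fun setT hA. Proof. exact: continuous_measurable_fun. Qed.

Let bA : bnd_measurable (fun t : mC => Af (sqnorm (toC t - a))).
Proof. by have [_ h _] := bnd_radial a e1 mhA (ltW r0) hAC hAr. Qed.

Let bB : bnd_measurable (fun t : mC => Bf (sqnorm (toC t - a))).
Proof.
have cB : continuous Bf.
  move=> s; have c1 : {for s, continuous (T1 \o y)}.
    by apply: continuous_comp (has_deriv_continuous (dy s)) _; exact: has_deriv_continuous (dT1 _).
  have h1 : (T1 \o y) x @[x --> s] --> (T1 \o y) s := c1.
  have d2 : has_deriv (fun s => k.+1%:R * q * ((n%:R + k%:R) * (q * s) ^+ k)) s
      (k.+1%:R * q * ((n%:R + k%:R) * (k%:R * (q * s) ^+ k.-1 * q))).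
    by apply: has_derivZ; apply: has_derivZ; apply: has_derivX; exact: dlin.
  have h2 : (k.+1%:R * q * ((n%:R + k%:R) * (q * x) ^+ k)) @[x --> s] -->
     (k.+1%:R * q * ((n%:R + k%:R) * (q * s) ^+ k)) := has_deriv_continuous d2.
  exact: cvgM h1 h2.
have Br s : r ^+ 2 < s -> Bf s = 0 by move=> /ltW rs; rewrite /Bf /T1 supp// mul0r.
have BC s : 0 <= s -> `|Bf s| <= k.+1%:R * q * (n%:R + k%:R).
  have nk : 0 <= k.+1%:R * q * (n%:R + k%:R) by rewrite mulr_ge0 ?C1.
  move=> s0; have [sr|sr] := leP s (r ^+ 2); last by rewrite Br// normr0.
  have /andP[h1 h2] := qs s0 sr; have /andP[h3 h4] := T1b (y s).
  have h5 : 0 <= (q * s) ^+ k by exact: exprn_ge0.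
  rewrite /Bf normrM (ger0_norm h3) mulrA normrM (ger0_norm nk) (ger0_norm h5).
  apply: le_trans (_ : 1 * (k.+1%:R * q * (n%:R + k%:R) * 1) <= _); last by rewrite mul1r mulr1.
  apply: ler_pM => //; first by rewrite mulr_ge0.
  by rewrite ler_wpM2l// exprn_ile1.
by have [h _ _] := bnd_radial a e1 (continuous_measurable_fun cB) (ltW r0) BC Br.
Qed.

Let gr s : r ^+ 2 < s -> g s = 0.
Proof. by move=> /ltW rs; rewrite /g /T supp// mulr0. Qed.

(** Superharmonicity gives J Af <= J Bf, and T1 <= 1 removes c from the right-hand side. *)
Let JA_le : ecball a r `<=` eball a R0 ->
  J (fun t => Af (sqnorm (toC t - a))) <= k.+1%:R * q * (n%:R + k%:R) * J pw.
Proof.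
move=> rR; have := J_laplace eg dg dg1 cg2 g0 gr (ltW r0) rR g1C g1r g2C g2r.
rewrite (_ : (fun t => _) = fun t : mC => Af (sqnorm (toC t - a)) - Bf (sqnorm (toC t - a))); last first.
  by apply/funext => t; rewrite AB.
rewrite (JB bA bB) subr_le0 => /le_trans; apply.
rewrite -(JZ _ bnd_pw); apply: (J_le bB (bnd_measurableZ _ bnd_pw)) => t _.
have s0 := sqnorm_ge0 (toC t - a).
rewrite /pw; case: ifPn => [h|]; last first.
  rewrite -leNgt => h; rewrite mulr0 /Bf /T1 supp ?mul0r// -sqr_enorm.
  by rewrite lerXn2r ?nnegrE ?enorm_ge0// ltW.
have sr : sqnorm (toC t - a) <= r ^+ 2.
  by rewrite -sqr_enorm lerXn2r ?nnegrE ?enorm_ge0// ltW.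
have /andP[h1 _] := qs s0 sr; have /andP[h3 h4] := T1b (y (sqnorm (toC t - a))).
have -> : k.+1%:R * q * (n%:R + k%:R) * (q * sqnorm (toC t - a)) ^+ k =
    k.+1%:R * q * ((n%:R + k%:R) * (q * sqnorm (toC t - a)) ^+ k) by rewrite mulrA.
apply: ler_piMl => //.
by rewrite mulr_ge0 ?C1// mulr_ge0 ?exprn_ge0// addr_ge0.
Qed.

Let hh x := T1 (y (x ^+ 2)).
Let dh x : has_deriv hh x (T2 (y (x ^+ 2)) * y1 (x ^+ 2) * (2 * x)).
Proof.
have d2 : has_deriv (fun x : R => x ^+ 2) x (2 * x).
  by apply: has_deriv_eq; [apply: has_derivX; exact: has_deriv_id|rewrite mulr1 expr1].
have d3 := @has_deriv_comp R (fun x => x ^+ 2) y x _ _ (dy (x ^+ 2)) d2.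
by have := @has_deriv_comp R (fun x => y (x ^+ 2)) T1 x _ _ (dT1 (y (x ^+ 2))) d3; rewrite mulrA.
Qed.

(** In polar coordinates N x^(N-1) Af(x^2) is the product of N (k+1) q^(k+1) x^(N+2k) / 2 and of
    minus the derivative of T1(y(x^2)). Bounding the first factor by its value at rho leaves an
    exact integral, with T1(y(r^2)) = 0. *)
Let JA_ge (rho L : R) : 0 < rho -> rho < r -> 0 <= L ->
  (forall x, rho <= x <= r -> (L%:E <= sphere_int F a x)%E) ->
  L * (N%:R * k.+1%:R * q ^+ k.+1 * rho ^+ (N + k + k) / 2) * T1 (y (rho ^+ 2)) <=
  J (fun t => Af (sqnorm (toC t - a))).
Proof.
move=> rho0 rhor L0 hL; set Kc := N%:R * k.+1%:R * q ^+ k.+1 * rho ^+ (N + k + k) / 2.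
have Kc0 : 0 <= Kc.
  by rewrite !mulr_ge0 ?invr_ge0 ?exprn_ge0 ?(ltW rho0) ?(ltW q0).
have A0 s : 0 <= s -> 0 <= Af s by move=> s0; rewrite /Af mulr_ge0 ?hA0.
rewrite -lee_fin -(int_F_wint bA).
have -> : (\int[mu]_t (F (toC t) * (Af (sqnorm (toC t - a)))%:E) =
   \int[mu]_t (F (toC t) * (Af (enorm (toC t - a) ^+ 2))%:E))%E.
  by apply: eq_integral => t _; rewrite sqr_enorm.
have cAf : continuous Af.
  by move=> s; have h := chA (x:=s); exact: cvgM (@cvg_id _ _) h.
have cAf2 : continuous (fun x : R => Af (x ^+ 2)).
  by move=> x; apply: (@continuous_comp _ _ _ (fun x : R => x ^+ 2) Af); [exact: exprn_continuous|exact: cAf].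
have mA2 : measurable_fun setT (fun x : R => Af (x ^+ 2)) by exact: continuous_measurable_fun.
rewrite (@polar_integral R n F _ a n0 mF F0 mA2 (fun x => A0 _ (sqr_ge0 x))).
pose D x := - (L * Kc) * (T2 (y (x ^+ 2)) * y1 (x ^+ 2) * (2 * x)).
have dP x : has_deriv (fun x => - (L * Kc) * hh x) x (D x) by exact: (has_derivZ _ (dh x)).
have cD : continuous D.
  move=> x.
  have cs : {for x, continuous (fun x : R => x ^+ 2)} by exact: exprn_continuous.
  have c1 : {for x, continuous (T2 \o y \o (fun x => x ^+ 2))}.
    apply: continuous_comp cs _; apply: continuous_comp; last exact: cT2.
    exact: has_deriv_continuous (dy _).
  have c2 : {for x, continuous (y1 \o (fun x => x ^+ 2))}.
    by apply: continuous_comp cs _; exact: has_deriv_continuous (dy1 _).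
  have c3 := has_deriv_continuous (dlin 2 x).
  have c4 := has_deriv_continuous (has_deriv_cst x (- (L * Kc))).
  have h1 : (T2 \o y \o (fun x => x ^+ 2)) z @[z --> x] --> (T2 \o y \o (fun x => x ^+ 2)) x := c1.
  have h2 : (y1 \o (fun x => x ^+ 2)) z @[z --> x] --> (y1 \o (fun x => x ^+ 2)) x := c2.
  have h3 : (2 * z) @[z --> x] --> 2 * x := c3.
  have h4 : (cst (- (L * Kc)) z) @[z --> x] --> - (L * Kc) := c4.
  exact: cvgM h4 (cvgM (cvgM h1 h2) h3).
have FTC : (\int[lebR]_(x in `[rho, r]) (D x)%:E = (L * Kc * T1 (y (rho ^+ 2)))%:E)%E.
  rewrite (continuous_FTC2 rhor (continuous_subspaceT cD) (F := fun x => - (L * Kc) * hh x)).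
  - rewrite /hh [X in - _ * X](_ : _ = 0); last by rewrite /T1 supp.
    by rewrite mulr0 sub0e mulNr EFinN oppeK.
  - split.
    + by move=> x _; have [] := has_derivP (dP x).
    + by apply: cvg_at_right_filter; exact: has_deriv_continuous (dP rho).
    + by apply: cvg_at_left_filter; exact: has_deriv_continuous (dP r).
  - by move=> x _; have [_ ->] := has_derivP (dP x).
have W0 x : (0 <= ((0 < x)%R%:R * (N%:R * x ^+ N.-1 * Af (x ^+ 2)))%:E)%E.
  rewrite lee_fin; apply: ind_mulr_ge0 => x0.
  apply: mulr_ge0; last by apply: A0; exact: sqr_ge0.
  by apply: mulr_ge0 => //; apply: exprn_ge0; exact: ltW.
have y1n x : 0 <= x -> y1 x <= 0.
  by move=> x0; rewrite /y1 mulNr oppr_le0 mulr_ge0 ?C1// exprn_ge0// mulr_ge0 ?(ltW q0).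
have T20 x : 0 <= T2 x by case/andP: (T2b x).
have D0 x : rho <= x -> 0 <= D x.
  move=> x1; have x0 : 0 <= x by apply: le_trans x1; exact: ltW.
  have -> : D x = L * Kc * (T2 (y (x ^+ 2)) * (- y1 (x ^+ 2)) * (2 * x)).
    by rewrite /D; move: (T2 _) (y1 _) => u v; ring.
  have := y1n _ (sqr_ge0 x); rewrite -oppr_ge0 => h.
  by do ![apply: mulr_ge0 => //]; exact: T20.
rewrite -FTC integral_mkcond; apply: ge0_le_integral => //.
- move=> x _; rewrite patchE; case: ifP => //; rewrite inE /= in_itv /= => /andP[x1 x2].
  by rewrite lee_fin D0.
- apply/(measurable_restrictT _ _).1 => //.
  by apply/measurable_EFinP; apply: measurable_funTS; exact: continuous_measurable_fun.
- apply: emeasurable_funM; first exact: measurable_sphere_int.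
  apply/measurable_EFinP; apply: measurable_funM; first exact: measurable_pos.
  by apply: measurable_funM => //; apply: measurable_funM => //; apply: measurable_funX.
- move=> x _; rewrite patchE; case: ifP; last first.
    by move=> _; rewrite mule_ge0 ?sphere_int_ge0//; exact: W0.
  rewrite inE /= in_itv /= => /andP[x1 x2]; have x0 : 0 < x by apply: lt_le_trans x1.
  apply: (@le_trans _ _ (L%:E * ((0 < x)%R%:R * (N%:R * x ^+ N.-1 * Af (x ^+ 2)))%:E)%E); last first.
    by apply: lee_wpmul2r; [exact: W0|apply: hL; rewrite x1].
  rewrite -EFinM lee_fin x0 mul1r /D /Af.
  have := y1n _ (sqr_ge0 x); have yE : - y1 (x ^+ 2) = k.+1%:R * q ^+ k.+1 * x ^+ (k + k).
    by rewrite /y1 mulNr opprK exprMn -exprM mul2n -addnn exprS; ring.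
  set Y := y1 _ in yE *; set U := T2 _ => Y0.
  have -> : - (L * Kc) * (U * Y * (2 * x)) = (L * U * (- Y) * x) * (Kc * 2) by ring.
  have -> : L * (N%:R * x ^+ N.-1 * (x ^+ 2 * (U * Y ^+ 2))) = (L * U * (- Y) * x) * (N%:R * (x ^+ N.-1 * x) * (- Y)).
    by rewrite expr2; ring.
  have LU : 0 <= L * U * - Y * x.
    apply: mulr_ge0; last exact: ltW.
    by apply: mulr_ge0; [apply: mulr_ge0 => //; exact: T20|rewrite oppr_ge0].
  rewrite ler_wpM2l// -exprSr prednK ?addn_gt0 ?n0// yE /Kc.
  have -> : N%:R * k.+1%:R * q ^+ k.+1 * rho ^+ (N + k + k) / 2 * 2 =
      (N%:R * k.+1%:R * q ^+ k.+1) * rho ^+ (N + k + k) by field.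
  have -> : N%:R * x ^+ N * (k.+1%:R * q ^+ k.+1 * x ^+ (k + k)) =
      (N%:R * k.+1%:R * q ^+ k.+1) * x ^+ (N + k + k).
    have aux (u v w z t : R) : u * v * (w * z * t) = (u * w * z) * (v * t) by ring.
    by rewrite aux -exprD addnA.
  rewrite ler_wpM2l ?mulr_ge0 ?exprn_ge0 ?(ltW q0)//.
  by rewrite lerXn2r ?nnegrE ?(ltW x0) ?(ltW rho0).
Qed.

Lemma JA_bound (rho L : R) : ecball a r `<=` eball a R0 -> 0 < rho -> rho < r -> 0 <= L ->
  (forall x, rho <= x <= r -> (L%:E <= sphere_int F a x)%E) ->
  L * (N%:R * k.+1%:R * q ^+ k.+1 * rho ^+ (N + k + k) / 2) * (1 - c / (1 - (q * rho ^+ 2) ^+ k.+1)) <=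
  k.+1%:R * q * (n%:R + k%:R) * J pw.
Proof.
move=> rR rho0 rhor L0 hL; apply: le_trans (JA_le rR).
apply: le_trans (JA_ge rho0 rhor L0 hL).
rewrite ler_wpM2l; first by [].
  by rewrite !mulr_ge0 ?invr_ge0 ?exprn_ge0 ?(ltW rho0) ?(ltW q0).
have y0 : 0 < y (rho ^+ 2).
  rewrite /y subr_gt0 exprn_ilt1//; first by rewrite mulr_ge0 ?sqr_ge0 ?(ltW q0).
  by rewrite /q ltr_pdivrMl ?exprn_gt0// mulr1 ltrXn2r ?nnegrE ?(ltW rho0) ?(ltW r0).
have := @flat1X_ge (c^-1 * y (rho ^+ 2)).
by rewrite invfM invrK; apply; rewrite mulr_gt0// invr_gt0.
Qed.

End Theta.

(** This is what spherical means decreasing in the radius would give after integration against the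
    weight. Here it comes from the test functions, by letting c tend to 0 and then rho to r; note
    that 2 (n + k) = N + 2 k. *)
Lemma pw_bound (r : R) (k : nat) (L : R) : 0 < r -> r < R0 -> 0 <= L -> (L%:E < sphere_int F a r)%E ->
  L * (N%:R * r ^+ N) <= (N + k + k)%:R * J (pw r k).
Proof.
move=> r0 rR L0 Lr; have [d d0 hd] := sphere_int_lsc r0 rR Lr.
have rE : ecball a r `<=` eball a R0 by move=> z; rewrite /ecball /eball /= => /le_lt_trans; apply.
set q := (r ^+ 2)^-1; have q0 : 0 < q by rewrite invr_gt0 exprn_gt0.
set m := (N + k + k)%N; set Jp := J (pw r k).
have kq : 0 < k.+1%:R * q by rewrite mulr_gt0 ?ltr0n.
have step1 rho : 0 < rho -> r - d < rho -> rho < r ->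
    L * N%:R * q ^+ k * rho ^+ m <= m%:R * Jp.
  move=> rho0 rhod rhor.
  have y0 : 0 < 1 - (q * rho ^+ 2) ^+ k.+1.
    rewrite subr_gt0 exprn_ilt1//; first by rewrite mulr_ge0 ?sqr_ge0 ?(ltW q0).
    by rewrite /q ltr_pdivrMl ?exprn_gt0// mulr1 ltrXn2r ?nnegrE ?(ltW rho0) ?(ltW r0).
  set Kc := N%:R * k.+1%:R * q ^+ k.+1 * rho ^+ m / 2.
  have : L * Kc <= k.+1%:R * q * (n%:R + k%:R) * Jp.
    apply: (@le_limit_small _ _ (L * Kc / (1 - (q * rho ^+ 2) ^+ k.+1)) 1) => // c /andP[c0 _].
    apply: le_trans (@JA_bound r c k r0 c0 rho L rE rho0 rhor L0 _).
      rewrite -/q -/m -/Kc; move: (1 - _) => w.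
      by have -> : L * Kc - c * (L * Kc / w) = L * Kc * (1 - c / w) by ring.
    move=> x /andP[x1 x2]; apply: ltW; apply: hd; rewrite x2 andbT.
    exact: lt_le_trans x1.
  have -> : k.+1%:R * q * (n%:R + k%:R) * Jp = (k.+1%:R * q / 2) * (m%:R * Jp).
    by rewrite /m !natrD; field.
  have -> : L * Kc = (k.+1%:R * q / 2) * (L * N%:R * q ^+ k * rho ^+ m).
    by rewrite /Kc exprS; field.
  have kq2 : 0 < k.+1%:R * q / 2 by rewrite divr_gt0 ?ltr0n.
  by rewrite (ler_pM2l kq2).
have -> : L * (N%:R * r ^+ N) = L * N%:R * q ^+ k * r ^+ m.
  have -> : r ^+ m = r ^+ N * (r ^+ 2) ^+ k by rewrite -exprM mul2n -addnn -exprD addnA.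
  have -> : L * N%:R * q ^+ k * (r ^+ N * (r ^+ 2) ^+ k) = L * (N%:R * r ^+ N) * (q * r ^+ 2) ^+ k.
    by rewrite [(q * _) ^+ k]exprMn; move: (q ^+ k) (r ^+ N) ((r ^+ 2) ^+ k) => x1 x2 x3; ring.
  by rewrite /q mulVf ?expr1n ?mulr1// gt_eqF// exprn_gt0.
set X := L * N%:R * q ^+ k.
have X0 : 0 <= X by rewrite !mulr_ge0 ?exprn_ge0 ?(ltW q0).
apply: (@le_limit_small _ _ (X * r ^+ m * m%:R) (Num.min 1 (d / r))).
  by rewrite lt_min ltr01 divr_gt0.
move=> t /andP[t0]; rewrite lt_min => /andP[t1 td].
apply: le_trans (step1 (r * (1 - t)) _ _ _).
- rewrite -/X exprMn.
  have h := @bernoulli_le t m; have {h} := h _; rewrite (ltW t0) (ltW t1) => /(_ isT) h.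
  have -> : X * r ^+ m - t * (X * r ^+ m * m%:R) = X * r ^+ m * (1 - m%:R * t) by ring.
  by rewrite mulrA ler_wpM2l// mulr_ge0// exprn_ge0// ltW.
- by rewrite mulr_gt0 ?subr_gt0.
- by move: td; rewrite ltr_pdivlMr//; lra.
- by rewrite gtr_pMr//; lra.
Qed.


(** * Mass of the supersolution in balls and shells *)

Definition ind (z : V) (s : R) (t : mC) : R := if enorm (toC t - z) < s then 1 else 0.

Lemma bnd_ind z s : bnd_measurable (ind z s).
Proof.
split.
  apply: measurable_fun_ifT; [|exact: measurable_cst|exact: measurable_cst].
  by apply: measurable_fun_ltr; [exact: measurable_enormC_sub|exact: measurable_cst].
by exists 1 => t; rewrite /ind; case: ifP => _; rewrite ?normr1// normr0.
Qed.

Lemma ind_ge0 z s t : 0 <= ind z s t.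
Proof. by rewrite /ind; case: ifP. Qed.

Lemma integral_pow (s : R) j : 0 < s ->
  (\int[lebR]_(x in `]0%R, s[) (x ^+ j)%:E = (s ^+ j.+1 / j.+1%:R)%:E)%E.
Proof.
move=> s0; have mf (A : set (measurableTypeR R)) : measurable A -> measurable_fun A (fun x : R => (x ^+ j)%:E).
  by move=> mA; apply/measurable_EFinP; apply: measurable_funTS; apply: measurable_funX.
rewrite integral_itv_bndo_bndc ?integral_itv_obnd_cbnd; [|exact: mf|exact: mf].
have dP x : has_deriv (fun x : R => j.+1%:R^-1 * x ^+ j.+1) x (x ^+ j).
  apply: has_deriv_eq; first by apply: has_derivZ; apply: has_derivX; exact: has_deriv_id.
  by rewrite mulr1 mulrA mulVf ?mul1r// pnatr_eq0.
have cD : continuous (fun x : R => x ^+ j) by exact: exprn_continuous.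
rewrite (continuous_FTC2 s0 (continuous_subspaceT cD) (F := fun x : R => j.+1%:R^-1 * x ^+ j.+1)).
- by rewrite expr0n /= mulr0 sube0 mulrC.
- split.
  + by move=> x _; have [] := has_derivP (dP x).
  + by apply: cvg_at_right_filter; exact: has_deriv_continuous (dP 0).
  + by apply: cvg_at_left_filter; exact: has_deriv_continuous (dP s).
- by move=> x _; have [_ ->] := has_derivP (dP x).
Qed.

Lemma pow_ball z s j : 0 < s ->
  (\int[mu]_t (enorm (toC t - z) ^+ j * ind z s t)%:E = (vol * N%:R * s ^+ (N + j) / (N + j)%:R)%:E)%E.
Proof.
move=> s0; pose h (x : R) : R := `|x| ^+ j * (if x < s then 1 else 0).
have h0 x : 0 <= h x by rewrite /h mulr_ge0 ?exprn_ge0//; case: ifP.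
have mh : measurable_fun setT h.
  apply: measurable_funM; first by apply: measurable_funX.
  by apply: measurable_fun_ifT => //; apply: measurable_fun_ltr.
have m1 : measurable_fun setT ((cst 1%E : V -> \bar R) \o toC) by exact: measurable_cst.
transitivity (\int[mu]_t (cst 1%E (toC t) * (h (enorm (toC t - z)))%:E))%E.
  by apply: eq_integral => t _; rewrite mul1e /h /ind ger0_norm ?enorm_ge0.
rewrite (@polar_integral R n (cst 1%E) h z n0 m1 (fun=> lee01) mh h0).
have N0 : (0 < N)%N by rewrite addn_gt0 n0.
have vN : 0 <= vol * N%:R by rewrite mulr_ge0// ltW// vol_gt0.
transitivity ((vol * N%:R)%:E * \int[lebR]_x (((fun x : R => (x ^+ (N + j).-1)%:E) \_ `]0%R, s[) x))%E.
  rewrite -ge0_integral_cstM.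
  - apply: eq_integral => x _; rewrite sphere_int_cst// mul1e patchE /h.
    have [x0|x0] := ltP 0 x; last first.
      rewrite mul0r mule0 memNset ?mule0//= in_itv /= => /andP[]; by rewrite ltNge x0.
    have [xs|xs] := ltP x s; last first.
      rewrite !mulr0 mule0 memNset ?mule0//= in_itv /= => /andP[_]; by rewrite ltNge xs.
    rewrite mem_set/= ?in_itv /= ?x0// -!EFinM mul1r mulr1 (gtr0_norm x0).
    rewrite -(prednK N0) addSn /= exprD; congr EFin.
    by move: (N.-1.+1%:R) => u; ring.
  - apply/(measurable_restrictT _ _).1 => //.
    by apply/measurable_EFinP; apply: measurable_funTS; apply: measurable_funX.
  - move=> x; rewrite patchE; case: ifP => //; rewrite inE /= in_itv /= => /andP[x0 _].
    by rewrite lee_fin exprn_ge0// ltW.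
  - by rewrite lee_fin.
transitivity ((vol * N%:R)%:E * (s ^+ (N + j) / (N + j)%:R)%:E)%E.
  congr (_ * _)%E; rewrite -integral_mkcond integral_pow// prednK//.
  by rewrite addn_gt0 N0.
by rewrite -EFinM mulrA.
Qed.

Lemma int_ind z s : 0 < s -> (\int[mu]_t (ind z s t)%:E = (vol * s ^+ N)%:E)%E.
Proof.
move=> s0; have := pow_ball z 0 s0.
under eq_integral do rewrite expr0 mul1r.
move=> ->; rewrite addn0; congr EFin; field.
by rewrite -natrD pnatr_eq0 addn_eq0 negb_and -!lt0n n0.
Qed.

(** The supermean inequality for solid balls: [mollify_le] with an indicator as kernel. *)
Lemma ind_avg z s Q : 0 < s -> ecball z s `<=` eball a R0 -> (F z < Q%:E)%E ->
  J (ind z s) <= Q * (vol * s ^+ N).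
Proof.
move=> s0 zs FQ; rewrite -lee_fin -(int_F_wint (bnd_ind z s)).
apply: (@le_trans _ _ (F z * (vol * s ^+ N)%:E)%E).
  rewrite -(int_ind z s0).
  apply: (@mollify_le z s (fun x => if x < s then 1 else 0)) => //.
  - by apply: measurable_fun_ifT => //; apply: measurable_fun_ltr.
  - by move=> x; case: ifP.
  - by move=> x /ltW; rewrite leNgt => /negPf ->.
rewrite [X in (_ <= X)%E]EFinM; apply: lee_wpmul2r; last exact: ltW.
by rewrite lee_fin mulr_ge0 ?exprn_ge0// ltW// vol_gt0.
Qed.

Lemma J_ind_mono z s w s' : eball z s `<=` eball w s' -> J (ind z s) <= J (ind w s').
Proof.
move=> h; apply: (J_le (bnd_ind _ _) (bnd_ind _ _)) => t _.
rewrite /ind; case: ifP => [zs|_]; last by case: ifP.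
by rewrite (h _ zs).
Qed.

(** The factor vol s^N is the volume of B(t, s). Exchanging the integrals over points t and centres
    y replaces the mass of [w] by masses of balls of radius s, each at most [X]; averaging takes the
    place of a covering argument. *)
Lemma fubini_shell (w b : mC -> R) s X : 0 < s -> 0 <= X ->
  bnd_measurable w -> (forall t, 0 <= w t) -> measurable_fun setT b -> (forall t, 0 <= b t) ->
  (forall t y, enorm (toC y - toC t) < s -> w t <= b y) ->
  (forall y, b y != 0 -> J (ind (toC y) s) <= X) ->
  ((J w * (vol * s ^+ N))%:E <= X%:E * \int[mu]_y (b y)%:E)%E.
Proof.
move=> s0 X0 bw w0 mb b0 wb bX.
pose I (t y : mC) : R := if enorm (toC y - toC t) < s then 1 else 0.
have I0 t y : 0 <= I t y by rewrite /I; case: ifP.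
have IE t y : I t y = ind (toC t) s y by [].
have IE' t y : I t y = ind (toC y) s t by rewrite /I /ind enormB.
pose H (v : mC * mC) := (F (toC v.1) * (b v.2 * I v.1 v.2)%:E)%E.
have H0 v : (0 <= H v)%E by rewrite mule_ge0// lee_fin mulr_ge0.
have mI : measurable_fun setT (fun v : mC * mC => I v.1 v.2).
  apply: measurable_fun_ifT; [|exact: measurable_cst|exact: measurable_cst].
  apply: measurable_fun_ltr; last exact: measurable_cst.
  apply: measurable_enorm => j.
    rewrite (_ : (fun v => _) = fun v : mC * mC => complex.Re (toC v.2 0 j) - complex.Re (toC v.1 0 j)); last first.
      by apply/funext => v; rewrite !mxE.
    apply: measurable_funB; apply: (measurableT_comp (measurable_ReC j)); [exact: measurable_snd|exact: measurable_fst].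
  rewrite (_ : (fun v => _) = fun v : mC * mC => complex.Im (toC v.2 0 j) - complex.Im (toC v.1 0 j)); last first.
    by apply/funext => v; rewrite !mxE.
  apply: measurable_funB; apply: (measurableT_comp (measurable_ImC j)); [exact: measurable_snd|exact: measurable_fst].
have mH : measurable_fun setT H.
  apply: emeasurable_funM; first exact: (measurableT_comp mF measurable_fst).
  apply/measurable_EFinP; apply: measurable_funM => //.
  exact: (measurableT_comp mb measurable_snd).
have v0 : 0 <= vol * s ^+ N by rewrite mulr_ge0 ?exprn_ge0 ?(ltW s0)// ltW// vol_gt0.
have [mw _] := bw.
apply: (@le_trans _ _ (\int[mu]_t \int[mu]_y H (t, y))%E).
  rewrite EFinM -(int_F_wint bw)// muleC -ge0_integral_cstM.
  - apply: ge0_le_integral => //.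
    + by move=> t _; rewrite mule_ge0 ?lee_fin// mule_ge0 ?lee_fin.
    + by apply: emeasurable_funM => //; apply: emeasurable_funM => //; apply/measurable_EFinP.
    + apply: (eq_measurable_fun (fubini_F mu H)); first by [].
      exact: measurable_fun_fubini_tonelli_F mH H0.
    move=> t _; rewrite /H /= ge0_integral_cstM => //; last 2 first.
    + apply/measurable_EFinP; apply: measurable_funM => //.
      by have [m _] := bnd_ind (toC t) s; exact: m.
    + by move=> y; rewrite lee_fin mulr_ge0.
    rewrite muleCA; apply: lee_wpmul2l => //.
    rewrite -(int_ind (toC t) s0) muleC -ge0_integral_cstM ?lee_fin//; last 2 first.
    + by apply/measurable_EFinP; have [] := bnd_ind (toC t) s.
    + by move=> y; rewrite lee_fin ind_ge0.
    apply: ge0_le_integral => //.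
    + by move=> y _; rewrite mule_ge0 ?lee_fin// ind_ge0.
    + apply: emeasurable_funM => //; apply/measurable_EFinP; by have [] := bnd_ind (toC t) s.
    + apply/measurable_EFinP; apply: measurable_funM => //; by have [m _] := bnd_ind (toC t) s; exact: m.
    move=> y _; rewrite -EFinM lee_fin -IE /I; case: ifP => h; last by rewrite !mulr0.
    by rewrite !mulr1; exact: wb.
  - by apply: emeasurable_funM => //; apply/measurable_EFinP.
  - by move=> t; rewrite mule_ge0 ?lee_fin.
  - by rewrite lee_fin.
rewrite (fubini_tonelli (m1 := mu) (m2 := mu) _ mH H0) -ge0_integral_cstM; last 3 first.
- exact/measurable_EFinP.
- by move=> y; rewrite lee_fin.
- by rewrite lee_fin.
apply: ge0_le_integral => //.
- by move=> y _; apply: integral_ge0 => t _; exact: H0.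
- apply: (eq_measurable_fun (fubini_G mu H)); first by [].
  exact: measurable_fun_fubini_tonelli_G mH H0.
- by apply: emeasurable_funM => //; apply/measurable_EFinP.
move=> y _; have -> : (\int[mu]_t H (t, y) = (b y * J (ind (toC y) s))%:E)%E.
  transitivity (\int[mu]_t ((b y)%:E * (F (toC t) * (ind (toC y) s t)%:E)))%E.
    by apply: eq_integral => t _; rewrite /H /= IE' EFinM muleCA.
  rewrite ge0_integral_cstM; last 3 first.
  - by apply: emeasurable_funM => //; apply/measurable_EFinP; have [] := bnd_ind (toC y) s.
  - by move=> t; rewrite mule_ge0 ?lee_fin ?ind_ge0.
  - by rewrite lee_fin.
  by rewrite (int_F_wint (bnd_ind _ _)) EFinM.
rewrite -EFinM lee_fin mulrC; have [->|by0] := eqVneq (b y) 0; first by rewrite !mulr0.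
by rewrite ler_wpM2r// bX.
Qed.


Lemma bernoulli_mul (t : R) m : 0 <= t <= 1 -> (1 - t) ^+ m * (1 + m%:R * t) <= 1.
Proof.
move=> /andP[t0 t1]; elim: m => [|m IH]; first by rewrite expr0 mul0r addr0 mulr1.
apply: le_trans IH; rewrite exprS [(1 - t) * _]mulrC -mulrA ler_wpM2l ?exprn_ge0 ?subr_ge0//.
have : 0 <= m%:R * t ^+ 2 by rewrite mulr_ge0 ?sqr_ge0.
have : 0 <= t ^+ 2 by exact: sqr_ge0.
by rewrite -natr1 expr2; move: (m%:R) => x; lra.
Qed.

(** Continuity of [Psi] at 1. In the application x is Psi(r^2), so by homogeneity the width [s] does
    not depend on r. *)
Lemma choose_sigma (l d : R) : 0 <= l -> 0 < d ->
  exists2 s : R, 0 < s < 1 / 16 & forall x, 0 <= x -> l * (Psi ((1 - 2 * s) ^+ 2) * x) <= (l + d) * x.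
Proof.
move=> l0 d0; have Psi1 : Psi 1 = 1 by rewrite /Psi powR1.
have e0 : 0 < d / (l + 1) by rewrite divr_gt0// ltr_wpDl.
have := has_deriv_continuous (has_deriv_Psi ltr01) => /cvgrPdist_lt /(_ _ e0) /nbhs_ballP[c /= c0 hc].
pose s := Num.min (1 / 32) (c / 8).
have s0 : 0 < s by rewrite lt_min !divr_gt0.
have s1 : s <= 1 / 32 by rewrite ge_min lexx.
have s2 : s <= c / 8 by rewrite ge_min lexx orbT.
exists s; first by rewrite s0 /=; lra.
move=> x x0; rewrite mulrA ler_wpM2r//.
have : `|Psi 1 - Psi ((1 - 2 * s) ^+ 2)| < d / (l + 1).
  apply: hc; rewrite /ball /= ger0_norm; rewrite expr2; nra.
rewrite Psi1 ltr_norml => /andP[+ _].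
move=> h.
have : l * Psi ((1 - 2 * s) ^+ 2) <= l * (1 + d / (l + 1)).
  by apply: ler_wpM2l => //; lra.
move=> /le_trans; apply; rewrite mulrDr mulr1 lerD2l mulrCA ger_pMr//.
by rewrite ler_pdivrMr ?mul1r ?lerDl// ltr_wpDl.
Qed.

(** By Bernoulli k (1 - s) s^k <= 1. One factor s^k absorbs N + 2k, the other is O(1/k). *)
Lemma choose_k (s A d : R) : 0 < s < 1 -> 0 <= A -> 0 < d ->
  exists k, forall B, 0 <= B <= A -> (N + k + k)%:R * s ^+ (k + k) * B <= d.
Proof.
move=> /andP[s0 s1] A0 d0; pose t := 1 - s; have t0 : 0 < t by rewrite subr_gt0.
have t1 : 0 <= t <= 1 by rewrite (ltW t0) /t lerBlDr lerDl ltW.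
pose B := (N%:R + 2 / t) / t * A.
have B0 : 0 <= B by rewrite mulr_ge0// divr_ge0 ?(ltW t0)// addr_ge0// divr_ge0 ?(ltW t0).
have [k k0' kB] : exists2 k, 0 < k%:R :> R & B / d < k%:R.
  exists (Num.bound (B / d)).+1; first by rewrite ltr0n.
  by apply: lt_trans (archi_boundP (divr_ge0 B0 (ltW d0))) _; rewrite ltr_nat.
exists k => B' /andP[B0' BA].
have sk0 : 0 <= s ^+ k by rewrite exprn_ge0// ltW.
have sk1 : s ^+ k <= 1 by rewrite exprn_ile1// ltW.
have skt : s ^+ k * (k%:R * t) <= 1.
  have := @bernoulli_mul t k t1; rewrite (_ : 1 - t = s); last by rewrite /t; ring.
  by apply: le_trans; rewrite ler_wpM2l// lerDr.
have h1 : s ^+ k <= (k%:R * t)^-1 by rewrite -[leRHS]mul1r ler_pdivlMr// mulr_gt0.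
have h2 : k%:R * s ^+ k <= t^-1.
  by rewrite -[leRHS]mul1r ler_pdivlMr// mulrAC mulrC.
apply: (@le_trans _ _ ((N + k + k)%:R * s ^+ (k + k) * A)).
  by rewrite ler_wpM2l// mulr_ge0// exprn_ge0// ltW.
apply: (@le_trans _ _ ((N%:R + 2 / t) * (k%:R * t)^-1 * A)).
  rewrite ler_wpM2r// exprD mulrA; apply: ler_pM => //; first by rewrite mulr_ge0.
  rewrite [(N + k + k)%:R]natrD [(N + k)%:R]natrD.
  apply: (@le_trans _ _ (N%:R * s ^+ k + 2 * (k%:R * s ^+ k))).
    by move: (N%:R) (k%:R) (s ^+ k) => u v w; lra.
  apply: lerD; last by rewrite ler_wpM2l.
  by rewrite ler_piMr.
have -> : (N%:R + 2 / t) * (k%:R * t)^-1 * A = B / k%:R.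
  by rewrite /B invfM; ring.
by rewrite ler_pdivrMr// mulrC -ler_pdivrMr// ltW.
Qed.

(** Bernoulli gives A <= B (1 - 2 rho)^M, and (1 - 2 rho)(1 + 2 rho) <= 1. *)
Lemma choose_rho (A B s : R) M : 0 <= A -> A < B -> 0 < s ->
  exists2 rho : R, 0 < rho < s & forall j, (j <= M)%N -> A * (1 + 2 * rho) ^+ j <= B.
Proof.
move=> A0 AB s0; have B0 : 0 < B by apply: le_lt_trans AB.
pose rho := Num.min (Num.min (s / 2) (1 / 2)) ((B - A) / (2 * (M%:R + 1) * B)).
have M1 : 0 < M%:R + 1 :> R by rewrite ltr_wpDl.
have BA : 0 < B - A by rewrite subr_gt0.
have r0 : 0 < rho by rewrite !lt_min !divr_gt0// !mulr_gt0.
have r1 : rho <= s / 2 by rewrite !ge_min lexx.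
have r2 : rho <= 1 / 2 by rewrite !ge_min lexx orbT.
have r3 : rho <= (B - A) / (2 * (M%:R + 1) * B) by rewrite !ge_min lexx orbT.
exists rho; first by rewrite r0 /=; lra.
move=> j jM; apply: (@le_trans _ _ (A * (1 + 2 * rho) ^+ M)).
  by rewrite ler_wpM2l// ler_weXn2l//; lra.
have r01 : 0 <= 2 * rho <= 1 by lra.
have AM : A <= B * (1 - 2 * rho) ^+ M.
  apply: (@le_trans _ _ (B * (1 - M%:R * (2 * rho)))); last first.
    by rewrite ler_wpM2l ?(ltW B0)// bernoulli_le.
  move: r3; rewrite ler_pdivlMr; last by rewrite !mulr_gt0.
  have : 0 <= rho * B by rewrite mulr_ge0 ?ltW.
  by rewrite !mulrDr !mulrDl; lra.
apply: (@le_trans _ _ (B * (1 - 2 * rho) ^+ M * (1 + 2 * rho) ^+ M)).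
  by rewrite ler_wpM2r// exprn_ge0//; lra.
rewrite -mulrA -exprMn ger_pMr// exprn_ile1//; have : 0 <= rho ^+ 2 by exact: sqr_ge0.
  by rewrite expr2; nra.
by rewrite expr2; nra.
Qed.

(* [low] is what the absence of a ball of excess amounts to; with the supermean
   inequality it bounds the mass of [F] near the sphere. *)
Section Shell.
Variables (r sg rho A : R) (k : nat).
Hypothesis r0 : 0 < r.
Hypothesis rR : r < R0 / 4.
Hypothesis sg1 : sg < 1 / 16.
Hypothesis rho0 : 0 < rho.
Hypothesis rhosg : rho < sg / 2.
Hypothesis A0 : 0 <= A.
Hypothesis low : forall y : V, (1 - sg - rho) * r <= enorm (y - a) < (1 + rho) * r ->
  exists2 z, eball y (rho ^+ 2 * r) z & (F z < A%:E)%E.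

Let w t := if (1 - sg) * r <= enorm (toC t - a) then pw r k t else 0.
Let m := (N + k + k)%N.
(** If z is the point given by [low] for y, the ball B(y, rho r) lies in B(z, (rho + rho^2) r),
    whose mass is bounded by the supermean inequality at z. Compared with A vol (rho r)^N only a
    factor (1 + rho)^N is lost. *)
Let X : R := A * (vol * ((rho + rho ^+ 2) * r) ^+ N).

Let e1 : rho ^+ 2 * r <= rho * r.
Proof. by rewrite ler_pM2r// expr2 ger_pMl//; move: rhosg sg1; lra. Qed.
Let e2 : rho * r <= sg / 2 * r. Proof. by rewrite ler_pM2r// ltW. Qed.
Let e3 : sg * r <= 1 / 16 * r. Proof. by rewrite ler_pM2r// ltW. Qed.
Let r1r : 0 < (1 + rho) * r. Proof. by rewrite mulr_gt0// ltr_wpDl// ltW. Qed.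
Let c0 : 0 <= (1 + 2 * rho) / r.
Proof. by rewrite divr_ge0 ?(ltW r0)// addr_ge0// mulr_ge0// ltW. Qed.

Lemma shell_ge0 t : 0 <= w t. Proof. by rewrite /w; case: ifP => // _; exact: pw_ge0. Qed.

Lemma bnd_shell : bnd_measurable w.
Proof.
have [mp [C pC]] := bnd_pw k r0; split.
  apply: measurable_fun_ifT; [|exact: mp|exact: measurable_cst].
  by apply: measurable_fun_ler; [exact: measurable_cst|exact: measurable_enormC_sub].
exists C => t; rewrite /w; case: ifP => _; first exact: pC.
by rewrite normr0; apply: le_trans (pC t).
Qed.

Let qE x : ((r ^+ 2)^-1 * x ^+ 2) ^+ k = (x / r) ^+ (k + k).
Proof. by rewrite -exprVn -exprMn -exprM mul2n -addnn mulrC. Qed.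

Lemma pw_split : J (pw r k) <= (1 - sg) ^+ (k + k) * J (ind a r) + J w.
Proof.
have bi := bnd_measurableZ ((1 - sg) ^+ (k + k)) (bnd_ind a r).
have sg01 : 0 <= 1 - sg by move: sg1; lra.
have sk : 0 <= (1 - sg) ^+ (k + k) by exact: exprn_ge0.
rewrite -(JZ _ (bnd_ind _ _)) -(JD bi bnd_shell).
apply: (J_le (bnd_pw k r0) (bnd_measurableD bi bnd_shell)) => t _.
rewrite /w; case: ifPn => h; first by rewrite lerDr mulr_ge0// ind_ge0.
rewrite addr0 /pw /ind; case: ifP => _; last by rewrite mulr0.
rewrite mulr1 -sqr_enorm qE lerXn2r ?nnegrE ?divr_ge0 ?enorm_ge0 ?(ltW r0)//.
by rewrite ler_pdivrMr//; move: h; rewrite -ltNge => /ltW.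
Qed.

Let bX y : (1 - sg - rho) * r <= enorm (y - a) < (1 + rho) * r -> J (ind y (rho * r)) <= X.
Proof.
move=> hy; have [z zy Fz] := low hy; move: hy => /andP[y1 y2].
apply: le_trans (J_ind_mono (w := z) (s' := (rho + rho ^+ 2) * r) _) _.
  move=> x; rewrite /eball /= => xa; apply: le_lt_trans (ler_enorm_dist _ y _) _.
  by rewrite mulrDl ltrD// enormB.
apply: ind_avg => //; first by rewrite mulr_gt0// addr_gt0// exprn_gt0.
move=> x; rewrite /ecball /eball /= => xa; apply: le_lt_trans (ler_enorm_dist _ z _) _.
have := ler_enorm_dist z y a; move: zy xa y2; rewrite /eball /=.
move: (enorm _) (enorm _) (enorm _) (enorm _) e1 e2 e3 rR r0 => u1 u2 u3 u4; lra.
Qed.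

(** Majorizes [w] at all points within rho r: on the shell enlarged by rho r, such a displacement
    changes |z - a| >= r/2 by a factor at most 1 + 2 rho. *)
Let b (t : mC) := if (1 - sg - rho) * r <= enorm (toC t - a) then
  ((1 + 2 * rho) / r) ^+ (k + k) * (enorm (toC t - a) ^+ (k + k) * ind a ((1 + rho) * r) t) else 0.

Let b0' t : 0 <= ((1 + 2 * rho) / r) ^+ (k + k) * (enorm (toC t - a) ^+ (k + k) * ind a ((1 + rho) * r) t).
Proof. by rewrite !mulr_ge0 ?exprn_ge0 ?enorm_ge0 ?ind_ge0. Qed.

Let b0 t : 0 <= b t. Proof. by rewrite /b; case: ifP => // _; exact: b0'. Qed.

Let mb' : measurable_fun setT (fun t => ((1 + 2 * rho) / r) ^+ (k + k) *
    (enorm (toC t - a) ^+ (k + k) * ind a ((1 + rho) * r) t)).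
Proof.
apply: measurable_funM; first exact: measurable_cst.
apply: measurable_funM; last by have [] := bnd_ind a ((1 + rho) * r).
by apply: measurable_funX; exact: measurable_enormC_sub.
Qed.

Let mb : measurable_fun setT b.
Proof.
apply: measurable_fun_ifT; [|exact: mb'|exact: measurable_cst].
by apply: measurable_fun_ler; [exact: measurable_cst|exact: measurable_enormC_sub].
Qed.

Let shell_dist (u v q : R) : q < rho * r -> u <= q + v -> v <= q + u -> (1 - sg) * r <= u -> u < r ->
  (1 - sg - rho) * r <= v < (1 + rho) * r /\ u <= (1 + 2 * rho) * v.
Proof.
move=> qr uv vu u1 u2; have v2 : r / 2 <= v by move: r0 e2 e3; lra.
have := ler_wpM2l (ltW rho0) v2.
by move: r0; split; [apply/andP; split|]; lra.
Qed.

Let wb t y : enorm (toC y - toC t) < rho * r -> w t <= b y.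
Proof.
move=> yt; rewrite /w; case: ifP => [h1|_]; last exact: b0.
rewrite /pw; case: ifP => [h2|_]; last exact: b0.
have t1 := ler_enorm_dist (toC y) (toC t) a.
have t2 := ler_enorm_dist (toC t) (toC y) a.
rewrite [enorm (toC t - toC y)]enormB in t2; have [/andP[y1 y2] y3] := shell_dist yt t2 t1 h1 h2.
have q1 : 0 <= enorm (toC t - a) / r by rewrite divr_ge0 ?enorm_ge0 ?(ltW r0).
have q2 : 0 <= (1 + 2 * rho) / r * enorm (toC y - a) by rewrite mulr_ge0 ?enorm_ge0.
rewrite /b y1 /ind y2 mulr1 -exprMn -sqr_enorm qE lerXn2r ?nnegrE//.
by rewrite [leRHS]mulrAC ler_pM2r ?invr_gt0.
Qed.

Let bX' y : b y != 0 -> J (ind (toC y) (rho * r)) <= X.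
Proof.
rewrite /b /ind; case: ifP => [h1|_]; last by rewrite eqxx.
case: ifP => [h2 _|_]; last by rewrite !mulr0 eqxx.
by apply: bX; rewrite h1 h2.
Qed.

Let intb : (\int[mu]_y (b y)%:E <= (((1 + 2 * rho) / r) ^+ (k + k) *
    (vol * N%:R * ((1 + rho) * r) ^+ m / m%:R))%:E)%E.
Proof.
rewrite EFinM /m -addnA -(pow_ball a (k + k) r1r) -ge0_integral_cstM; last 3 first.
- apply/measurable_EFinP; apply: measurable_funM; last by have [] := bnd_ind a ((1 + rho) * r).
  by apply: measurable_funX; exact: measurable_enormC_sub.
- by move=> t; rewrite lee_fin mulr_ge0 ?exprn_ge0 ?enorm_ge0 ?ind_ge0.
- by rewrite lee_fin exprn_ge0.
apply: ge0_le_integral => //.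
- by move=> t _; rewrite lee_fin b0.
- exact/measurable_EFinP.
- apply: (eq_measurable_fun (fun t => (((1 + 2 * rho) / r) ^+ (k + k) *
    (enorm (toC t - a) ^+ (k + k) * ind a ((1 + rho) * r) t))%:E)) => //.
  exact/measurable_EFinP.
- move=> t _; rewrite -EFinM lee_fin /b; case: ifP => // _; exact: b0'.
Qed.

(** The losses are 1 + rho to the power N + m and 1 + 2 rho to the power 2k. Since N + m + 2k = 2m,
    they are absorbed by (1 + 2 rho)^(2m). *)
Lemma shell_bound : m%:R * J w <= A * (1 + 2 * rho) ^+ (m + m) * (vol * N%:R * r ^+ N).
Proof.
have v0 := ltW (vol_gt0 R n).
have m0 : 0 < m%:R :> R by rewrite ltr0n /m -addnA addn_gt0 addn_gt0 n0.
have X0 : 0 <= X.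
  by rewrite !mulr_ge0// exprn_ge0// mulr_ge0 ?(ltW r0)// addr_ge0 ?exprn_ge0// ltW.
have rhor : 0 < rho * r by rewrite mulr_gt0.
have := fubini_shell rhor X0 bnd_shell shell_ge0 mb b0 wb bX'.
have X0' : (0 <= X%:E)%E by rewrite lee_fin.
move=> /le_trans /(_ (lee_wpmul2l X0' intb)); rewrite -EFinM lee_fin => hJw.
have rhoN : 0 < vol * (rho * r) ^+ N by rewrite mulr_gt0 ?vol_gt0// exprn_gt0.
rewrite -(ler_pM2r rhoN) -[m%:R * J w * _]mulrA.
apply: (le_trans (ler_wpM2l (ltW m0) hJw)).
have -> : m%:R * (X * (((1 + 2 * rho) / r) ^+ (k + k) * (vol * N%:R * ((1 + rho) * r) ^+ m / m%:R))) =
    (A * ((1 + rho) ^+ (N + m) * (1 + 2 * rho) ^+ (k + k))) *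
      (vol * N%:R * r ^+ N * (vol * (rho * r) ^+ N)).
  rewrite /X; have -> : (rho + rho ^+ 2) * r = (1 + rho) * (rho * r) by ring.
  rewrite [((1 + rho) * (rho * r)) ^+ N]exprMn [((1 + rho) * r) ^+ m]exprMn.
  rewrite [(1 + rho) ^+ (N + m)]exprD [(_ / r) ^+ (k + k)]exprMn.
  have -> : r ^+ m = r ^+ N * r ^+ (k + k) by rewrite -exprD addnA.
  rewrite exprVn; have rk : r ^+ (k + k) != 0 by rewrite expf_neq0// gt_eqF.
  move: (r ^+ (k + k)) rk ((1 + rho) ^+ N) ((1 + rho) ^+ m) ((1 + 2 * rho) ^+ (k + k)) ((rho * r) ^+ N) (r ^+ N) (N%:R) (m%:R) m0.
  move=> u1 u1n u2 u3 u4 u5 u6 u7 u8 u80; field.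
  by rewrite u1n gt_eqF.
rewrite -[leRHS]mulrA ler_wpM2r//.
  by rewrite !mulr_ge0// exprn_ge0// ?(ltW r0)// ltW.
rewrite ler_wpM2l//.
have -> : (m + m = (N + m) + (k + k))%N by rewrite {1}/m -(addnA N) addnAC.
have rho1 : 0 <= 1 + rho by rewrite addr_ge0// ltW.
have rho2 : 1 + rho <= 1 + 2 * rho by rewrite lerD2l ler_peMl ?(ltW rho0)// ler1n.
rewrite [leRHS]exprD ler_wpM2r ?exprn_ge0//; first exact: le_trans rho2.
by rewrite lerXn2r ?nnegrE//; exact: le_trans rho2.
Qed.

End Shell.

(** Without such a ball, every small ball near the sphere contains a point where F < (l + d/2)
    Psi(r^2). In units of Psi(r^2) vol r^N the shell then contributes at most (l + d) N and the
    inner ball at most d/2, while [pw_bound] demands (l + 2d) N. The constants are chosen in the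
    order sg, k, rho, before r. *)
Lemma fat_ball (l d : R) : 0 <= l -> 0 < d ->
  (exists2 r1, 0 < r1 & forall r, 0 < r < r1 ->
    exists2 z, eball a r z & (F z < ((l + 1) * Psi (r ^+ 2))%:E)%E) ->
  exists rho r2, [/\ 0 < rho < 1 / 16, 0 < r2 & forall r, 0 < r < r2 ->
    (((l + 2 * d) * Psi (r ^+ 2) * vol)%:E < sphere_int F a r)%E ->
    exists2 y : V, 7 / 8 * r <= enorm (y - a) <= 9 / 8 * r &
    forall z, eball y (rho * r) z -> ((l * Psi (sqnorm (z - a)) + d / 4 * Psi (r ^+ 2))%:E <= F z)%E].
Proof.
move=> l0 d0 [r1 r10 hr1].
have d4 : 0 < d / 4 by rewrite divr_gt0.
have [sg /andP[sg0 sg1] hsg] := choose_sigma l0 d4.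
(* Bounds the mass of B(a, r) in units of Psi(r^2) vol r^N: this ball lies in the ball of radius 5/4
   r about a point of B(a, r/4) where F < (l + 1) Psi(r^2 / 16). *)
have [D1 D10 hD1] : exists2 D1, 0 <= D1 & forall x y,
    (l + 1) * (Psi (1 / 16) * x) * (vol * (5 / 4 * y) ^+ N) = D1 * x * vol * y ^+ N.
  exists ((l + 1) * Psi (1 / 16) * (5 / 4) ^+ N) => [|x y]; last first.
    by rewrite exprMn; move: (y ^+ N) ((5 / 4) ^+ N) (vol) => u1 u2 u3; ring.
  by rewrite !mulr_ge0 ?exprn_ge0 ?addr_ge0// ltW// Psi_gt0// divr_gt0.
have s01 : 0 < 1 - sg < 1 by lra.
have d2 : 0 < d / 2 by rewrite divr_gt0.
have [k hk] := choose_k s01 D10 d2.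
have l2 : 0 <= l + d / 2 by lra.
have l3 : l + d / 2 < l + d by lra.
have sg2 : 0 < sg / 2 by rewrite divr_gt0.
have [rho /andP[rho0 rho1] hrho] := choose_rho ((N + k + k) + (N + k + k)) l2 l3 sg2.
have rr0 : 0 < rho ^+ 2 by rewrite exprn_gt0.
have rr1 : rho ^+ 2 <= rho by rewrite expr2 ger_pMl//; lra.
(* The ball of excess has radius rho^2 r, small against the averaging radius rho r, so that
   recentring at a point of low value costs little. *)
exists (rho ^+ 2), (Num.min r1 (R0 / 4)); split.
- by rewrite rr0 /=; lra.
- by rewrite lt_min r10 divr_gt0.
move=> r /andP[r0]; rewrite lt_min => /andP[rr1' rR] hL.
have PsiS x : 0 <= x -> Psi ((x * r) ^+ 2) = Psi (x ^+ 2) * Psi (r ^+ 2).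
  by move=> x0; rewrite exprMn PsiM ?sqr_ge0.
have P0 : 0 < Psi (r ^+ 2) by apply: Psi_gt0; exact: exprn_gt0.
move: (Psi (r ^+ 2)) PsiS P0 hL => P PsiS P0 hL.
have e1 : rho ^+ 2 * r <= rho * r by rewrite ler_pM2r.
have e2 : rho * r <= sg / 2 * r by rewrite ler_pM2r// ltW.
have e3 : sg * r <= 1 / 16 * r by rewrite ler_pM2r// ltW.
apply: contrapT => nex.
have A0 : 0 <= (l + d / 2) * P by rewrite mulr_ge0// ltW.
have low y : (1 - sg - rho) * r <= enorm (y - a) < (1 + rho) * r ->
    exists2 z, eball y (rho ^+ 2 * r) z & (F z < ((l + d / 2) * P)%:E)%E.
  move=> /andP[y1 y2]; apply: contrapT => nz; apply: nex; exists y.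
    by apply/andP; split; [move: y1|move: y2]; lra.
  move=> z yz; apply: (@le_trans _ _ ((l + d / 2) * P)%:E); last first.
    by rewrite leNgt; apply/negP => Fz; apply: nz; exists z.
  rewrite lee_fin.
  have z1 : (1 - 2 * sg) * r <= enorm (z - a).
    have := ler_enorm_dist y z a; move: yz; rewrite /eball /= [enorm (z - y)]enormB.
    by lra.
  have sr0 : 0 < (1 - 2 * sg) * r by rewrite mulr_gt0//; lra.
  have : Psi (sqnorm (z - a)) <= Psi ((1 - 2 * sg) ^+ 2) * P.
    rewrite -PsiS; last by lra.
    apply: Psi_le; first exact: exprn_gt0.
    by rewrite -sqr_enorm lerXn2r ?nnegrE ?(ltW sr0) ?enorm_ge0.
  move=> /(ler_wpM2l l0) /le_trans /(_ (hsg P (ltW P0))).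
  by move: (l * Psi _) => q; lra.
have JaR : J (ind a r) <= D1 * P * vol * r ^+ N.
  have r4 : 0 < r / 4 < r1 by rewrite divr_gt0//=; lra.
  have [z1 z1a Fz1] := hr1 _ r4.
  have z1R : ecball z1 (5 / 4 * r) `<=` eball a R0.
    move=> x; rewrite /ecball /eball /= => xz; apply: le_lt_trans (ler_enorm_dist _ z1 _) _.
    by move: z1a; rewrite /eball /=; lra.
  have r54 : 0 < 5 / 4 * r by rewrite mulr_gt0.
  apply: le_trans (J_ind_mono (w := z1) (s' := 5 / 4 * r) _) _.
    move=> x; rewrite /eball /= => xa; apply: le_lt_trans (ler_enorm_dist _ a _) _.
    by move: z1a; rewrite /eball /= [enorm (z1 - a)]enormB; lra.
  apply: le_trans (ind_avg r54 z1R Fz1) _.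
  have -> : r / 4 = 1 / 4 * r by ring.
  by rewrite PsiS// (_ : (1 / 4) ^+ 2 = 1 / 16 :> R) ?hD1//; field.
have hw := shell_bound k r0 rR sg1 rho0 rho1 A0 low.
have hs := pw_split k r0 sg1.
have rR0 : r < R0 by lra.
have L0 : 0 <= (l + 2 * d) * P * vol.
  by rewrite !mulr_ge0 ?(ltW P0) ?(ltW (vol_gt0 R n))// addr_ge0// mulr_ge0// ltW.
have hb := pw_bound k r0 rR0 L0 hL.
have Y0 : 0 < P * vol * r ^+ N by rewrite !mulr_gt0 ?vol_gt0// exprn_gt0.
have N2 : 2 <= N%:R :> R by rewrite (ler_nat _ 2) addnn -mul2n leq_pmulr.
have m0 : 0 <= (N + k + k)%:R :> R by [].
have sk : 0 <= (1 - sg) ^+ (k + k) by apply: exprn_ge0; case/andP: s01 => /ltW.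
have D11 : 0 <= D1 <= D1 by rewrite D10 lexx.
have h2 := ler_wpM2r (ltW Y0) (hk _ D11).
have h3 := ler_wpM2l (mulr_ge0 m0 sk) JaR.
have h4 := ler_wpM2l (mulr_ge0 (ltW Y0) (ler0n R N)) (hrho _ (leqnn _)).
move: hb (ler_wpM2l m0 hs) hw h2 h3 h4 Y0 N2; clear hk hrho hs hsg sk m0 L0 JaR low.
move: (J (ind a r)) (J (pw r k)) (J _) ((1 - sg) ^+ (k + k)) ((1 + 2 * rho) ^+ _) (r ^+ N) (N%:R) ((N + k + k)%:R) (vol).
move=> Ja Jp Jw S T rN Nn M v hb hs hw h2 h3 h4 Y0 N2.
have dY : 0 < d * (P * v * rN) by rewrite mulr_gt0.
have dYN := ler_wpM2l (ltW dY) N2.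
move: hb hs hw h2 h3 h4 dY dYN; lra.
Qed.

(** * Propagation of an excess *)

Section Propagation.
Variable l : R.
Hypothesis Fl : forall z, 0 < enorm (z - a) < R1 ->
  ((l * (Psi (sqnorm (z - a)) - Psi (R1 ^+ 2)))%:E <= F z)%E.

Let base z := l * (Psi (sqnorm (z - a)) - Psi (R1 ^+ 2)).

Let SDlim_base z : z != a -> SDlim p k0 ((enorm (z - a))^-1%:C *: (z - a)) base z 0.
Proof.
move=> za; rewrite (_ : base = fun w => l * Psi (sqnorm (w - a)) + - (l * Psi (R1 ^+ 2))); last first.
  by apply/funext => w; rewrite /base; ring.
have := SDlim_add (SDlim_scale l (SDlim_Psi za))
  (SDlim_cst p k0 ((enorm (z - a))^-1%:C *: (z - a)) (- (l * Psi (R1 ^+ 2))) z).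
by rewrite mulr0 addr0.
Qed.

Let continuous_base z : z != a -> {for z, continuous base}.
Proof.
move=> za; have s0 : 0 < sqnorm (z - a) by rewrite -sqr_enorm exprn_gt0// enorm_gt0 subr_eq0.
apply: (@continuous_sqnorm_comp a z (fun s => l * (Psi s - Psi (R1 ^+ 2)))).
apply: has_deriv_continuous; apply: has_derivZ; apply: has_derivD; last exact: has_deriv_cst.
exact: has_deriv_Psi.
Qed.

Lemma has_deriv_expZ (u s : R) : has_deriv (fun s => expR (u * s)) s (u * expR (u * s)).
Proof.
rewrite mulrC; apply: has_deriv_comp; first exact: is_derive_expR.
by apply: has_deriv_eq; first apply: has_derivZ; [exact: has_deriv_id|rewrite mulr1].
Qed.

(** The k0 term containing the second derivative is nonnegative and is dropped, so the bound holds
    in every direction. It thus applies in the direction radial with respect to [a], imposed by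
    [base], although the Gaussian is centred at [y]. *)
Lemma SDlim_gaussian (e y z : V) (u : R) : sqnorm e = 1 -> 0 <= u ->
  exists2 b, u * (p * (u * sqnorm (z - y)) - (p * n%:R + k0)) * expR (- u * sqnorm (z - y)) <= b &
    SDlim p k0 e (fun w => expR (- u * sqnorm (w - y))) z (4 * b).
Proof.
move=> e1 u0; exists (hopr p k0 e (- u * expR (- u * sqnorm (z - y)))
    (- u * (- u * expR (- u * sqnorm (z - y)))) (z - y)); last first.
  apply: (SDlim_radial (ltW p0) k00 e1 (G := fun s => expR (- u * s)) (G1 := fun s => - u * expR (- u * s))).
    by near=> s; exact: has_deriv_expZ.
  by apply: has_derivZ; exact: has_deriv_expZ.
rewrite /hopr; set G := expR _; set s := sqnorm _; set q := _ + _ ^+ 2.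
have q0 : 0 <= k0 * (u * u * G) * q.
  by rewrite !mulr_ge0 ?expR_ge0// addr_ge0// sqr_ge0.
move: q0; move: q => q q0.
have -> : p * (n%:R * (- u * G) + s * (- u * (- u * G))) + k0 * (- u * G + - u * (- u * G) * q) =
  u * (p * (u * s) - (p * n%:R + k0)) * G + k0 * (u * u * G) * q by ring.
by rewrite lerDl.
Unshelve. all: end_near. Qed.

(* A Hopf-type lemma: the barrier [exp (- k |z - y|^2 / r^2)] is a strict subsolution away from [y]. *)
Lemma hopf_step (rho : R) : 0 < rho < 1 / 8 -> exists2 c, 0 < c <= 1 & forall b r y, 0 < b -> 0 < r -> 2 * r < R1 ->
  1 / 2 * r <= enorm (y - a) <= 3 / 2 * r ->
  (forall z, eball y (rho * r) z -> ((base z + b)%:E <= F z)%E) ->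
  forall z, eball y (1 / 8 * r) z -> ((base z + c * b)%:E <= F z)%E.
Proof.
move=> /andP[rho0 rho1].
pose Q := p * n%:R + k0; have Q0 : 0 <= Q by rewrite addr_ge0// mulr_ge0// ltW.
pose s1 := rho / 2; have s10 : 0 < s1 by rewrite divr_gt0.
(* With u = kp / r^2 this gives p u |w - y|^2 >= Q + 1 at distance at least s1 r, so the Gaussian is
   strictly positive under every D_e there. As s1 < rho, the inner sphere lies in the ball of
   excess. *)
pose kp := (Q + 1) / (p * s1 ^+ 2).
have kp0 : 0 < kp by rewrite divr_gt0 ?mulr_gt0 ?exprn_gt0// ltr_wpDl.
have kpQ : p * (kp * s1 ^+ 2) = Q + 1.
  by rewrite mulrCA /kp -mulrA mulVf ?mulr1// gt_eqF// mulr_gt0// exprn_gt0.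
move: (kp) kp0 kpQ => {}kp kp0 kpQ.
(* The drop of the Gaussian between the distances r/8, where the conclusion is wanted, and r/4,
   where the barrier must fall back below [base]. *)
pose c := expR (- (kp / 64)) - expR (- (kp / 16)).
have c0 : 0 < c by rewrite subr_gt0 ltr_expR; lra.
have c1 : c <= 1.
  have h1 : expR (- (kp / 64)) <= 1 by rewrite -[leRHS]expR0 ler_expR; lra.
  by rewrite lerBlDr; apply: le_trans h1 _; rewrite lerDl expR_ge0.
exists c; first by rewrite c0.
move=> b r y b0 r0 rR /andP[yl yu] hb z zr.
have [zl|zl] := ltP (enorm (z - y)) (s1 * r).
  have zb : eball y (rho * r) z.
    by apply: lt_le_trans zl _; rewrite ler_pM2r// /s1; lra.
  by apply: le_trans (hb z zb); rewrite lee_fin lerD2l ger_pMl.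
have yd w : enorm (w - y) <= 1 / 4 * r -> 0 < enorm (w - a) < R1.
  move=> wy; have h1 := ler_enorm_dist w y a; have h2 := ler_enorm_dist y w a.
  move: h2; rewrite [enorm (y - w)]enormB => h2; apply/andP; split; lra.
have wna w : enorm (w - y) <= 1 / 4 * r -> w != a.
  by move=> /yd /andP[+ _]; rewrite enorm_gt0 subr_eq0.
apply: (@le_limit_scale _ _ 1) => tau tau0.
pose u := kp / r ^+ 2; have u0 : 0 < u by rewrite divr_gt0// exprn_gt0.
pose H w := (base w + b * expR (- u * sqnorm (w - y))) + (- (b * expR (- (kp / 16)) + tau)).
have ur q : u * (q * r) ^+ 2 = kp * q ^+ 2.
  by rewrite /u; field; rewrite gt_eqF.
apply: le_trans (_ : (H z)%:E <= _)%E.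
  rewrite lee_fin /H.
  have : c * b <= b * expR (- u * sqnorm (z - y)) - b * expR (- (kp / 16)).
    rewrite /c mulrBl [_ * b]mulrC [X in _ - X]mulrC lerD2r ler_pM2l// ler_expR mulNr lerN2.
    apply: le_trans (_ : u * (1 / 8 * r) ^+ 2 <= _).
      by rewrite ler_pM2l// -sqr_enorm lerXn2r ?nnegrE ?enorm_ge0 ?ltW// mulr_gt0.
    by rewrite ur expr2; lra.
  by lra.
have s1r0 : 0 < s1 * r by exact: mulr_gt0.
apply: (@comparison (ecball y (1 / 4 * r) `&` ~` eball y (s1 * r)) (eball y (1 / 4 * r) `&` ~` ecball y (s1 * r)) H).
- apply: compact_closedI; first exact: compact_ecball.
  by apply: open_closedC; apply: open_eball.
- by move=> w [/yd /andP[_ wR] _]; apply: lt_trans wR R1R0.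
- move=> w [+ +]; rewrite /ecball /eball /= => h1 h2; split; first exact: ltW.
  by rewrite /= => h3; apply: h2; rewrite ltW.
- apply: openI; first exact: open_eball.
  by apply: closed_openC; apply: closed_ecball.
- move=> w [wy _].
  have cg : {for w, continuous (fun w : V => expR (- u * sqnorm (w - y)))}.
    apply: (@continuous_sqnorm_comp y w (fun s => expR (- u * s))).
    exact: has_deriv_continuous (has_deriv_expZ _ _).
  apply: (cvgD (cvgD (continuous_base (wna w wy)) _) (@cst_continuous _ _ _ w)).
  exact: (cvgM (@cst_continuous _ _ b w) cg).
- move=> w [wy +] nU; rewrite /eball /= => /negP; rewrite -leNgt => wl.
  have [wE|wE] := eqVneq (enorm (w - y)) (s1 * r).
    apply: lt_le_trans (hb w _).
      rewrite lte_fin /H -addrA ltrD2l.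
      have : b * expR (- u * sqnorm (w - y)) <= b.
        by rewrite ger_pMr// -expR0 ler_expR mulNr oppr_le0 mulr_ge0 ?sqnorm_ge0// ltW.
      have : 0 < b * expR (- (kp / 16)) by rewrite mulr_gt0// expR_gt0.
      by lra.
    by rewrite /eball /= wE ltr_pM2r// /s1; lra.
  have wE' : enorm (w - y) = 1 / 4 * r.
    apply/eqP; rewrite eq_le; move: wy; rewrite /ecball /= => wy; rewrite wy /= leNgt; apply/negP => wr'.
    by apply: nU; split => //=; apply/negP; rewrite -ltNge lt_neqAle eq_sym wE.
  apply: lt_le_trans (Fl (yd w wy)); rewrite lte_fin /H -/(base w).
  rewrite -sqr_enorm wE' mulNr ur (_ : kp * (1 / 4) ^+ 2 = kp / 16); last by rewrite expr2; field.
  by lra.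
- move=> w [wr]; rewrite /ecball /= => /negP; rewrite -ltNge => dw.
  have wa : w != a by apply: wna; apply: ltW.
  have e1 : sqnorm ((enorm (w - a))^-1%:C *: (w - a)) = 1 by rewrite sqnorm_unit// subr_eq0.
  exists ((enorm (w - a))^-1%:C *: (w - a)) => //.
  have [v hv hv'] := @SDlim_gaussian _ y w u e1 (ltW u0).
  have h3 := SDlim_add (SDlim_add (SDlim_base wa) (SDlim_scale b hv'))
    (SDlim_cst p k0 ((enorm (w - a))^-1%:C *: (w - a)) (- (b * expR (- (kp / 16)) + tau)) w).
  apply: SDlim_pos h3; rewrite add0r addr0 !mulr_gt0//.
  apply: lt_le_trans hv; apply: mulr_gt0; last exact: expR_gt0.
  apply: mulr_gt0 => //; rewrite subr_gt0 -/Q.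
  apply: lt_le_trans (_ : Q + 1 <= _); first by rewrite ltrDl.
  rewrite -kpQ ler_pM2l// -ur ler_pM2l// -sqr_enorm lerXn2r ?nnegrE ?enorm_ge0// ltW//.
- split; first by apply: le_trans (ltW zr) _; rewrite ler_pM2r//; lra.
  by rewrite /eball /=; apply/negP; rewrite -leNgt.
Qed.



(** The ball of radius r/16 about the next centre lies in the ball of radius r/8 about the current
    one, which [hopf_step] with rho = 1/16 reaches. *)
Lemma hopf_chain : exists2 c, 0 < c <= 1 & forall b r (y : nat -> V) k, 0 < b -> 0 < r -> 2 * r < R1 ->
  (forall i, (i <= k)%N -> 1 / 2 * r <= enorm (y i - a) <= 3 / 2 * r) ->
  (forall i, (i < k)%N -> enorm (y i.+1 - y i) <= 1 / 16 * r) ->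
  (forall z, eball (y 0) (1 / 16 * r) z -> ((base z + b)%:E <= F z)%E) ->
  forall z, eball (y k) (1 / 16 * r) z -> ((base z + c ^+ k * b)%:E <= F z)%E.
Proof.
have s16 : 0 < (1 / 16 : R) < 1 / 8 by lra.
have [c /andP[c0 c1] hc] := hopf_step s16; exists c; first by rewrite c0.
move=> b r y k b0 r0 rR; elim: k => [|k IH] hy hs hb z zk.
  by rewrite expr0 mul1r; exact: hb.
have hk w : eball (y k) (1 / 16 * r) w -> ((base w + c ^+ k * b)%:E <= F w)%E.
  apply: IH => // i ik; [exact/hy/leqW|exact/hs/leqW].
rewrite exprS -mulrA; apply: (hc _ r (y k) _ r0 rR (hy k (leqnSn k)) hk); first by rewrite mulr_gt0// exprn_gt0.
have := ler_enorm_dist z (y k.+1) (y k); have := hs k (ltnSn k).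
move: zk; rewrite /eball /=; move: (enorm _) (enorm _) (enorm _) => u v w; lra.
Qed.

(** An angle that is at most right keeps the segment away from the origin: the squared norm is at
    least ((1-t)^2 + t^2) (7r/8)^2 >= 49 r^2 / 128 > r^2 / 4 for r > 0. *)
Lemma enorm_segment (r t : R) (x y : V) : 0 <= r -> 0 <= t <= 1 -> 0 <= rdot x y ->
  7 / 8 * r <= enorm x <= 9 / 8 * r -> 7 / 8 * r <= enorm y <= 9 / 8 * r ->
  1 / 2 * r <= enorm (x + t%:C *: (y - x)) <= 3 / 2 * r.
Proof.
move=> r0 /andP[t0 t1] xy /andP[xl xu] /andP[yl yu].
have -> : x + t%:C *: (y - x) = (1 - t)%:C *: x + t%:C *: y.
  by rewrite scalerBr CBr scalerBl scale1r addrCA addrC.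
apply/andP; split; last first.
  apply: le_trans (ler_enormD _ _) _; rewrite !enormZ !ger0_norm ?subr_ge0//.
  move: (enorm x) (enorm y) xl xu yl yu => u v xl xu yl yu; nra.
rewrite -(@ler_pXn2r _ 2) ?nnegrE ?enorm_ge0 ?mulr_ge0//.
rewrite sqr_enorm sqnormD !sqnormZ rdotZl rdotZr -!sqr_enorm.
have h1 : 0 <= 2 * ((1 - t) * (t * rdot x y)).
  by rewrite !mulr_ge0 ?subr_ge0.
have h : 0 <= 7 / 8 * r by rewrite mulr_ge0// divr_ge0.
have hx : (7 / 8 * r) ^+ 2 <= enorm x ^+ 2 by rewrite lerXn2r// nnegrE ?enorm_ge0.
have hy : (7 / 8 * r) ^+ 2 <= enorm y ^+ 2 by rewrite lerXn2r// nnegrE ?enorm_ge0.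
have hx' := ler_wpM2l (sqr_ge0 (1 - t)) hx.
have hy' := ler_wpM2l (sqr_ge0 t) hy.
have r2 : 0 <= r ^+ 2 by exact: sqr_ge0.
have t2 : 1 / 2 * r ^+ 2 <= ((1 - t) ^+ 2 + t ^+ 2) * r ^+ 2.
  by rewrite ler_wpM2r//; have := sqr_ge0 (2 * t - 1); rewrite !expr2; lra.
move: hx' hy' h1; rewrite !(exprMn _ _ r).
rewrite [(1 - t) * (t * _)]mulrA; move: (_ * t * rdot x y) => D.
move: (enorm x ^+ 2) (enorm y ^+ 2) ((1 - t) ^+ 2) (t ^+ 2) (r ^+ 2) t2 r2 => X Y T1 T2 S.
rewrite [(7 / 8) ^+ 2]expr2 [(1 / 2) ^+ 2]expr2; lra.
Qed.

Lemma hopf_segment : exists2 c, 0 < c <= 1 & forall b r y z, 0 < b -> 0 < r -> 2 * r < R1 ->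
  7 / 8 * r <= enorm (y - a) <= 9 / 8 * r -> 7 / 8 * r <= enorm (z - a) <= 9 / 8 * r ->
  0 <= rdot (y - a) (z - a) ->
  (forall w, eball y (1 / 16 * r) w -> ((base w + b)%:E <= F w)%E) ->
  forall w, eball z (1 / 16 * r) w -> ((base w + c * b)%:E <= F w)%E.
Proof.
(* The endpoints are at distance at most 9/4 r = 36 (r/16). The number of steps is kept opaque so
   that it is not unfolded. *)
have [K K0 KE] : exists2 K : nat, 0 < (K%:R : R) & (K%:R : R) = 36 by exists 36%N.
have [c /andP[c0 c1] hc] := hopf_chain; exists (c ^+ K); first by rewrite exprn_gt0//= exprn_ile1// ltW.
move=> b r y z b0 r0 rR ya za yz hb w wz.
pose x i : V := y + (i%:R / K%:R)%:C *: (z - y).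
have xK : x K = z by rewrite /x divff ?gt_eqF// scale1r addrC subrK.
have x0 : x 0%N = y by rewrite /x mul0r scale0r addr0.
have h1 i : (i <= K)%N -> 1 / 2 * r <= enorm (x i - a) <= 3 / 2 * r.
  move=> iK; have -> : x i - a = (y - a) + (i%:R / K%:R)%:C *: ((z - a) - (y - a)).
    by rewrite /x addrAC; congr (_ + _ *: _); rewrite opprB addrA subrK.
  apply: enorm_segment => //; first exact: ltW.
  by rewrite divr_ge0//= ler_pdivrMr// mul1r ler_nat.
have h2 i : (i < K)%N -> enorm (x i.+1 - x i) <= 1 / 16 * r.
  move=> _; have -> : x i.+1 - x i = (K%:R^-1)%:C *: (z - y).
    rewrite /x opprD addrACA subrr add0r -scalerBl -CBr; congr (_%:C *: _).
    by rewrite -natr1 mulrDl mul1r addrAC subrr add0r.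
  rewrite enormZ ger0_norm ?invr_ge0// mulrC ler_pdivrMr// KE.
  have := ler_enorm_dist z a y; rewrite [enorm (a - y)]enormB => /le_trans; apply.
  have [/andP[_ yu] /andP[_ zu]] := (ya, za).
  by apply: le_trans (lerD zu yu) _; rewrite -mulrDl mulrAC ler_pM2r//; lra.
by rewrite -xK in wz; apply: (hc b r x K b0 r0 rR h1 h2 _ w wz) => v; rewrite x0; exact: hb.
Qed.

(** A segment joining opposite points would meet [a]. The path goes instead through a + i (y - a) or
    a - i (y - a): i (y - a) is orthogonal to y - a, and the sign makes the second angle at most
    right. *)
Lemma hopf_sphere (rho : R) : 0 < rho < 1 / 8 -> exists2 c, 0 < c & forall b r y, 0 < b -> 0 < r -> 2 * r < R1 ->
  7 / 8 * r <= enorm (y - a) <= 9 / 8 * r ->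
  (forall z, eball y (rho * r) z -> ((base z + b)%:E <= F z)%E) ->
  forall z, enorm (z - a) = r -> ((base z + c * b)%:E <= F z)%E.
Proof.
move=> rhoP; have [c1 /andP[c10 _] h1] := hopf_step rhoP.
have [c2 /andP[c20 _] h2] := hopf_segment.
exists (c2 * (c2 * c1)); first by rewrite !mulr_gt0.
move=> b r y b0 r0 rR yr hb z za.
have ha : forall w, eball y (1 / 16 * r) w -> ((base w + c1 * b)%:E <= F w)%E.
  move=> w wy; apply: (h1 b r y b0 r0 rR _ hb).
    by move: yr; lra.
  by apply: lt_le_trans wy _; rewrite ler_pM2r//; lra.
have [sg sgE sgz] : exists2 sg : R, `|sg| = 1 & 0 <= rdot (sg%:C *: ('i *: (y - a))) (z - a).
  have hsg D : exists2 sg : R, `|sg| = 1 & 0 <= sg * D.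
    by have [h|h] := leP 0 D; [exists 1; rewrite ?normr1 ?mul1r|exists (-1); rewrite ?normrN1// mulN1r oppr_ge0 ltW].
  have [sg h1' h2'] := hsg (rdot ('i *: (y - a)) (z - a)).
  by exists sg => //; rewrite rdotZl.
pose w : V := a + sg%:C *: ('i *: (y - a)).
have wa : w - a = sg%:C *: ('i *: (y - a)) by rewrite /w addrAC subrr add0r.
have wr : 7 / 8 * r <= enorm (w - a) <= 9 / 8 * r by rewrite wa enormZ sgE mul1r enormI.
have zr : 7 / 8 * r <= enorm (z - a) <= 9 / 8 * r by rewrite za; lra.
have b1 : 0 < c1 * b by exact: mulr_gt0.
have b2 : 0 < c2 * (c1 * b) by exact: mulr_gt0.
have yw : 0 <= rdot (y - a) (w - a) by rewrite wa rdotZr rdotxI mulr0.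
have wz : 0 <= rdot (w - a) (z - a) by rewrite wa.
rewrite -!mulrA; apply: (h2 _ r w z b2 r0 rR wr zr wz (h2 _ r y w b1 r0 rR yr wr yw ha)).
by rewrite /eball /= subrr enorm0 mulr_gt0.
Qed.

(** Comparison with C + tau (|w - a|^2 - r^2 - 1), which is below C on the sphere and a strict
    subsolution in any direction. *)
Lemma min_principle (C r : R) : 0 < r -> r < R0 ->
  (forall z, enorm (z - a) = r -> (C%:E <= F z)%E) -> forall z, eball a r z -> (C%:E <= F z)%E.
Proof.
move=> r0 rR hC z zr.
apply: (@le_limit_scale _ _ (1 + (r ^+ 2 - sqnorm (z - a)))) => tau tau0.
pose H w := tau * sqnorm (w - a) + (C - tau * (1 + r ^+ 2)).
have -> : C - tau * (1 + (r ^+ 2 - sqnorm (z - a))) = H z by rewrite /H; ring.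
apply: (@comparison (ecball a r) (eball a r) H).
- exact: compact_ecball.
- by move=> w; rewrite /ecball /eball /= => h; apply: le_lt_trans h _.
- by move=> w /ltW.
- exact: open_eball.
- move=> w _; apply: (@continuous_sqnorm_comp a w (fun s => tau * s + (C - tau * (1 + r ^+ 2)))).
  apply: has_deriv_continuous; apply: has_derivD; last exact: has_deriv_cst.
  by apply: has_derivZ; exact: has_deriv_id.
- move=> w wr nU; have wE : enorm (w - a) = r.
    by apply/eqP; rewrite eq_le wr /= leNgt; apply/negP.
  apply: lt_le_trans (hC w wE); rewrite lte_fin /H -sqr_enorm wE; lra.
- move=> w _; have e1 : sqnorm (delta_mx 0 (Ordinal n0) : V) = 1 by exact: sqnorm_delta.
  exists (delta_mx 0 (Ordinal n0)) => //.
  have h := SDlim_add (SDlim_scale tau (SDlim_sqnorm w a e1))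
    (SDlim_cst p k0 (delta_mx 0 (Ordinal n0)) (C - tau * (1 + r ^+ 2)) w).
  apply: SDlim_pos h; rewrite addr0 !mulr_gt0//.
  by apply: ltr_wpDr => //; rewrite mulr_gt0// ltr0n.
- exact: ltW.
Qed.

End Propagation.

Lemma Psi_large (A : R) : exists2 r1, 0 < r1 & forall r, 0 < r < r1 -> A < Psi (r ^+ 2).
Proof.
have A0 : 0 < `|A| + 1 by rewrite ltr_wpDl.
pose t := (`|A| + 1) `^ (- (2 * p)^-1).
have t0 : 0 < t by exact: powR_gt0.
exists t => // r /andP[r0 rt]; apply: (@lt_trans _ _ (Psi (t ^+ 2))); last first.
  by apply: Psi_lt; rewrite ?exprn_gt0// ltrXn2r// ?nnegrE ltW.
rewrite /Psi -(powR_mulrn _ (ltW t0)) /t -!powRrM.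
have -> : - (2 * p)^-1 * (2%:R * - p) = 1 by field; rewrite gt_eqF.
by rewrite powRr1 ?(ltW A0)//; have := ler_norm A; lra.
Qed.

Lemma sphere_mean_ge (C r : R) : 0 <= r ->
  (forall z, enorm (z - a) <= r -> (C%:E <= F z)%E) -> (C%:E <= sphere_mean F a r)%E.
Proof.
move=> r0 hC; have v0 := vol_gt0 R n.
have [C0|C0] := leP 0 C; last first.
  apply: (@le_trans _ _ 0%E); first by rewrite lee_fin ltW.
  by rewrite sphere_meanE; apply: mule_ge0; [rewrite lee_fin invr_ge0 ltW|exact: sphere_int_ge0].
rewrite sphere_meanE -(@lee_pmul2l _ vol%:E)//.
rewrite muleVK// muleC -(@sphere_int_cst R n C%:E a r)// /sphere_int.
have mB : measurable [set t : mC | enorm (toC t) < 1].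
  by rewrite unit_ballE; exact: measurable_eballC.
apply: ge0_le_integral => //.
- by apply: measurable_funTS; exact: measurable_sphere_map.
move=> t _; apply: hC; rewrite addrAC subrr add0r enormZ.
have [->|t0] := eqVneq (toC t) 0; first by rewrite enorm0 mulr0.
have te : 0 < enorm (toC t) by rewrite enorm_gt0.
by rewrite ger0_norm ?(divr_ge0 r0 (ltW te))// divfK ?gt_eqF.
Qed.

Lemma potential_limit : exists2 l, 0 <= l & forall d, 0 < d -> exists2 r1, 0 < r1 & forall r, 0 < r < r1 ->
  [/\ forall z, eball a r z -> (((l - d) * Psi (r ^+ 2))%:E <= F z)%E,
      exists2 z, eball a r z & (F z < ((l + d) * Psi (r ^+ 2))%:E)%E,
      (((l - d) * Psi (r ^+ 2))%:E <= sphere_mean F a r)%E &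
      (sphere_mean F a r <= ((l + d) * Psi (r ^+ 2))%:E)%E].
Proof.
have [l [l0 hl hinf]] := ell_exists; exists l => // d d0.
have d2 : 0 < d / 2 by rewrite divr_gt0.
have [rho [r2 [rhoP r20 hfat]]] := @fat_ball l (d / 2) l0 d2 (hinf 1 ltr01).
have rho8 : 0 < rho < 1 / 8 by move: rhoP; lra.
have [c c0 hc] := hopf_sphere hl rho8.
(* The excess on the whole sphere in units of Psi(r^2): [fat_ball] with d/2 provides (d/2)/4, and
   propagation costs the factor [c]. Half of [dl] is spent on the nearly minimal point of B(a, r),
   half on the constant l Psi(R1^2). *)
pose dl := c * (d / 2 / 4); have dl0 : 0 < dl by rewrite mulr_gt0// divr_gt0.
have [r3 r30 h3] := hinf (dl / 2) (divr_gt0 dl0 (ltr0n _ 2)).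
have [r4 r40 h4] := hinf d d0.
have [r5 r50 h5] := Psi_large (l * Psi (R1 ^+ 2) / (dl / 2)).
have [r6 r60 h6] := Psi_large (l * Psi (R1 ^+ 2) / d).
have low r z : 0 < r -> r < r6 -> r < R1 -> enorm (z - a) <= r -> (((l - d) * Psi (r ^+ 2))%:E <= F z)%E.
  move=> r0 rr6 rR zr; have [->|za] := eqVneq z a; first by rewrite Fa leey.
  have z0 : 0 < enorm (z - a) by rewrite enorm_gt0 subr_eq0.
  have zR : 0 < enorm (z - a) < R1 by rewrite z0/=; apply: le_lt_trans rR.
  apply: le_trans (hl z zR); rewrite lee_fin -sqr_enorm.
  have := h6 r; rewrite r0 rr6 ltr_pdivrMr// => /(_ isT) h.
  have : l * Psi (r ^+ 2) <= l * Psi (enorm (z - a) ^+ 2).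
    rewrite ler_wpM2l//; apply: Psi_le; first exact: exprn_gt0.
    by rewrite lerXn2r// nnegrE ltW.
  by move: h; lra.
pose r1 := Num.min (Num.min (Num.min r2 r3) (Num.min r4 r5)) (Num.min r6 (R1 / 2)).
exists r1; first by rewrite !lt_min r20 r30 r40 r50 r60 divr_gt0.
move=> r /andP[r0]; rewrite !lt_min => /andP[/andP[/andP[rr2 rr3] /andP[rr4 rr5]] /andP[rr6 rr7]].
have rR1 : 2 * r < R1 by lra.
have rR : r < R1 by lra.
have lowr z : enorm (z - a) <= r -> (((l - d) * Psi (r ^+ 2))%:E <= F z)%E by exact: low.
split.
- by move=> z /ltW; exact: lowr.
- by apply: h4; rewrite r0.
- exact: sphere_mean_ge (ltW r0) lowr.
- rewrite leNgt; apply/negP => hS.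
  have hS' : (((l + 2 * (d / 2)) * Psi (r ^+ 2) * vol)%:E < sphere_int F a r)%E.
    rewrite sphere_intE// EFinM muleC lte_pmul2l ?lte_fin ?vol_gt0//.
    by rewrite (_ : 2 * (d / 2) = d)//; field.
  have rr2' : 0 < r < r2 by rewrite r0.
  have [y yr hy] := hfat r rr2' hS'.
  have Pr : 0 < Psi (r ^+ 2) by apply: Psi_gt0; exact: exprn_gt0.
  have PR : 0 < Psi (R1 ^+ 2) by apply: Psi_gt0; exact: exprn_gt0.
  have b0 : 0 < d / 2 / 4 * Psi (r ^+ 2) by rewrite mulr_gt0// divr_gt0.
  have sph : forall z, enorm (z - a) = r ->
      ((l * (Psi (r ^+ 2) - Psi (R1 ^+ 2)) + dl * Psi (r ^+ 2))%:E <= F z)%E.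
    move=> z zr; have := hc _ r y b0 r0 rR1 yr _ z zr.
    rewrite mulrA -sqr_enorm zr; apply => w wy; apply: le_trans (hy w wy).
    by rewrite lee_fin lerD2r ler_wpM2l// gerBl ltW.
  have rr3' : 0 < r < r3 by rewrite r0.
  have [z zr] := h3 r rr3'; apply/negP; rewrite -leNgt.
  apply: le_trans (min_principle r0 (lt_trans rR R1R0) sph zr); rewrite lee_fin.
  have := h5 r; rewrite r0 rr5 ltr_pdivrMr ?divr_gt0// => /(_ isT).
  by lra.
Qed.

End Potential.

(** * From subharmonic functions to supersolutions *)

Section Reduction.
Variables (R : realType) (n : nat).
Local Notation mR := (measurableTypeR R).
Local Notation mC := ((n + n).-tuple mR).
Local Notation V := 'rV[R[i]]_n.
Local Notation mu := (leb R n).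
Local Notation toC := (@toC R n).

Lemma rational_in_eball (z : V) (d : R) : 0 < d -> exists (q q' : 'rV[rat]_n),
  enorm (z - (\row_j (ratr (q 0 j) +i* ratr (q' 0 j)))) < d.
Proof.
move=> d0; pose e := d / (2 * (n%:R + 1)).
have n1 : 0 < n%:R + 1 :> R by rewrite ltr_wpDl.
have e0 : 0 < e by rewrite divr_gt0// mulr_gt0.
have rat_close (x : R) : exists q : rat, `|x - ratr q| <= e.
  have [q] := rat_in_itvoo (ltr_pwDr e0 (lexx x)).
  rewrite in_itv /= => /andP[q1 q2]; exists q; rewrite ler0_norm; lra.
have [q hq] := choice rat_close.
exists (\row_j q (complex.Re (z 0 j))), (\row_j q (complex.Im (z 0 j))).
apply: le_lt_trans (enorm_le_sum _) _.
apply: (@le_lt_trans _ _ (\sum_(j < n) (e + e))).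
  by apply: ler_sum => j _; rewrite !mxE ReD ImD ReN ImN /=; apply: lerD.
rewrite sumr_const card_ord -mulr_natl.
have -> : d = (n%:R + 1) * (e + e) by rewrite /e; field; rewrite gt_eqF.
by rewrite ltr_pM2r ?addr_gt0// ltrDl.
Qed.

(** The sigma-algebra on tuples comes from the coordinates, not from the topology of C^n. An open
    set is a countable union of balls with rational centres and radii 1/(k+1), whose preimages are
    measurable. *)
Lemma measurable_open_preimage (O : set V) : open O -> measurable (toC @^-1` O).
Proof.
move=> oO; pose c (q : 'rV[rat]_n * 'rV[rat]_n) : V := \row_j (ratr (q.1 0 j) +i* ratr (q.2 0 j)).
pose B (q : 'rV[rat]_n * 'rV[rat]_n * nat) := if `[< eball (c q.1) (q.2.+1%:R^-1) `<=` O >]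
  then toC @^-1` eball (c q.1) (q.2.+1%:R^-1) else set0.
have -> : toC @^-1` O = \bigcup_q B q.
  apply/seteqP; split=> [t Ot|t [q _]]; last first.
    by rewrite /B; case: asboolP => // h; exact: h.
  have /nbhs_eballP[d d0 dO] : nbhs (toC t) O by exact: open_nbhs_nbhs.
  have d2 : 0 < d / 2 by rewrite divr_gt0.
  have [N Nd] := ltr_add_invr d2; rewrite add0r in Nd.
  have N0 : 0 < N.+1%:R^-1 :> R by rewrite invr_gt0 ltr0n.
  have [q [q' hq]] := rational_in_eball (toC t) N0.
  exists (q, q', N) => //; rewrite /B; case: asboolP => [_|h]; first by rewrite /= /eball /=.
  exfalso; apply: h => w; rewrite /eball /= => wq; apply: dO; rewrite /eball /=.
  apply: le_lt_trans (ler_enorm_dist _ (c (q, q')) _) _; rewrite [enorm (c _ - _)]enormB /c /=.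
  move: wq hq Nd; rewrite /c /=; move: (enorm _) (enorm _) (N.+1%:R^-1) => x y u; lra.
apply: countable_bigcupT_measurable; first exact: countableP.
by move=> q; rewrite /B; case: asboolP => _; [exact: measurable_eballC|exact: measurable0].
Qed.

Section Extension.
Variables (Om : set V) (u : V -> \bar R) (a : V) (R0 : R).
Hypothesis oOm : open Om.
Hypothesis iu : loc_integrable Om u.
Hypothesis RO : ecball a R0 `<=` Om.

(** The function F of the introduction, extended by 0 to be globally defined. When u < 0 on the ball
    this keeps it nonnegative, so that integrals over the whole space and Tonelli apply. *)
Definition opp_ext (z : V) : \bar R := if z \in eball a R0 then (- u z)%E else 0%E.

Lemma opp_extE z : eball a R0 z -> opp_ext z = (- u z)%E.
Proof. by move=> zR; rewrite /opp_ext mem_set. Qed.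

Lemma measurable_u : measurable_fun (toC @^-1` Om) (u \o toC).
Proof. by case: iu. Qed.

Lemma measurable_opp_ext : measurable_fun setT (opp_ext \o toC).
Proof.
have mB : measurable (toC @^-1` eball a R0) by exact: measurable_eballC.
have -> : opp_ext \o toC = (fun t => (- u (toC t))%E) \_ (toC @^-1` eball a R0).
  apply/funext => t; rewrite patchE /opp_ext /=.
  have [h|h] := boolP (toC t \in eball a R0); first by rewrite mem_set//; exact: set_mem.
  by rewrite memNset// => h'; move/negP: h; apply; exact: mem_set.
apply/(measurable_restrictT _ mB); apply: measurableT_comp => //.
apply: measurable_funS measurable_u; first exact: measurable_open_preimage.
by move=> t; rewrite /= /eball /= => /ltW; exact: RO.
Qed.

Lemma sphere_mean_opp_ext z r : 0 <= r -> ecball z r `<=` eball a R0 ->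
  sphere_mean u z r = sphere_mean (fun w => - opp_ext w)%E z r.
Proof.
move=> r0 zr; congr (_ * _)%E; apply: eq_integral => t _.
rewrite opp_extE ?oppeK//; apply: zr; rewrite /ecball /= addrAC subrr add0r enormZ.
have [->|t0] := eqVneq (toC t) 0; first by rewrite enorm0 mulr0.
have te : 0 < enorm (toC t) by rewrite enorm_gt0.
by rewrite ger0_norm ?(divr_ge0 r0 (ltW te))// divfK ?gt_eqF.
Qed.

(** Here [u] has no definite sign; its integral is at most that of its positive part, which is
    bounded by [C]. *)
Lemma sphere_mean_le (C r : R) : 0 <= C -> 0 <= r -> r < R0 ->
  (forall z, eball a R0 z -> (u z <= C%:E)%E) -> (sphere_mean u a r <= C%:E)%E.
Proof.
move=> C0 r0 rR uC; have v0 := vol_gt0 R n.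
have rE : ecball a r `<=` eball a R0 by move=> z; rewrite /ecball /eball /= => /le_lt_trans; apply.
rewrite sphere_mean_opp_ext// sphere_meanE -(@lee_pmul2l _ (vol R n)%:E)//.
rewrite muleVK// muleC -(@sphere_int_cst R n C%:E a r)// /sphere_int.
have mB : measurable [set t : mC | enorm (toC t) < 1].
  by rewrite unit_ballE; exact: measurable_eballC.
rewrite integralE; set A := integral _ _ _; set B := integral _ _ _.
have B0 : (0 <= B)%E by apply: integral_ge0 => t _; exact: funeneg_ge0.
apply: (@le_trans _ _ A); first by rewrite -[leRHS]adde0; apply: leeD => //; rewrite oppe_le0.
have mf : measurable_fun setT (fun t : mC => (- opp_ext (a + (r / enorm (toC t))%:C *: toC t))%E).
  by apply: measurableT_comp => //; exact: measurable_sphere_map measurable_opp_ext _.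
apply: ge0_le_integral => //.
- by apply: measurable_funepos; exact: measurable_funTS.
- move=> t _; rewrite funeposE ge_max lee_fin C0 andbT /opp_ext.
  by case: ifPn => [/set_mem/uC|_]; rewrite ?oppeK ?oppe0 ?lee_fin.
Qed.

Hypothesis uneg : forall z, eball a R0 z -> (u z < 0)%E.

Lemma opp_ext_ge0 z : (0 <= opp_ext z)%E.
Proof. by rewrite /opp_ext; case: ifPn => // /set_mem /uneg /ltW; rewrite oppe_ge0. Qed.

Lemma opp_ext_integrable : (\int[mu]_t opp_ext (toC t) < +oo)%E.
Proof.
have [_ /(_ _ (@compact_ecball R n a R0) RO)] := iu; apply: le_lt_trans.
rewrite [leRHS]integral_mkcond; apply: ge0_le_integral => //.
- by move=> t _; exact: opp_ext_ge0.
- exact: measurable_opp_ext.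
- apply/(measurable_restrictT _ (measurable_ecballC _ _)).
  apply: measurableT_comp => //; apply: measurable_funS measurable_u; first exact: measurable_open_preimage.
  by move=> t; exact: RO.
move=> t _; rewrite patchE /opp_ext; have [h|h] := boolP (toC t \in eball a R0).
  have ha : eball a R0 (toC t) by exact: set_mem.
  by rewrite mem_set; [rewrite lte0_abs//; exact: uneg|exact: ltW].
by case: ifP.
Qed.

Lemma sphere_mean_oppE z r : 0 <= r -> ecball z r `<=` eball a R0 ->
  sphere_mean u z r = (- sphere_mean opp_ext z r)%E.
Proof.
move=> r0 zr; rewrite sphere_mean_opp_ext// /sphere_mean integral_ge0N ?muleN//.
by move=> t _; exact: opp_ext_ge0.
Qed.

Lemma opp_ext_supermean : subharmonic Om u -> forall z r, 0 < r -> ecball z r `<=` eball a R0 ->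
  (sphere_mean opp_ext z r <= opp_ext z)%E.
Proof.
move=> [_ hu] z r r0 zr.
have za : eball a R0 z by apply: zr; rewrite /ecball /= subrr enorm0 ltW.
rewrite (opp_extE za) leeNr -(sphere_mean_oppE (ltW r0) zr); apply: hu => // w /zr.
by rewrite /eball /= => /ltW; exact: RO.
Qed.

Lemma opp_ext_lsc : usc_on Om u -> forall z c, eball a R0 z -> (c%:E < opp_ext z)%E ->
  \forall w \near z, (c%:E < opp_ext w)%E.
Proof.
move=> hu z c za; rewrite (opp_extE za) lteNr -EFinN => uz.
have zO : Om z by apply: RO; exact: ltW.
have := hu z zO _ uz; have : nbhs z (eball a R0) by apply: open_nbhs_nbhs; split => //; exact: open_eball.
apply: filterS2 => w wa uw; rewrite (opp_extE wa) lteNr -EFinN; exact: uw.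
Qed.

End Extension.
End Reduction.


Lemma has_deriv_unique (R : realType) (f : R -> R) x b c : has_deriv f x b -> has_deriv f x c -> b = c.
Proof. by move=> /has_derivP[_ <-] /has_derivP[_ <-]. Qed.

Lemma has_deriv_supp (R : realType) (f f1 : R -> R) r : (forall x, has_deriv f x (f1 x)) ->
  (forall x, r < x -> f x = 0) -> forall x, r < x -> f1 x = 0.
Proof.
move=> df fr x rx; apply: has_deriv_unique (df x) _; apply: has_deriv_near (has_deriv_cst x 0).
by near=> y; rewrite fr//; near: y; exact: lt_nbhsr.
Unshelve. all: end_near. Qed.

Lemma bounded_supp (R : realType) (f : R -> R) r : 0 <= r -> continuous f -> (forall x, r < x -> f x = 0) ->
  exists C, forall x, 0 <= x -> `|f x| <= C.
Proof.
move=> r0 cf fr.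
have cn : {within `[0, r], continuous (fun x => `|f x|)}.
  apply: continuous_subspaceT => x; apply: continuous_comp; [exact: cf|exact: norm_continuous].
have [c _ hc] := EVT_max r0 cn.
exists `|f c| => x x0; have [xr|xr] := leP x r; last by rewrite fr// normr0.
by apply: hc; rewrite in_itv /= x0.
Qed.

(** * The Hessian inequality for the extended function *)

Section HessianInequality.
Variables (R : realType) (k : nat).
Local Notation n := (k.+2).
Local Notation mR := (measurableTypeR R).
Local Notation mC := ((n + n).-tuple mR).
Local Notation V := 'rV[R[i]]_n.
Local Notation toC := (@toC R n).

(** The tested expression vanishes off the ball of radius [r] about [c], which lies where the
    extension equals - u. The integral over [Om] therefore becomes one over the whole space, with
    the positive factor k! 4^n divided out. *)
Lemma opp_ext_hessian m (Om : set V) (u : V -> \bar R) (a : V) (R0 : R) e c (g g1 g2 : R -> R) r :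
  (1 <= m)%N -> (m < n)%N -> open Om -> loc_integrable Om u -> hessian_nonneg m Om u ->
  ecball a R0 `<=` Om -> (forall z, eball a R0 z -> (u z < 0)%E) ->
  sqnorm e = 1 -> elementary (fun z : V => g (sqnorm (z - c))) ->
  (forall x, has_deriv g x (g1 x)) -> (forall x, has_deriv g1 x (g2 x)) -> continuous g2 ->
  (forall x, 0 <= g x) -> (forall x, r ^+ 2 < x -> g x = 0) -> 0 <= r ->
  ecball c r `<=` eball a R0 ->
  wint (leb R n) (dens (opp_ext u a R0)) (fun t => hopr (n%:R / m%:R - 1) (m.-1%:R * (n%:R / m%:R)) e
    (g1 (sqnorm (toC t - c))) (g2 (sqnorm (toC t - c))) (toC t - c)) <= 0.
Proof.
move=> m1 mn oOm iu hu RO uneg e1 eg dg dg1 cg2 g0 gr r0 cR.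
have cO : ecball c r `<=` Om by move=> z /cR; rewrite /eball /= => /ltW; exact: RO.
have := radial_hessian m1 mn hu e1 eg dg dg1 g0 gr r0 cO.
have g1r := has_deriv_supp dg gr; have g2r := has_deriv_supp dg1 g1r.
have cg1 : continuous g1 by move=> x; exact: has_deriv_continuous (dg1 x).
have [C1 hC1] := bounded_supp (sqr_ge0 r) cg1 g1r.
have [C2 hC2] := bounded_supp (sqr_ge0 r) cg2 g2r.
pose h (t : mC) := hopr (n%:R / m%:R - 1) (m.-1%:R * (n%:R / m%:R)) e
    (g1 (sqnorm (toC t - c))) (g2 (sqnorm (toC t - c))) (toC t - c).
have bh : bnd_measurable h.
  apply: (@bnd_hopr _ _ _ _ _ c g1 g2 (Num.max C1 C2) r) => //; try exact: continuous_measurable_fun.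
    by move=> x x0; rewrite le_max hC1.
  by move=> x x0; rewrite le_max hC2// orbT.
have h0 t : ~ ecball c r (toC t) -> h t = 0.
  rewrite /ecball /= => /negP; rewrite -ltNge => tr.
  have sr : r ^+ 2 < sqnorm (toC t - c) by rewrite -sqr_enorm ltrXn2r// nnegrE ?enorm_ge0.
  by rewrite /h g1r// g2r// /hopr !(mulr0, mul0r, addr0).
pose K : R := k`!%:R * 4 ^+ n.
have K0 : 0 < K by rewrite mulr_gt0 ?exprn_gt0// ltr0n fact_gt0.
have bN : bnd_measurable (fun t => - K * h t) by exact: bnd_measurableZ.
have [mF iF F0] : [/\ measurable_fun setT (opp_ext u a R0 \o toC),
   (\int[leb R n]_t opp_ext u a R0 (toC t) < +oo)%E & forall z, (0 <= opp_ext u a R0 z)%E].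
  split; [exact: (measurable_opp_ext oOm iu RO)|exact: (opp_ext_integrable oOm iu RO uneg)|
          exact: (opp_ext_ge0 uneg)].
rewrite integral_mkcond.
rewrite (_ : integral _ _ _ = \int[leb R n]_t (opp_ext u a R0 (toC t) * (- K * h t)%:E)%E)%E; last first.
  apply: eq_integral => t _; rewrite patchE -/(h t).
  have [tc|tc] := pselect (ecball c r (toC t)).
    rewrite mem_set; last exact: cO.
    rewrite opp_extE ?mulNr ?EFinN ?muleN ?mulNe ?oppeK//; exact: cR.
  have ht : h t = 0 by exact: h0.
  have ht' : hop m e g1 g2 (toC t - c) = 0 by exact: ht.
  by rewrite ht ht' !mulr0 !mule0; case: ifP.
rewrite int_F_wint// lee_fin (wintZ (dens_int F0 mF iF) (- K) bh).
by rewrite mulNr oppr_ge0 pmulr_rle0.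
Qed.
End HessianInequality.


(** * Limits of the two quotients *)

Lemma phi_invE (R : realType) (n m : nat) (r : R) : 0 < r ->
  (phi n m r)^-1 = - ((n%:R / m%:R - 1) * (Psi (n%:R / m%:R - 1) (r ^+ 2))^-1).
Proof.
move=> r0; rewrite /phi invrN invrK /Psi powRN invrK.
by rewrite -(powR_mulrn 2 (ltW r0)) -powRrM.
Qed.

(** Since 1 / phi_m(r) = - p / Psi(r^2), the bounds on [S] squeeze the quotient towards p l. They
    also force [S r] to be finite near 0, which brings the argument back to real numbers. *)
Lemma quotient_cvg (R : realType) (n m : nat) (S : R -> \bar R) (l : R) : 0 < n%:R / m%:R - 1 :> R ->
  (forall d, 0 < d -> exists2 r1, 0 < r1 & forall r, 0 < r < r1 ->
    ((- ((l + d) * Psi (n%:R / m%:R - 1) (r ^+ 2)))%:E <= S r <=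
     (- ((l - d) * Psi (n%:R / m%:R - 1) (r ^+ 2)))%:E)%E) ->
  (S r * ((phi n m r)^-1)%:E)%E @[r --> 0^'+] --> ((n%:R / m%:R - 1) * l)%:E.
Proof.
set p := n%:R / m%:R - 1 => p0 hS; apply/fine_cvgP; split.
  have [r1 r10 h] := hS 1 ltr01; apply/near_right0; exists r1 => // r rr.
  have := h r rr; case: (S r) => [s||] //=; rewrite ?leNye ?leeNy_eq ?leye_eq ?andbF//.
apply/cvgrPdist_le => e e0; have [r1 r10 h] := hS (e / p) (divr_gt0 e0 p0).
apply/near_right0; exists r1 => // r rr; have r0 : 0 < r by case/andP: rr.
have P0 : 0 < Psi p (r ^+ 2) by apply: Psi_gt0; exact: exprn_gt0.
have := h r rr; rewrite /= phi_invE// -/p.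
case: (S r) => [s| |] /=; rewrite ?leye_eq ?leeNy_eq ?andbF//.
rewrite !lee_fin => /andP[s1 s2].
have sE : p * l - s * - (p * (Psi p (r ^+ 2))^-1) = p * ((l * Psi p (r ^+ 2) + s) / Psi p (r ^+ 2)).
  by field; rewrite gt_eqF.
rewrite sE normrM (gtr0_norm p0) mulrC -ler_pdivlMr// normrM normfV (gtr0_norm P0) ler_pdivrMr//.
by rewrite ler_norml; move: s1 s2; move: (Psi _ _) => P; lra.
Qed.

Lemma sup_ball_ge (R : realType) n (u : 'rV[R[i]]_n -> \bar R) a z r :
  eball a r z -> (u z <= sup_ball u a r)%E.
Proof. by move=> zr; apply: ereal_sup_ubound; exists z. Qed.

Lemma sup_ball_le (R : realType) n (u : 'rV[R[i]]_n -> \bar R) a r (C : \bar R) :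
  (forall z, eball a r z -> (u z <= C)%E) -> (sup_ball u a r <= C)%E.
Proof. by move=> h; apply: ge_ereal_sup => _ [z zr <-]; exact: h. Qed.

Lemma common_limit (R : realType) (n m : nat) (Om : set 'rV[R[i]]_n) (u : 'rV[R[i]]_n -> \bar R) a :
  (1 <= m)%N -> (m < n)%N -> open Om -> SH m Om u -> Om a ->
  exists l : \bar R, (sup_ball u a r * ((phi n m r)^-1)%:E)%E @[r --> 0^'+] --> l /\
    (sphere_mean u a r * ((phi n m r)^-1)%:E)%E @[r --> 0^'+] --> l.
Proof.
(* The cases n = 0 and n = 1 contradict 1 <= m < n; the trace formulas are stated in dimension k +
   2. *)
case: n Om u a => [|[|k]] Om u a m1 mn oOm [ulty iu uu su hu] Oma; [by []|by move: mn; rewrite ltnNge m1|].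
set n := k.+2 in Om u a mn oOm ulty iu uu su hu Oma *.
have n0 : (0 < n)%N by [].
have m0 : 0 < m%:R :> R by rewrite ltr0n.
have p0 : 0 < n%:R / m%:R - 1 :> R by rewrite subr_gt0 ltr_pdivlMr// mul1r ltr_nat.
have bound (C : R) : (u a < C%:E)%E -> exists2 R0, 0 < R0 &
    ecball a R0 `<=` Om /\ forall z, eball a R0 z -> (u z < C%:E)%E.
  move=> /(uu a Oma) /nbhs_eballP[d1 d10 h1].
  have /nbhs_eballP[d2 d20 h2] : nbhs a Om by exact: open_nbhs_nbhs.
  have d0 : 0 < Num.min d1 d2 by rewrite lt_min d10.
  have dlt : Num.min d1 d2 / 2 < Num.min d1 d2 by lra.
  exists (Num.min d1 d2 / 2); first exact: divr_gt0.
  split=> z; rewrite /ecball /eball /= => zd.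
    by apply: h2; have := le_lt_trans zd dlt; rewrite /eball /= lt_min => /andP[].
  by apply: h1; have := lt_trans zd dlt; rewrite /eball /= lt_min => /andP[].
have fin_or : u a = -oo%E \/ exists c : R, u a = c%:E.
  by have := ulty a Oma; case: (u a) => [c| |] //; [right; exists c|left].
have [uaN|[c uac]] := fin_or; last first.
  have uac' : (u a < (`|c| + 1)%:E)%E by rewrite uac lte_fin; have := ler_norm c; lra.
  have [R0 R00 [RO uC]] := bound _ uac'.
  have c1 : 0 <= `|c| + 1 by rewrite addr_ge0.
  have [_ submean] := su.
  (* A bounded quantity satisfies the bounds of [quotient_cvg] with l = 0, because Psi(r^2) tends to
     infinity. *)
  have small (S : R -> \bar R) : (forall r, 0 < r < R0 -> (c%:E <= S r <= (`|c| + 1)%:E)%E) ->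
      (S r * ((phi n m r)^-1)%:E)%E @[r --> 0^'+] --> ((n%:R / m%:R - 1) * 0)%:E.
    move=> hS; apply: quotient_cvg => // d d0.
    have [r1 r10 h1] := Psi_large p0 ((`|c| + 1) / d).
    exists (Num.min r1 R0); first by rewrite lt_min r10.
    move=> r /andP[r0]; rewrite lt_min => /andP[rr1 rR].
    have := h1 r; rewrite r0 rr1 ltr_pdivrMr// => /(_ isT) h.
    have /andP[s1 s2] : (c%:E <= S r <= (`|c| + 1)%:E)%E by apply: hS; rewrite r0.
    have := ler_norm (- c); rewrite normrN => hc.
    apply/andP; split; [apply: le_trans s1|apply: (le_trans s2)]; rewrite lee_fin; lra.
  exists ((n%:R / m%:R - 1) * 0)%:E; split; apply: small => r /andP[r0 rR]; apply/andP; split.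
  - by rewrite -uac; apply: sup_ball_ge; rewrite /eball /= subrr enorm0.
  - by apply: sup_ball_le => z zr; apply/ltW/uC; exact: lt_trans rR.
  - by rewrite -uac; apply: submean => // z zr; apply: RO; exact: le_trans (ltW rR).
  - by apply: (sphere_mean_le oOm iu RO) => //; [exact: ltW|move=> z zR; apply/ltW/uC].
(* Now u(a) = -oo, and upper semicontinuity makes [u] negative on a small ball, so that F = - u is
   positive there. *)
have [R0 R00 [RO uneg]] : exists2 R0, 0 < R0 &
    ecball a R0 `<=` Om /\ forall z, eball a R0 z -> (u z < 0)%E.
  by apply: (bound 0); rewrite uaN ltNyr.
pose F := opp_ext u a R0.
(* p + 1 = n/m and p + k0 = n - 1. *)
have pk : (n%:R / m%:R - 1) * n%:R + m.-1%:R * (n%:R / m%:R) =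
    (n%:R / m%:R - 1 + 1) * (n%:R / m%:R - 1 + m.-1%:R * (n%:R / m%:R)) :> R.
  by rewrite -subn1 natrB//; field; rewrite gt_eqF.
have k00 : 0 <= m.-1%:R * (n%:R / m%:R) :> R by rewrite mulr_ge0// divr_ge0.
have Fpos z : eball a R0 z -> (0 < F z)%E by move=> zR; rewrite /F opp_extE// oppe_gt0; exact: uneg.
have aR : eball a R0 a by rewrite /eball /= subrr enorm0.
have Fa : F a = +oo%E by rewrite /F opp_extE// uaN.
have R2 : 0 < R0 / 2 by rewrite divr_gt0.
have R2R : R0 / 2 < R0 by lra.
have hopF (e c : 'rV[R[i]]_n) (g g1 g2 : R -> R) r : sqnorm e = 1 ->
    elementary (fun z => g (sqnorm (z - c))) ->
    (forall x, has_deriv g x (g1 x)) -> (forall x, has_deriv g1 x (g2 x)) -> continuous g2 ->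
    (forall x, 0 <= g x) -> (forall x, r ^+ 2 < x -> g x = 0) -> 0 <= r ->
    ecball c r `<=` eball a R0 ->
    wint (leb R n) (dens F) (fun t => hopr (n%:R / m%:R - 1) (m.-1%:R * (n%:R / m%:R)) e
      (g1 (sqnorm (toC t - c))) (g2 (sqnorm (toC t - c))) (toC t - c)) <= 0.
  move=> e1 eg dg dg1 cg2 g0 gr r0 cR.
  exact: (opp_ext_hessian m1 mn oOm iu hu RO uneg e1 eg dg dg1 cg2 g0 gr r0 cR).
have [l l0 hl] := potential_limit n0 R00 (opp_ext_ge0 uneg) (measurable_opp_ext oOm iu RO)
  (opp_ext_integrable oOm iu RO uneg) (opp_ext_supermean RO uneg su) p0 k00
  (opp_ext_lsc RO uu) hopF pk Fpos Fa R2 R2R.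
exists ((n%:R / m%:R - 1) * l)%:E; split; apply: quotient_cvg => // d d0; have [r1 r10 h] := hl d d0.
  exists (Num.min r1 R0); first by rewrite lt_min r10.
  move=> r /andP[r0]; rewrite lt_min => /andP[rr1 rR].
  have rr : 0 < r < r1 by rewrite r0.
  have [h1 [z zr h2] _ _] := h r rr.
  have uF w : eball a r w -> u w = (- F w)%E.
    by move=> wr; rewrite /F opp_extE ?oppeK//; exact: lt_trans rR.
  apply/andP; split.
    apply: le_trans (sup_ball_ge u zr); rewrite (uF z zr) EFinN leeN2; exact: ltW.
  by apply: sup_ball_le => w wr; rewrite (uF w wr) EFinN leeN2; exact: h1.
exists (Num.min r1 R0); first by rewrite lt_min r10.
move=> r /andP[r0]; rewrite lt_min => /andP[rr1 rR].
have rr : 0 < r < r1 by rewrite r0.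
have [_ _ h1 h2] := h r rr.
rewrite (sphere_mean_oppE uneg (ltW r0)); last first.
  by move=> z zr; exact: le_lt_trans rR.
by rewrite !EFinN !leeN2 h1 h2.
Qed.

(** Convergence is asserted separately because [lim] takes a default value where no limit exists.
    Both quotients have the common limit provided by [common_limit]. *)
Theorem theorem8p1 (R : realType) (n m : nat) (Om : set 'rV[R[i]]_n)
    (u : 'rV[R[i]]_n -> \bar R) (a : 'rV[R[i]]_n) :
  (1 <= m)%N -> (m < n)%N ->
  open Om -> connected Om ->
  SH m Om u -> Om a ->
  cvg ((sup_ball u a r * ((phi n m r)^-1)%:E)%E @[r --> 0^'+]) /\
  lelong m u a = (2%:E * lim ((sup_ball u a r * ((phi n m r)^-1)%:E)%E @[r --> 0^'+]))%E.
Proof.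
move=> m1 mn oOm _ hu Oma; have [l [h1 h2]] := common_limit m1 mn oOm hu Oma.
by split; [apply/cvg_ex; exists l|rewrite /lelong (cvg_lim _ h1)// (cvg_lim _ h2)].
Qed.
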